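(* Let $\mathfrak b_n$ be the Bohr radius of $\mathbb D^n$. Then, for every \[ A>2\beta_\star+\frac32 \] and all sufficiently large $n$, \[ \sqrt{\frac{\log n-A\log\log n}{n}}\le\mathfrak b_n\le\sqrt{\frac{\log n}{n}}\exp\!\left\{\left(\frac34+o(1)\right)\frac{\log\log n}{\log n}\right\}. \] Consequently, \[ \mathfrak b_n=\sqrt{\frac{\log n}{n}}\left(1+O\!\left(\frac{\log\log n}{\log n}\right)\right). \] More precisely, \begin{align*} \limsup_{n\to\infty}\frac{\log n}{\log\log n}\left(1-\mathfrak b_n\sqrt{\frac n{\log n}}\right)&\le\beta_\star+\frac34,\\ \limsup_{n\to\infty}\frac{\log n}{\log\log n}\left(\mathfrak b_n\sqrt{\frac n{\log n}}-1\right)&\le\frac34 . \end{align*}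
   Context: $\mathfrak b_n$ is the largest $r\in(0,1)$ such that every polynomial $f(z)=\sum_{\alpha\in\mathbb N_0^n}a_\alpha z^\alpha$ satisfies $\sum_\alpha|a_\alpha|r^{|\alpha|}\le\|f\|_{L^\infty(\mathbb D^n)}$. The $o(1)$ and $O(\cdot)$ terms are as $n\to\infty$. The constant $\beta_\star$ is defined as follows. Let $h(a)=-a\log a-(1-a)\log(1-a)$ for $0<a<1$, let $a_{\max}=\frac12\bigl(1-\frac1{\sqrt2}\bigr)$, and for $0<a<a_{\max}$ put \[ \mu(a)=\frac{1+\sqrt{2(1-2a)^2-1}}2,\qquad B_{\rm diff}(a)=\frac{\log(2\sqrt{e})}{h(a)}-\frac12,\qquad B_{\rm cap}(a)=\frac{3}{2\mu(a)} . \] Then $\beta_\star=\inf_{0<a<a_{\max}}\max\{B_{\rm diff}(a),B_{\rm cap}(a)\}$ (numerically $2.468449871619\ldots$). *)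

(* Defs.v *)
From mathcomp Require Export all_boot all_order all_algebra.
From mathcomp Require Export all_classical all_reals all_analysis.
From mathcomp Require Export complex.
(* Not imported: its notations clash with those of MathComp-Analysis. *)
From mathcomp Require mpoly.

Set Implicit Arguments.
Unset Strict Implicit.
Unset Printing Implicit Defensive.

Import Order.TTheory GRing.Theory Num.Theory.
Import numFieldNormedType.Exports.

Local Open Scope classical_set_scope.
Local Open Scope ring_scope.

(* [Normc.normc : R[i] -> R] is the complex modulus with values in the base
   field; the generic norm on [R[i]] takes its values in [R[i]]. *)
Local Notation normc := ComplexField.Normc.normc.

Section BohrRadius.
Variable R : realType.

Definition polydisc (n : nat) : set ('I_n -> R[i]) :=
  [set z | forall i, normc (z i) < 1].

Arguments polydisc n : clear implicits.

(* The L^oo norm over the open polydisc.  A polynomial is continuous, so its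
   essential supremum is its supremum; the value is finite, and taking it in
   [\bar R] only avoids the default value of the real supremum. *)
Definition polydisc_norm (n : nat) (f : mpoly.mpoly n R[i]) : \bar R :=
  ereal_sup [set (normc (mpoly.meval z f))%:E | z in polydisc n].

Definition majorant_sum (n : nat) (f : mpoly.mpoly n R[i]) (r : R) : R :=
  \sum_(m <- mpoly.msupp f) normc (mpoly.mcoeff m f) * r ^+ mpoly.mdeg m.

Definition bohr_set (n : nat) : set R :=
  [set r | 0 < r < 1 /\
    forall f : mpoly.mpoly n R[i],
      ((majorant_sum f r)%:E <= polydisc_norm f)%E].

(* The supremum is total; [bohr_radius_largest] identifies it with the
   largest element of [bohr_set n].  (For n = 0 every r in (0, 1) qualifies
   and there is no largest one; only large n matter below.) *)
Definition bohr_radius (n : nat) : R := sup (bohr_set n).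

Lemma bohr_radius_largest (n : nat) (b : R) :
  bohr_set n b -> ubound (bohr_set n) b -> bohr_radius n = b.
Proof.
move=> Sb ub; apply/eqP; rewrite eq_le; apply/andP; split.
  by apply: ge_sup => //; exists b.
by apply: ub_le_sup => //; exists b.
Qed.

End BohrRadius.

Section BetaStar.
Variable R : realType.
Implicit Type a : R.

Definition entropy a : R := - a * ln a - (1 - a) * ln (1 - a).

Definition a_max : R := 2^-1 * (1 - (Num.sqrt 2)^-1).

Definition mu a : R := (1 + Num.sqrt (2 * (1 - 2 * a) ^+ 2 - 1)) / 2.

Definition B_diff a : R := ln (2 * Num.sqrt (expR 1)) / entropy a - 2^-1.

Definition B_cap a : R := 3 / (2 * mu a).

Definition beta_star : R :=
  inf [set Num.max (B_diff a) (B_cap a) | a in [set a | 0 < a < a_max]].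

End BetaStar.

Arguments bohr_radius R n : clear implicits.
Arguments beta_star R : clear implicits.

(* Main.v *)
Require Import Defs.
From mathcomp Require Import cyclic separable cyclotomic zify ring lra.

(* With L = ln n and l = ln L, the theorem reduces to two bounds valid for large n,
     sqrt ((L - 89/20 * l) / n) <= b_n <= sqrt (L / n) * (1 + 3/4 * l / L),
   because beta_star >= 3/2, so that every admissible A exceeds 9/2 > 89/20, and
   the error e may be taken to be 0.

   Lower bound.  Let |f| <= 1 on the torus, with coefficients a.  Averaging
   1 - Re f bounds each homogeneous part by 2 (1 - |a_0|), so it suffices that, for
   homogeneous parts of modulus at most 1, the sums of the |a_al| r^|al| over
   |al| = m add up to at most 1/2.
   For the squarefree al the Bohnenblust-Hille constant is polynomial in the degree:
     sum_(|T| = m) |a_T| <= D m^(6/5) C(n, m)^(1/2 - 1/(2m)).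
   This follows from a bound on the a_T in l^p, p = 2m/(m+1), which comes from
   splitting the variables into two random halves.  Blei's inequality for the pair of halves and hypercontractivity on the torus bound the degree-k
   constant by 9/4 times the degree-k/2 constant, and 9/4 < 2^(6/5).  The induction is
   run for all degrees in a window of width O(sqrt k) around k and for inhomogeneous
   polynomials, since a random half meets T in about |T|/2 elements.  The al that are
   not squarefree, and those of degree above 8L, are handled by Cauchy-Schwarz.

   Upper bound.  For m = floor L take a random sign combination of the squarefree
   monomials of degree m.  It has degree one in each variable, so its supremum over the
   polydisc is attained up to a constant at the vertices of a product of regular
   polygons, where a Chernoff bound applies.

   All averages over the torus are finite: they run over roots of unity of order
   larger than the degrees involved. *)

Set Implicit Arguments.
Unset Strict Implicit.
Unset Printing Implicit Defensive.

Import Order.TTheory GRing.Theory Num.Theory.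
Import numFieldNormedType.Exports.

Local Open Scope ring_scope.

(** Cauchy-Schwarz alone bounds the degree-m sum by sqrt(C(n, m) r^(2m)). Up to powers of L these
    bounds add up to exp(n r^2 / 2), which is sqrt(n) L^(-A/2) at r^2 = (L - A l) / n. The
    Bohnenblust-Hille exponent supplies the missing factor, C(n, m)^(-1/(2m)) <= sqrt(m / n). For m
    <= 8L and a constant m^kappa, what remains is L^(kappa + 1 - A/2), so A > 2 kappa + 2 suffices.
    As A > 9/2 is given, any kappa < 5/4 would do, and kappa = 6/5 leaves room for 89/20. Each
    halving must therefore lose less than 2^(5/4). Interpolation between L^2 and L^4 costs 2^(l/j)
    for halves of degrees j and l, a factor near 2 when these are nearly equal. The other losses
    (Blei's weights, bad random sets, the window) are close to 1 once the degree is large; the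
    recursion stops at a degree whose constant is enormous but independent of n. In the upper bound,
    m near L makes n^(1/(2m)) close to sqrt(e), which cancels the e^(-1/2) coming from m!. *)

Local Notation normc := ComplexField.Normc.normc.

(** * The complex modulus and roots of unity *)

Section ComplexModulus.
Variable R : realType.
Implicit Types z w : R[i].

Lemma normcR z : `|z| = (normc z)%:C%C.
Proof. by []. Qed.

Lemma normc_ge0 z : 0 <= normc z.
Proof. by case: z => a b; apply: sqrtr_ge0. Qed.

Lemma normc_eq0 z : (normc z == 0) = (z == 0).
Proof. by rewrite -(@normr_eq0 _ _ z) normcR -(inj_eq (@complexI R)). Qed.

Lemma normc_prod I r (P : pred I) (F : I -> R[i]) :
  normc (\prod_(i <- r | P i) F i) = \prod_(i <- r | P i) normc (F i).
Proof.
elim/big_rec2: _ => [|i x y _ <-]; first exact: ComplexField.Normc.normc1.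
exact: ComplexField.Normc.normcM.
Qed.

Lemma normcX z n : normc (z ^+ n) = normc z ^+ n.
Proof.
elim: n => [|n IHn]; first by rewrite !expr0; exact: ComplexField.Normc.normc1.
by rewrite !exprS -IHn; exact: ComplexField.Normc.normcM.
Qed.

Lemma normc_nat n : normc (n%:R : R[i]) = n%:R.
Proof. by apply: (@complexI R); rewrite -normcR normr_nat rmorph_nat. Qed.

Lemma normcC (x : R) : normc (x%:C)%C = `|x|.
Proof. by rewrite /= expr0n addr0 sqrtr_sqr. Qed.

Lemma le_normc_sum I r (P : pred I) (F : I -> R[i]) :
  normc (\sum_(i <- r | P i) F i) <= \sum_(i <- r | P i) normc (F i).
Proof.
elim/big_ind2: _ => [|x a y b xa yb|//]; first by rewrite ComplexField.Normc.normc0.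
by apply: (le_trans (le_normcD _ _)); apply: lerD.
Qed.

Lemma normc_conj z : normc z^* = normc z.
Proof. by apply: (@complexI R); rewrite -!normcR norm_conjC. Qed.

Lemma normc_sqr z : ((normc z ^+ 2)%:C)%C = z * z^*.
Proof. by rewrite rmorphXn /= -normcR normCK. Qed.

Lemma primitive_root_exists n : (0 < n)%N -> {w : R[i] | n.-primitive_root w}.
Proof.
move=> n0; have [r Dp] := closed_field_poly_normal ('X^n - 1 : {poly R[i]}).
rewrite lead_coefXnsubC // scale1r in Dp.
have r1 : all n.-unity_root r by apply/allP => z; rewrite -root_prod_XsubC -Dp.
have ur : uniq r.
  by rewrite -separable_prod_XsubC -Dp separable_Xn_sub_1 // pnatr_eq0 -lt0n.
have sr : (n < (size r).+1)%N.
  by rewrite -(size_prod_XsubC r id) -Dp size_XnsubC.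
have /sig2W[w _] := hasP (cyclic.has_prim_root n0 r1 ur sr).
by exists w.
Qed.

End ComplexModulus.

(** * Averages over roots of unity *)

Section Average.
Variables (T : finType) (K : fieldType).
Implicit Type F : T -> K.

(** Stands for the Haar integral. Over an empty type it is 0, hence the cardinality condition of
    [avg_const]. *)
Definition avg F : K := (\sum_x F x) / #|T|%:R.

Lemma avg_sum I r (P : pred I) (F : I -> T -> K) :
  avg (fun x => \sum_(i <- r | P i) F i x) = \sum_(i <- r | P i) avg (F i).
Proof. by rewrite /avg exchange_big /= mulr_suml. Qed.

Lemma eq_avg F F' : F =1 F' -> avg F = avg F'.
Proof. by move=> e; rewrite /avg (eq_bigr F'). Qed.

Lemma avgZ (c : K) F : avg (fun x => c * F x) = c * avg F.
Proof. by rewrite /avg -mulr_sumr mulrA. Qed.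

Lemma avgD F F' : avg (fun x => F x + F' x) = avg F + avg F'.
Proof. by rewrite /avg big_split mulrDl. Qed.

End Average.

Lemma avg_const (T : finType) (K : numFieldType) (c : K) :
  (0 < #|T|)%N -> avg (fun _ : T => c) = c.
Proof.
by move=> T0; rewrite /avg sumr_const -[c *+ _]mulr_natr mulfK // pnatr_eq0 -lt0n.
Qed.

Lemma avg_ge0 (T : finType) (K : numFieldType) (F : T -> K) :
  (forall x, 0 <= F x) -> 0 <= avg F.
Proof. by move=> F0; rewrite divr_ge0 // sumr_ge0. Qed.

Lemma ler_avg (T : finType) (K : numFieldType) (F F' : T -> K) :
  (forall x, F x <= F' x) -> avg F <= avg F'.
Proof. by move=> FF'; rewrite ler_wpM2r ?invr_ge0 // ler_sum. Qed.

Lemma normc_avg (R : realType) (T : finType) (F : T -> R[i]) :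
  normc (avg F) <= avg (fun x => normc (F x)).
Proof.
rewrite /avg ComplexField.Normc.normcM ComplexField.Normc.normcV normc_nat.
by rewrite ler_wpM2r ?invr_ge0 // le_normc_sum.
Qed.

Lemma avg_complex (R : realType) (T : finType) (F : T -> R) :
  avg (fun x => (F x)%:C%C) = ((avg F)%:C)%C.
Proof. by rewrite /avg -rmorph_sum /= rmorphM fmorphV rmorph_nat. Qed.

Section Torus.
Variables (R : realType) (n N : nat) (w : R[i]).
Hypothesis wP : N.+1.-primitive_root w.

Local Notation expo := {ffun 'I_n -> 'I_N.+1}.

Implicit Types (a b c : expo -> R[i]) (al be ga x : expo) (u : 'I_n -> R[i]).

(** Exponents and sample points share the type [expo]: the group of n-tuples of (N+1)-st roots of
    unity is its own dual. *)
Definition pt x : 'I_n -> R[i] := fun i => w ^+ x i.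
Definition mon al u : R[i] := \prod_i u i ^+ al i.
Definition deg al : nat := \sum_i al i.
Definition trig b x : R[i] := \sum_be b be * mon be (pt x).

Lemma normc_root : normc w = 1.
Proof.
apply/eqP; rewrite -(@pexpr_eq1 _ _ N.+1) //; last exact: normc_ge0.
by rewrite -normcX (prim_expr_order wP) ComplexField.Normc.normc1.
Qed.

Lemma normc_pt x i : normc (pt x i) = 1.
Proof. by rewrite normcX normc_root expr1n. Qed.

Lemma root_conj k : (w ^+ k)^* * w ^+ k = 1.
Proof. by rewrite mulrC -normc_sqr normcX normc_root !expr1n. Qed.

(** A geometric sum of ratio v = w^(k-l): either v = 1, or v^(N+1) = 1 with v <> 1 makes it
    vanish. *)
Lemma sum_root k l :
  \sum_(j < N.+1) (w ^+ k) ^+ j * ((w ^+ l) ^+ j)^* =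
  if k == l %[mod N.+1] then N.+1%:R else 0.
Proof.
set v := w ^+ k * (w ^+ l)^*.
rewrite (eq_bigr (fun j : 'I_N.+1 => v ^+ j)); last first.
  by move=> j _; rewrite rmorphXn exprMn.
have vw : v * w ^+ l = w ^+ k by rewrite /v -mulrA root_conj mulr1.
case: ifPn => [/eqP kl|kl].
  have -> : v = 1.
    have /eqP : w ^+ k = w ^+ l by apply/eqP; rewrite (eq_prim_root_expr wP) kl.
    rewrite -vw -subr_eq0 -{2}[w ^+ l]mul1r -mulrBl mulf_eq0 subr_eq0.
    case/orP => [/eqP//|]; rewrite -normc_eq0 normcX normc_root expr1n.
    by rewrite oner_eq0.
  by rewrite (eq_bigr (fun=> 1)) ?sumr_const ?card_ord // => j _; rewrite expr1n.
have v1 : v - 1 != 0.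
  rewrite subr_eq0; apply: contra kl => /eqP v1.
  by rewrite -(eq_prim_root_expr wP) -vw v1 mul1r.
apply: (mulfI v1); rewrite mulr0 -subrX1 /v exprMn -rmorphXn /=.
by rewrite -!exprM !(mulnC _ N.+1) !exprM (prim_expr_order wP) !expr1n rmorph1 mul1r subrr.
Qed.

Lemma mon_pt al x : mon al (pt x) = \prod_i (w ^+ al i) ^+ x i.
Proof. by apply: eq_bigr => i _; rewrite /pt -!exprM mulnC. Qed.

Lemma card_expo : #|{: expo}|%:R = \prod_(i < n) N.+1%:R :> R[i].
Proof. by rewrite card_ffun !card_ord prodr_const card_ord natrX. Qed.

Lemma orthogonality al be :
  avg (fun x => mon al (pt x) * (mon be (pt x))^*) = (al == be)%:R.
Proof.
rewrite /avg (eq_bigr (fun x : expo =>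
    \prod_i ((w ^+ al i) ^+ x i * ((w ^+ be i) ^+ x i)^*))); last first.
  by move=> x _; rewrite !mon_pt rmorph_prod -big_split.
rewrite -(bigA_distr_bigA (fun i j => (w ^+ al i) ^+ (j : 'I_N.+1) *
  ((w ^+ be i) ^+ j)^*)) card_expo -prodf_div.
rewrite (eq_bigr (fun i => (al i == be i)%:R)); last first.
  move=> i _; rewrite sum_root !modn_small ?ltn_ord // val_eqE.
  by case: eqP => _; rewrite ?mul0r // divff // pnatr_eq0.
case: (altP (al =P be)) => [->|neq]; first by rewrite big1 // => i _; rewrite eqxx.
suff [i ne] : exists i, al i != be i by rewrite (bigD1 i) //= (negbTE ne) mul0r.
apply/existsP; rewrite -negb_forall; apply: contra neq => /forallP e.
by apply/eqP/ffunP => i; apply/eqP.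
Qed.

Lemma avg_trigM b c :
  avg (fun x => trig b x * (trig c x)^*) = \sum_be b be * (c be)^*.
Proof.
rewrite (eq_avg (F' := fun x => \sum_al \sum_be
   (b al * (c be)^*) * (mon al (pt x) * (mon be (pt x))^*))); last first.
  move=> x; rewrite rmorph_sum big_distrlr; apply: eq_bigr => al _.
  by apply: eq_bigr => be _; rewrite rmorphM mulrACA.
rewrite avg_sum; apply: eq_bigr => al _.
rewrite avg_sum (bigD1 al) //= avgZ orthogonality eqxx mulr1 big1 ?addr0 //.
by move=> be ne; rewrite avgZ orthogonality eq_sym (negbTE ne) mulr0.
Qed.

Lemma parseval b :
  avg (fun x => normc (trig b x) ^+ 2) = \sum_be normc (b be) ^+ 2.
Proof.
apply: (@complexI R); rewrite -avg_complex rmorph_sum /=.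
rewrite (eq_avg (F' := fun x => trig b x * (trig b x)^*)); last first.
  by move=> x; rewrite normc_sqr.
by rewrite avg_trigM; apply: eq_bigr => be _; rewrite normc_sqr.
Qed.

End Torus.

(** * Mean inequalities and hypercontractivity on the torus *)

Lemma cauchy_schwarz_sum (R : realDomainType) I r (P : pred I) (x y : I -> R) :
  (\sum_(i <- r | P i) x i * y i) ^+ 2 <=
  (\sum_(i <- r | P i) x i ^+ 2) * (\sum_(i <- r | P i) y i ^+ 2).
Proof.
rewrite -subr_ge0 -(@pmulr_rge0 _ 2) // mulrBr.
have -> : 2 * ((\sum_(i <- r | P i) x i ^+ 2) * (\sum_(i <- r | P i) y i ^+ 2)) =
    \sum_(i <- r | P i) \sum_(j <- r | P j)
      (x i ^+ 2 * y j ^+ 2 + x j ^+ 2 * y i ^+ 2).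
  rewrite mulrDl mul1r [X in _ + X = _]mulrC !big_distrlr -big_split.
  apply: eq_bigr => i _; rewrite -big_split; apply: eq_bigr => j _.
  by rewrite [X in _ + X]mulrC.
have -> : 2 * (\sum_(i <- r | P i) x i * y i) ^+ 2 =
    \sum_(i <- r | P i) \sum_(j <- r | P j) (2 * (x i * y i * (x j * y j))).
  by rewrite expr2 big_distrlr mulr_sumr; under eq_bigr do rewrite mulr_sumr.
rewrite -sumrB sumr_ge0 // => i _; rewrite -sumrB sumr_ge0 // => j _.
(* Lagrange's identity: the difference is a double sum of squares. *)
suff -> : x i ^+ 2 * y j ^+ 2 + x j ^+ 2 * y i ^+ 2 - 2 * (x i * y i * (x j * y j)) =
  (x i * y j - x j * y i) ^+ 2 by exact: sqr_ge0.
by ring.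
Qed.

(** Tangent line of exp at the weighted mean M: every s is at least exp(M) (1 + ln s - M), and in
    the weighted sum the logarithms cancel against M. The Hölder-type inequalities below reduce to
    it. *)
Lemma weighted_amgm (R : realType) (u v t a b c : R) :
  0 <= u -> 0 <= v -> 0 <= t -> u + v + t = 1 -> 0 < a -> 0 < b -> 0 < c ->
  expR (u * ln a + v * ln b + t * ln c) <= u * a + v * b + t * c.
Proof.
move=> u0 v0 t0 uvt a0 b0 c0; set M := (X in expR X).
have tangent s : 0 < s -> expR M * (1 + (ln s - M)) <= s.
  move=> s0; rewrite mulrC -ler_pdivlMr ?expR_gt0 //.
  by rewrite -[X in X / _](lnK (x := s)) // -expRN -expRD expR_ge1Dx.
apply: (@le_trans _ _ (u * (expR M * (1 + (ln a - M))) +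
  v * (expR M * (1 + (ln b - M))) + t * (expR M * (1 + (ln c - M))))).
  rewrite [X in _ <= X](_ : _ = expR M * ((u + v + t) * (1 - M) +
    (u * ln a + v * ln b + t * ln c))); last by ring.
  by rewrite uvt mul1r -/M subrK mulr1.
by rewrite !lerD // ler_wpM2l // tangent.
Qed.

Section Torus.
Variables (R : realType) (n N : nat) (w : R[i]).
Hypothesis wP : N.+1.-primitive_root w.
Local Notation expo := {ffun 'I_n -> 'I_N.+1}.
Implicit Types (b c : expo -> R[i]) (al be ga x : expo).
Local Notation trig := (@trig R n N w).
Local Notation pt := (@pt R n N w).

(** [inord] sends sums above N to a default index, so this adds exponents only if no sum exceeds N;
    hence the conditions [l.*2 <= N]. *)
Definition addx al be : expo := [ffun i => inord (al i + be i)].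

Lemma deg_ge al i : (al i <= deg al)%N.
Proof. by rewrite /deg (bigD1 i) //= leq_addr. Qed.

Lemma addxE l al be i : (l.*2 <= N)%N -> (deg al <= l)%N -> (deg be <= l)%N ->
  addx al be i = (al i + be i)%N :> nat.
Proof.
move=> lN al_l be_l; rewrite ffunE inordK // ltnS (leq_trans _ lN) //.
by rewrite -addnn leq_add // (leq_trans (deg_ge _ _)).
Qed.

Lemma mon_addx l al be (z : 'I_n -> R[i]) :
  (l.*2 <= N)%N -> (deg al <= l)%N -> (deg be <= l)%N ->
  mon (addx al be) z = mon al z * mon be z.
Proof.
move=> lN al_l be_l; rewrite /mon -big_split; apply: eq_bigr => i _ /=.
by rewrite (addxE _ lN) // exprD.
Qed.

(** The count is the product of the ga_i + 1, and k + 1 <= 2^k. *)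
Lemma card_below ga : (#|[set al : expo | [forall i, al i <= ga i]%N]| <= 2 ^ deg ga)%N.
Proof.
rewrite -sum1_card.
rewrite (_ : (\sum_(_ in _) _ = \sum_(al : expo) \prod_i (al i <= ga i : nat))%N); last first.
  rewrite [LHS]big_mkcond /=; apply: eq_bigr => al _. rewrite inE.
  case: ifPn => [/forallP h|]; first by rewrite big1 // => i _; rewrite h.
  by rewrite negb_forall => /existsP[i /negbTE h]; rewrite (bigD1 i) //= h mul0n.
rewrite -(bigA_distr_bigA (fun i (j : 'I_N.+1) => (j <= ga i : nat))%N) /=.
rewrite /deg expn_sum; apply: leq_prod => i _.
rewrite -big_mkcond /= sum1_card.
rewrite (leq_trans _ (ltn_expl (ga i) (ltnSn 1))) //.
rewrite -[X in (_ <= X)%N]card_ord -(card_in_imset (f := fun j : 'I_N.+1 => inord j : 'I_(ga i).+1)) ?max_card //.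
move=> j k; rewrite !unfold_in => jg kg /(congr1 val) /=.
by rewrite !inordK // => /val_inj.
Qed.

(* A character of total degree 2l is a product of two characters of degree
   at most l in at most 2^(2l) ways. *)
Lemma trig_L4 b l : (l.*2 <= N)%N -> (forall be, b be != 0 -> (deg be <= l)%N) ->
  avg (fun x => normc (trig b x) ^+ 4) <=
  4 ^+ l * (\sum_be normc (b be) ^+ 2) ^+ 2.
Proof.
move=> lN bl.
pose S ga := [pred p : expo * expo |
  [&& addx p.1 p.2 == ga, b p.1 != 0 & b p.2 != 0]].
pose c ga := \sum_(p | p \in S ga) b p.1 * b p.2.
(* Squaring turns the L^4 norm into an L^2 norm, which Parseval expresses by the self-convolution
   [c] of [b]. *)
have sqE x : trig b x ^+ 2 = trig c x.
  rewrite /trig expr2 big_distrlr pair_bigA /=.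
  rewrite (bigID (fun p => (b p.1 != 0) && (b p.2 != 0))) /= [X in _ + X]big1.
    rewrite addr0 (partition_big (fun p => addx p.1 p.2) xpredT) //=.
    apply: eq_bigr => ga _; rewrite mulr_suml.
    apply: eq_big => [[al be]|[al be]]; rewrite ?inE /=; first by rewrite andbC.
    case/andP=> /andP[ba bb] /eqP <-.
    by rewrite (mon_addx _ lN) ?bl // mulrACA.
  move=> [al be] /=; rewrite negb_and !negbK.
  by case/orP => /eqP ->; rewrite ?mul0r ?mulr0 // mul0r.
rewrite (eq_avg (F' := fun x => normc (trig c x) ^+ 2)); last first.
  by move=> x; rewrite -sqE normcX -exprM.
rewrite parseval //.
pose T := \sum_ga \sum_(p | p \in S ga) (normc (b p.1) * normc (b p.2)) ^+ 2.
apply: (@le_trans _ _ (4 ^+ l * T)); last first.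
  rewrite ler_wpM2l // ?exprn_ge0 // expr2 big_distrlr pair_bigA /= /T.
  rewrite [X in _ <= X](partition_big (fun p => addx p.1 p.2) xpredT) //=.
  apply: ler_sum => ga _; rewrite (eq_bigr (fun p : expo * expo =>
    normc (b p.1) ^+ 2 * normc (b p.2) ^+ 2)); last by move=> p _; rewrite exprMn.
  rewrite [X in _ <= X](bigID (fun p => (b p.1 != 0) && (b p.2 != 0))) /=.
  rewrite -[X in X <= _]addr0 lerD //.
  by rewrite sumr_ge0 // => p _; rewrite mulr_ge0 // sqr_ge0.
rewrite /T mulr_sumr; apply: ler_sum => ga _.
(* Cauchy-Schwarz against the constant 1 costs the number of pairs in [S ga]; a pair is determined
   by its first entry, which lies below [ga]. *)
have nc : normc (c ga) <= \sum_(p | p \in S ga) 1 * (normc (b p.1) * normc (b p.2)).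
  rewrite (le_trans (le_normc_sum _ _ _)) //; apply: ler_sum => p _.
  by rewrite mul1r ComplexField.Normc.normcM.
have := lerXn2r 2 _ _ nc; rewrite !nnegrE normc_ge0 => /(_ isT) h.
apply: (le_trans (h _)); first by apply: le_trans nc; exact: normc_ge0.
rewrite (le_trans (cauchy_schwarz_sum _ _ _ _)) // ler_wpM2r //.
  by rewrite sumr_ge0 // => p _; rewrite sqr_ge0.
rewrite (eq_bigr (fun=> 1)) ?sumr_const; last by move=> *; rewrite expr1n.
have -> : (4 ^+ l : R) = (4 ^ l)%:R by rewrite natrX.
rewrite ler_nat.
have [/card0_eq S0|] := posnP #|S ga|; first by rewrite eq_card0.
case/card_gt0P=> -[al be]; rewrite inE /= => /and3P[/eqP ga_ ba bb].
apply: (@leq_trans (2 ^ deg ga)); last first.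
  rewrite -[4%N]/(2 ^ 2)%N -expnM leq_pexp2l // /deg -ga_.
  under eq_bigr do rewrite (addxE _ lN) ?bl //.
  by rewrite big_split mul2n -addnn leq_add // bl.
apply: leq_trans (card_below ga).
rewrite -(card_in_imset (f := fst) (D := S ga)).
  apply: subset_leq_card; apply/fintype.subsetP => al'. move=> /imsetP[[p q]].
  rewrite !inE /= => /and3P[/eqP <- bp bq] ->.
  by apply/forallP => i; rewrite (addxE _ lN) ?bl // leq_addr.
move=> [p q] [p' q']; rewrite !inE /= => /and3P[/eqP e1 bp bq] /and3P[/eqP e2 _ bq'] pp'.
congr pair => //; apply/ffunP => i; apply: val_inj => /=.
have := congr1 (fun f : expo => val (f i)) (etrans e1 (esym e2)).
by rewrite /= !(addxE _ lN) ?bl -?pp' // => /addnI.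
Qed.

End Torus.

(** Hölder's inequality for f = f1^u f2^v f3^t: after division by A, B, C the pointwise mean
    inequality averages to u + v + t = 1. The factorisation is asked through [ln], and only where f
    > 0, to keep zeros out of real powers. *)
Lemma holder_avg (R : realType) (T : finType) (f f1 f2 f3 : T -> R)
    (u v t A B C : R) :
  0 <= u -> 0 <= v -> 0 <= t -> u + v + t = 1 -> 0 < A -> 0 < B -> 0 < C ->
  (forall x, 0 <= f1 x) -> (forall x, 0 <= f2 x) -> (forall x, 0 <= f3 x) ->
  avg f1 <= A -> avg f2 <= B -> avg f3 <= C ->
  (forall x, 0 < f x -> [/\ 0 < f1 x, 0 < f2 x, 0 < f3 x &
     ln (f x) = u * ln (f1 x) + v * ln (f2 x) + t * ln (f3 x)]) ->
  avg f <= expR (u * ln A + v * ln B + t * ln C).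
Proof.
move=> u0 v0 t0 uvt A0 B0 C0 f10 f20 f30 f1A f2B f3C fE.
set K := expR _.
apply: (@le_trans _ _
    (avg (fun x => K * (u / A * f1 x + (v / B * f2 x + t / C * f3 x))))).
  apply: ler_avg => x; have [fx0|fx0] := ltP 0 (f x); last first.
    by rewrite (le_trans fx0) // mulr_ge0 ?expR_ge0 // !addr_ge0 // mulr_ge0 // divr_ge0 // ltW.
  have [x1 x2 x3 lnf] := fE _ fx0.
  rewrite mulrC -ler_pdivrMr ?expR_gt0 //.
  have := weighted_amgm u0 v0 t0 uvt (divr_gt0 x1 A0) (divr_gt0 x2 B0) (divr_gt0 x3 C0).
  rewrite !ln_div // => am; apply: le_trans (le_trans am _); last first.
    by rewrite le_eqVlt; apply/orP; left; apply/eqP; ring.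
  rewrite -[X in X / _](lnK (x := f x)) // -expRN -expRD ler_expR lnf /K.
  by rewrite le_eqVlt; apply/orP; left; apply/eqP; ring.
rewrite avgZ -[X in _ <= X]mulr1 ler_wpM2l ?expR_ge0 // !avgD !avgZ -uvt -addrA.
by rewrite !lerD // mulrAC -mulrA ler_piMr // ler_pdivrMr // mul1r.
Qed.

Lemma ln_sqrt (R : realType) (x : R) : 0 < x -> ln (Num.sqrt x) = ln x / 2.
Proof.
move=> x0; have s0 : 0 < Num.sqrt x by rewrite sqrtr_gt0.
by rewrite -{2}(sqr_sqrtr (ltW x0)) lnXn // -[_ *+ _]mulr_natr mulfK.
Qed.

(** The Bohnenblust-Hille exponent. *)
Definition pexp (R : realType) (j : nat) : R := 2 * j%:R / j.+1%:R.

Lemma pexp_ge1 (R : realType) j : (0 < j)%N -> 1 <= pexp R j.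
Proof.
by move=> j0; rewrite ler_pdivlMr // mul1r -natrM ler_nat; lia.
Qed.

Lemma pexp_gt0 (R : realType) j : (0 < j)%N -> 0 < pexp R j.
Proof. by move=> j0; apply: lt_le_trans (pexp_ge1 R j0). Qed.

Section Torus.
Variables (R : realType) (n N : nat) (w : R[i]).
Hypothesis wP : N.+1.-primitive_root w.
Local Notation expo := {ffun 'I_n -> 'I_N.+1}.
Implicit Types (b c : expo -> R[i]) (al be ga x : expo) (U : pred expo).
Local Notation trig := (@trig R n N w).
Local Notation pt := (@pt R n N w).

Definition part U b : expo -> R[i] := fun be => if U be then b be else 0.

Lemma sum_part U b :
  \sum_be normc (part U b be) ^+ 2 = \sum_(be | U be) normc (b be) ^+ 2.
Proof.
rewrite [RHS]big_mkcond; apply: eq_bigr => be _; rewrite /part.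
by case: ifP => // _; rewrite ComplexField.Normc.normc0 expr0n.
Qed.

(* Only the low-degree part of the function is controlled in L^2; by duality the
   interpolation between L^2 and L^4 is applied to that part alone. *)
Lemma hypercontractive_dual b U j l : (1 < j)%N -> (l.*2 <= N)%N ->
  (forall be, U be -> b be != 0 -> (deg be <= l)%N) ->
  Num.sqrt (\sum_(be | U be) normc (b be) ^+ 2) `^ pexp R j <=
  (2 `^ (l%:R / j%:R)) `^ pexp R j * avg (fun x => normc (trig b x) `^ pexp R j).
Proof.
move=> j1 lN Ul; set S := \sum_(be | U be) _; set A := avg _.
have j0 : (0 < j)%N by apply: ltn_trans j1.
have p0 := pexp_gt0 R j0.
have A0 : 0 <= A by apply: avg_ge0 => x; exact: powR_ge0.
have [S0|S0] := leP S 0.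
  by rewrite ler0_sqrtr // powR0 ?gt_eqF // mulr_ge0 // powR_ge0.
pose g := part U b.
have gl be : g be != 0 -> (deg be <= l)%N.
  by rewrite /g /part; case: ifP => [/Ul //|]; rewrite eqxx.
have Sg : \sum_be normc (g be) ^+ 2 = S by rewrite sum_part.
(* Pairing with g returns S, since g has the same coefficients on U and none elsewhere. *)
have Sle : S <= avg (fun x => normc (trig b x) * normc (trig g x)).
  rewrite (eq_avg (F' := fun x => normc (trig b x * (trig g x)^*))); last first.
    by move=> x; rewrite ComplexField.Normc.normcM normc_conj.
  apply: le_trans (normc_avg _); rewrite avg_trigM //.
  rewrite (_ : \sum_be _ = S%:C%C); last first.
    rewrite -Sg rmorph_sum /=; apply: eq_bigr => be _; rewrite normc_sqr /g /part.
    by case: ifP => // _; rewrite mul0r rmorph0 mulr0.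
  by rewrite normcC ler_norm.
have [A00|A00] := leP A 0.
  suff : S <= 0 by rewrite leNgt S0.
  apply: (le_trans Sle); rewrite (eq_avg (F' := fun=> 0)).
    by rewrite /avg big1 // mul0r.
  move=> x; suff -> : normc (trig b x) = 0 by rewrite mul0r.
  apply: (@powR_eq0_eq0 _ _ (pexp R j)); apply/eqP; rewrite eq_le powR_ge0 andbT.
  apply: (@le_trans _ _ (A * #|{: expo}|%:R)); last by rewrite mulr_le0_ge0.
  rewrite /A /avg divfK; last first.
    by rewrite pnatr_eq0 -lt0n card_ffun !card_ord expn_gt0.
  by rewrite (bigD1 x) //= lerDl sumr_ge0 // => y _; exact: powR_ge0.
have jR : 0 < j%:R :> R by rewrite ltr0n.
have j1n : 1 + j%:R != 0 :> R by rewrite nat1r pnatr_eq0.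
have C0 : 0 < 4 ^+ l * S ^+ 2 by rewrite mulr_gt0 ?exprn_gt0.
(* The last two weights interpolate the norm of g for the dual exponent 2j/(j-1) between L^2 and
   L^4. This exponent is at most 4 only from j = 2 on, so j = 1 is treated separately. *)
have := holder_avg (u := (pexp R j)^-1) (v := (j - 2)%:R / (2 * j%:R))
  (t := (2 * j%:R)^-1) (f := fun x => normc (trig b x) * normc (trig g x))
  _ _ _ _ A00 S0 C0
  (fun x => powR_ge0 _ _) (fun x => sqr_ge0 (normc (trig g x)))
  (fun x => exprn_ge0 4 (normc_ge0 (trig g x))) (lexx _).
rewrite natrB // parseval // Sg lexx => H.
have {}H : S <= expR ((pexp R j)^-1 * ln A + (j%:R - 2) / (2 * j%:R) * ln S +
    (2 * j%:R)^-1 * ln (4 ^+ l * S ^+ 2)).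
  apply: (le_trans Sle); apply: H => //.
  - by rewrite invr_ge0 ltW.
  - by rewrite divr_ge0 ?mulr_ge0 // subr_ge0 ler_nat.
  - by rewrite /pexp -natr1; field; rewrite j1n gt_eqF.
  - by rewrite -Sg; apply: trig_L4.
  move=> x fg0.
  have f0 : 0 < normc (trig b x).
    rewrite lt_def normc_ge0 andbT; apply: contraL fg0 => /eqP ->.
    by rewrite mul0r ltxx.
  have g0 : 0 < normc (trig g x).
    rewrite lt_def normc_ge0 andbT; apply: contraL fg0 => /eqP ->.
    by rewrite mulr0 ltxx.
  split; rewrite ?powR_gt0 ?exprn_gt0 //.
  rewrite lnM ?posrE // ln_powR !lnXn // /pexp -natr1.
  rewrite -[ln _ *+ 2]mulr_natl -[ln _ *+ 4]mulr_natl; field.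
  by rewrite j1n gt_eqF.
move: H; rewrite -{1}[S]lnK // ler_expR [ln (4 ^+ l * _)]lnM ?posrE ?exprn_gt0 // !lnXn // => H.
have Sq : 0 < Num.sqrt S by rewrite sqrtr_gt0.
rewrite /powR !gt_eqF ?expR_gt0 // -[A]lnK ?posrE // -expRD ler_expR.
rewrite ln_sqrt //.
rewrite expRK; move: H; rewrite (_ : 4 = 2 ^+ 2) ?lnXn //; last by ring.
rewrite -[ln 2 *+ 2]mulr_natl -[ln S *+ 2]mulr_natl -[_ *+ l]mulr_natl => H.
rewrite -[X in _ <= _ + X](mulVKf (x := pexp R j)) ?gt_eqF // -mulrDr ler_pM2l //.
rewrite -subr_ge0; move: H; rewrite -subr_ge0.
congr (0 <= _); field; rewrite ?gt_eqF //=.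
Qed.

Lemma deg_shift be x (k : 'I_N.+1) :
  mon be (pt [ffun i => x i + k]) = (w ^+ deg be) ^+ k * mon be (pt x).
Proof.
rewrite /mon /pt /deg -prodrXr -prodrXl -big_split; apply: eq_bigr => i _ /=.
rewrite ffunE /= (prim_expr_mod wP) exprD exprMn mulrC -!exprM.
by rewrite [(k * _)%N]mulnC.
Qed.

Lemma shift_inj (k : 'I_N.+1) : injective (fun x : expo => [ffun i => x i + k] : expo).
Proof.
by move=> x y /ffunP e; apply/ffunP => i; have := e i; rewrite !ffunE => /addIr.
Qed.

(** The l-th Fourier coefficient along the common rotation of all variables by w^k. Degrees at most
    N stay distinct modulo N + 1. *)
Lemma homogeneous_avg b l x :
  (l <= N)%N -> (forall be, b be != 0 -> (deg be <= N)%N) ->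
  trig (part (fun be => deg be == l) b) x =
  avg (fun k : 'I_N.+1 => ((w ^+ l) ^+ k)^* * trig b [ffun i => x i + k]).
Proof.
move=> lN bN; rewrite /trig (eq_avg (F' := fun k : 'I_N.+1 => \sum_be
    b be * mon be (pt x) * ((w ^+ deg be) ^+ k * ((w ^+ l) ^+ k)^*))); last first.
  move=> k; rewrite mulr_sumr; apply: eq_bigr => be _; rewrite deg_shift.
  by ring.
rewrite avg_sum; apply: eq_bigr => be _; rewrite avgZ /avg card_ord sum_root //.
rewrite /part; have [->|/bN dN] := eqVneq (b be) 0; first by rewrite if_same !mul0r.
rewrite !modn_small ?ltnS //; case: eqP => _; rewrite ?mul0r ?mulr0 //.
by rewrite divff ?mulr1 // pnatr_eq0.
Qed.

(** For j = 1 the dual exponent is infinite, out of reach of L^4. Restricting to one exact degree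
    helps: the projection onto it contracts L^1, being a mean of rotations, and on its range L^2 is
    interpolated between L^1 and L^4. The exponent [pexp R 1], which is 1, keeps the shape of the
    other case. *)
Lemma hypercontractive_linear b l :
  (l.*2 <= N)%N -> (forall be, b be != 0 -> (deg be <= N)%N) ->
  Num.sqrt (\sum_(be | deg be == l) normc (b be) ^+ 2) `^ pexp R 1 <=
  (2 `^ (l%:R / 1%:R)) `^ pexp R 1 * avg (fun x => normc (trig b x) `^ pexp R 1).
Proof.
move=> lN bN; have -> : pexp R 1 = 1 by rewrite /pexp mulr1 divff.
rewrite !powRr1 ?sqrtr_ge0 ?powR_ge0 // divr1 powR_mulrn //.
rewrite (eq_avg (F' := fun x => normc (trig b x))); last first.
  by move=> x; rewrite powRr1 // normc_ge0.
set S := \sum_(be | _) _; pose g := part (fun be => deg be == l) b.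
have Sg : \sum_be normc (g be) ^+ 2 = S by rewrite sum_part.
have lN' : (l <= N)%N by rewrite (leq_trans _ lN) // -addnn leq_addr.
apply: (@le_trans _ _ (2 ^+ l * avg (fun x => normc (trig g x)))); last first.
  rewrite ler_wpM2l ?exprn_ge0 //.
  apply: (@le_trans _ _
      (avg (fun x => avg (fun k : 'I_N.+1 => normc (trig b [ffun i => x i + k]))))).
    apply: ler_avg => x; rewrite homogeneous_avg //.
    apply: (le_trans (normc_avg _)); apply: ler_avg => k.
    rewrite ComplexField.Normc.normcM normc_conj !normcX (normc_root wP).
    by rewrite !expr1n mul1r.
  rewrite {1}/avg [X in X / _](eq_bigr (fun x =>
    (\sum_(k < N.+1) normc (trig b [ffun i => x i + k])) / N.+1%:R)); last first.
    by move=> x _; rewrite /avg card_ord.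
  rewrite -mulr_suml exchange_big /=.
  rewrite (eq_bigr (fun=> \sum_x normc (trig b x))); last first.
    by move=> k _; rewrite [RHS](reindex_inj (@shift_inj k)).
  by rewrite sumr_const card_ord -[_ *+ _]mulr_natr mulfK ?pnatr_eq0.
have [S0|S0] := leP S 0.
  rewrite ler0_sqrtr // mulr_ge0 ?exprn_ge0 //.
  by apply: avg_ge0 => x; exact: normc_ge0.
set A := avg _.
have gl be : g be != 0 -> (deg be <= l)%N.
  by rewrite /g /part; case: ifP => [/eqP -> //|]; rewrite eqxx.
have C0 : 0 < 4 ^+ l * S ^+ 2 by rewrite mulr_gt0 ?exprn_gt0.
have SE : S = avg (fun x => normc (trig g x) ^+ 2) by rewrite parseval.
have A0 : 0 < A.
  rewrite lt_def avg_ge0 ?andbT => [|x]; last exact: normc_ge0.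
  apply: contraL S0 => /eqP A0; rewrite -leNgt SE.
  rewrite (eq_avg (F' := fun=> 0)); first by rewrite /avg big1 // mul0r.
  move=> x; apply/eqP; rewrite sqrf_eq0 eq_le normc_ge0 andbT.
  apply: (@le_trans _ _ (A * #|{: expo}|%:R)); last by rewrite A0 mul0r.
  rewrite /A /avg divfK; last first.
    by rewrite pnatr_eq0 -lt0n card_ffun !card_ord expn_gt0.
  by rewrite (bigD1 x) //= lerDl sumr_ge0 // => y _; exact: normc_ge0.
(* |g|^2 = |g|^(2/3) (|g|^4)^(1/3); the middle factor has weight 0. *)
have := holder_avg (u := 2 / 3) (v := 0) (t := 3^-1)
  (f := fun x => normc (trig g x) ^+ 2) (f1 := fun x => normc (trig g x))
  (f2 := fun x => normc (trig g x)) (f3 := fun x => normc (trig g x) ^+ 4)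
  _ _ _ _ A0 A0 C0 (fun x => normc_ge0 _) (fun x => normc_ge0 _)
  (fun x => exprn_ge0 4 (normc_ge0 _)) (lexx _) (lexx _) => H.
have {}H : S <= expR (2 / 3 * ln A + 0 * ln A + 3^-1 * ln (4 ^+ l * S ^+ 2)).
  rewrite {1}SE; apply: H => //; first by field.
    by rewrite -Sg; apply: trig_L4.
  move=> x g2; have g0 : 0 < normc (trig g x).
    rewrite lt_def normc_ge0 andbT; apply: contraL g2 => /eqP ->.
    by rewrite expr0n ltxx.
  split; rewrite ?exprn_gt0 // !lnXn // -[ln _ *+ 2]mulr_natl -[ln _ *+ 4]mulr_natl.
  by field.
move: H; rewrite -{1}[S]lnK // ler_expR [ln (4 ^+ l * _)]lnM ?posrE ?exprn_gt0 //.
rewrite !lnXn // (_ : 4 = 2 ^+ 2) ?lnXn //; last by ring.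
rewrite -[ln 2 *+ 2]mulr_natl -[ln S *+ 2]mulr_natl -[_ *+ l]mulr_natl => H.
have l0 : 0 < 2 ^+ l :> R by rewrite exprn_gt0.
rewrite -ler_ln ?posrE ?sqrtr_gt0 //; last exact: mulr_gt0.
rewrite ln_sqrt //.
rewrite [ln (2 ^+ l * A)]lnM ?posrE // lnXn // -[ln 2 *+ l]mulr_natl.
by move: H; rewrite [l%:R * (2 * _)]mulrCA; move: (ln A) (ln S) (l%:R * ln 2) => *; lra.
Qed.

End Torus.

(** * The Blei inequality *)

(* The weights j : l : 1 are forced by p_j / (2 - p_j) = j, which makes the powers of F
   and G cancel in the geometric mean. *)
Lemma blei_pointwise (R : realType) (j l : nat) (f F G : R) :
  (0 < j)%N -> (0 < l)%N -> 0 < f -> 0 < F -> 0 < G ->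
  f `^ pexp R (j + l) <=
    j%:R / (j + l).+1%:R * (f ^+ 2 * F `^ (pexp R j - 2)) +
    l%:R / (j + l).+1%:R * (f ^+ 2 * G `^ (pexp R l - 2)) +
    ((j + l).+1%:R)^-1 * (F `^ pexp R j * G `^ pexp R l).
Proof.
move=> j0 l0 f0 F0 G0.
have f2 : 0 < f ^+ 2 by rewrite exprn_gt0.
have [jR lR] : 0 < j%:R :> R /\ 0 < l%:R :> R by rewrite !ltr0n.
have sn0 : (j + l).+1%:R = j%:R + l%:R + 1 :> R by rewrite -natr1 natrD.
have nz1 : j%:R + l%:R + 1 != 0 :> R by rewrite gt_eqF // !addr_gt0.
have nz2 : j%:R + 1 != 0 :> R by rewrite natr1 pnatr_eq0.
have nz3 : l%:R + 1 != 0 :> R by rewrite natr1 pnatr_eq0.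
apply: le_trans (weighted_amgm _ _ _ _ _ _ _).
- rewrite {1}/powR gt_eqF // ler_expR !lnM ?posrE ?powR_gt0 // !ln_powR.
  rewrite /pexp natrD sn0 -![_.+1%:R]natr1.
  rewrite le_eqVlt; apply/orP; left; apply/eqP; field.
  by rewrite nz1 nz2 nz3.
- by rewrite divr_ge0.
- by rewrite divr_ge0.
- by rewrite invr_ge0.
- by rewrite sn0; field.
- by rewrite mulr_gt0 ?powR_gt0.
- by rewrite mulr_gt0 ?powR_gt0.
- by rewrite mulr_gt0 ?powR_gt0.
Qed.


Section Blei.
Variables (R : realType) (I J : finType) (f : I -> J -> R).
Variables (rI : I -> nat) (rJ : J -> nat) (P : I -> J -> bool).
Variables (QI : pred I) (QJ : pred J) (k1 k0 : R).
Hypothesis f0 : forall i j, 0 <= f i j.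
Hypothesis PI : forall i j, P i j -> QI i /\ (0 < rI i)%N.
Hypothesis PJ : forall i j, P i j -> QJ j /\ (0 < rJ j)%N.
Hypothesis k1I : forall i j, P i j -> (rI i)%:R / (rI i + rJ j).+1%:R <= k1.
Hypothesis k1J : forall i j, P i j -> (rJ j)%:R / (rI i + rJ j).+1%:R <= k1.
Hypothesis k0P : forall i j, P i j -> ((rI i + rJ j).+1%:R)^-1 <= k0.
Hypotheses (k1_ge0 : 0 <= k1) (k0_ge0 : 0 <= k0).
Let F i := Num.sqrt (\sum_(j | P i j) f i j ^+ 2).
Let G j := Num.sqrt (\sum_(i | P i j) f i j ^+ 2).
Hypothesis SF : \sum_(i | QI i) F i `^ pexp R (rI i) <= 1.
Hypothesis SG : \sum_(j | QJ j) G j `^ pexp R (rJ j) <= 1.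

(** In the sum of the pointwise inequality, f^2 F^(p-2) summed over j collapses to F^p, likewise for
    G, and the last term is a product of two sums at most 1. The degrees may vary with the indices;
    when they are large and nearly equal, 2 k1 + k0 can be taken close to 1. *)
Lemma blei :
  \sum_i \sum_(j | P i j) f i j `^ pexp R (rI i + rJ j) <= k1 *+ 2 + k0.
Proof.
have fF i j : P i j -> f i j <= F i.
  move=> ij; rewrite -[f i j]ger0_norm // -sqrtr_sqr ler_wsqrtr //.
  by rewrite (bigD1 j) //= lerDl sumr_ge0 // => *; exact: sqr_ge0.
have fG i j : P i j -> f i j <= G j.
  move=> ij; rewrite -[f i j]ger0_norm // -sqrtr_sqr ler_wsqrtr //.
  by rewrite (bigD1 i) //= lerDl sumr_ge0 // => *; exact: sqr_ge0.
have sqF i : F i ^+ 2 = \sum_(j | P i j) f i j ^+ 2.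
  by rewrite sqr_sqrtr // sumr_ge0 // => *; exact: sqr_ge0.
have sqG j : G j ^+ 2 = \sum_(i | P i j) f i j ^+ 2.
  by rewrite sqr_sqrtr // sumr_ge0 // => *; exact: sqr_ge0.
have pw (x : R) r : 0 <= x -> (0 < r)%N ->
    x `^ (pexp R r - 2) * x ^+ 2 = x `^ pexp R r.
  rewrite le0r => /orP[/eqP ->|x0] r0.
    by rewrite expr0n mulr0 powR0 // gt_eqF // pexp_gt0.
  by rewrite -powR_mulrn ?ltW // -powRD ?(gt_eqF x0) ?implybT // subrK.
have point i j : P i j -> f i j `^ pexp R (rI i + rJ j) <=
    k1 * (f i j ^+ 2 * F i `^ (pexp R (rI i) - 2)) +
    k1 * (f i j ^+ 2 * G j `^ (pexp R (rJ j) - 2)) +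
    k0 * (F i `^ pexp R (rI i) * G j `^ pexp R (rJ j)).
  move=> ij; have [[_ i0] [_ j0]] := (PI ij, PJ ij).
  have /orP[/eqP fij|fij] : (f i j == 0) || (0 < f i j) by rewrite -le0r.
    rewrite fij powR0; last by rewrite gt_eqF // pexp_gt0 // addn_gt0 i0.
    by rewrite !addr_ge0 // !mulr_ge0 ?powR_ge0 // sqr_ge0.
  apply: (le_trans (blei_pointwise i0 j0 fij (lt_le_trans fij (fF _ _ ij))
    (lt_le_trans fij (fG _ _ ij)))).
  by rewrite !lerD // ler_wpM2r ?k1I ?k1J ?k0P // mulr_ge0 ?powR_ge0 // sqr_ge0.
apply: (le_trans (ler_sum _ (fun i _ => ler_sum _ (fun j ij => point i j ij)))).
under eq_bigr do rewrite !big_split /=.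
rewrite !big_split /= mulr2n; apply: lerD; first apply: lerD.
- apply: (@le_trans _ _ (k1 * \sum_(i | QI i) F i `^ pexp R (rI i))); last first.
    by rewrite -[X in _ <= X]mulr1 ler_wpM2l.
  rewrite mulr_sumr [X in _ <= X]big_mkcond; apply: ler_sum => i _ /=.
  rewrite -mulr_sumr -mulr_suml -sqF; have [[j ij]|nj] := pselect (exists j, P i j).
    by have [-> i0] := PI ij; rewrite [_ ^+ 2 * _]mulrC pw // sqrtr_ge0.
  have -> : F i ^+ 2 = 0 by rewrite sqF big1 // => j ij; case: nj; exists j.
  by rewrite mul0r mulr0; case: ifP => // _; rewrite mulr_ge0 ?powR_ge0.
- apply: (@le_trans _ _ (k1 * \sum_(j | QJ j) G j `^ pexp R (rJ j))); last first.
    by rewrite -[X in _ <= X]mulr1 ler_wpM2l.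
  rewrite (exchange_big_dep xpredT) //=.
  rewrite mulr_sumr [X in _ <= X]big_mkcond; apply: ler_sum => j _ /=.
  rewrite -mulr_sumr -mulr_suml -sqG; have [[i ij]|nj] := pselect (exists i, P i j).
    by have [-> j0] := PJ ij; rewrite [_ ^+ 2 * _]mulrC pw // sqrtr_ge0.
  have -> : G j ^+ 2 = 0 by rewrite sqG big1 // => i ij; case: nj; exists i.
  by rewrite mul0r mulr0; case: ifP => // _; rewrite mulr_ge0 ?powR_ge0.
- apply: (@le_trans _ _ (k0 * ((\sum_(i | QI i) F i `^ pexp R (rI i)) *
     \sum_(j | QJ j) G j `^ pexp R (rJ j)))); last first.
    rewrite -[X in _ <= X]mulr1 ler_wpM2l // mulr_ile1 //.
    + by rewrite sumr_ge0 // => *; exact: powR_ge0.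
    + by rewrite sumr_ge0 // => *; exact: powR_ge0.
  rewrite big_distrlr /= mulr_sumr [X in _ <= X]big_mkcond.
  apply: ler_sum => i _ /=; have [Qi|Qi] := ifPn; last first.
    by rewrite big1 // => j /PI[]; rewrite (negbTE Qi).
  rewrite mulr_sumr [X in _ <= X]big_mkcond [X in X <= _]big_mkcond.
  apply: ler_sum => j _ /=; case: ifPn => [/PJ[-> //]|_].
  by case: ifP => // _; rewrite !mulr_ge0 ?powR_ge0.
Qed.

End Blei.

(** * Coefficient blocks *)

Section Coefficients.
Variables (R : realType) (n N : nat) (w : R[i]).
Hypothesis wP : N.+1.-primitive_root w.
Local Notation expo := {ffun 'I_n -> 'I_N.+1}.
Implicit Types (al be x : expo) (X Y S T : {set 'I_n}) (u z : 'I_n -> R[i]).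
Local Notation trig := (@trig R n N w).
Local Notation pt := (@pt R n N w).

Definition torus z := forall i, normc (z i) = 1.

Variable a : expo -> R[i].
Variable d : nat.
Hypothesis a_deg : forall al, a al != 0 -> (deg al <= d)%N.
Hypothesis d_gt0 : (0 < d)%N.
Hypothesis dN : (d.*2 <= N)%N.

Definition ev u : R[i] := \sum_al a al * mon al u.

Hypothesis ev_le1 : forall u, torus u -> normc (ev u) <= 1.

Let N_gt0 : (0 < N)%N.
Proof. by apply: leq_trans dN; rewrite double_gt0. Qed.

Definition mix X u z : 'I_n -> R[i] := fun i => if i \in X then u i else z i.
Definition agree X T al := [forall i in X, al i == (i \in T) :> nat].
(* With the variables outside X frozen at z, the coefficient of the squarefree monomial
   with support T in the variables of X. *)
Definition coef X T z : R[i] :=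
  \sum_(al | agree X T al) a al * \prod_(i | i \notin X) z i ^+ al i.

Definition restr X al : expo := [ffun i => if i \in X then al i else ord0].
Definition ind T : expo := [ffun i => inord (i \in T)].
Definition mixcoef X T Y z be : R[i] :=
  \sum_(al | agree X T al && (restr Y al == be))
    a al * \prod_(i | i \notin X :|: Y) z i ^+ al i.

Lemma torus_mix X u z : torus u -> torus z -> torus (mix X u z).
Proof. by move=> hu hz i; rewrite /mix; case: ifP. Qed.

Lemma torus_pt x : torus (pt x).
Proof. by move=> i; exact: normc_pt. Qed.

Lemma indE T i : ind T i = (i \in T) :> nat.
Proof. by rewrite ffunE inordK //; case: (i \in T). Qed.

Lemma deg_ind T : deg (ind T) = #|T|.
Proof.
rewrite /deg (eq_bigr (fun i => (i \in T) : nat)); last by move=> i _; rewrite indE.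
by rewrite -sum1_card [RHS]big_mkcond; apply: eq_bigr => i _; case: (i \in T).
Qed.

Lemma ind_inj : injective ind.
Proof.
move=> S T /ffunP e; apply/setP => i.
by have := congr1 val (e i); rewrite /= !indE; do 2 case: (_ \in _).
Qed.

Lemma deg_restr Y al : (deg (restr Y al) <= deg al)%N.
Proof. by apply: leq_sum => i _; rewrite ffunE; case: ifP. Qed.

Lemma mixcoef_deg X T Y z be : mixcoef X T Y z be != 0 -> (deg be <= d)%N.
Proof.
apply: contraR => nd; apply/eqP; rewrite /mixcoef big1 // => al /andP[_ /eqP e].
suff -> : a al = 0 by rewrite mul0r.
apply/eqP; apply: contraR nd => /a_deg; rewrite -e; apply: leq_trans.
exact: deg_restr.
Qed.

(** Obtained by grouping the exponents according to their restriction to Y. *)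
Lemma coef_mix X T Y z x : [disjoint X & Y] ->
  coef X T (mix Y (pt x) z) = trig (mixcoef X T Y z) x.
Proof.
move=> XY; rewrite /coef (partition_big (restr Y) xpredT) //=.
apply: eq_bigr => be _; rewrite mulr_suml; apply: eq_bigr => al /andP[_ /eqP <-].
rewrite -mulrA; congr (_ * _); rewrite /mon !(big_mkcond (fun i => i \notin _)).
rewrite -big_split; apply: eq_bigr => i _ /=; rewrite /mix ffunE finset.in_setU.
have [iX|iX] /= := boolP (i \in X).
  by rewrite (disjointFr XY iX) expr0 mulr1.
by case: (i \in Y) => /=; rewrite ?mul1r ?expr0 ?mulr1.
Qed.

(** Extracting S and then T is extracting their union. This makes an l^2 sum over T part of an L^2
    norm in the variables of Y. *)
Lemma mixcoef_ind X S Y T z : [disjoint X & Y] -> S \subset X -> T \subset Y ->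
  mixcoef X S Y z (ind T) = coef (X :|: Y) (S :|: T) z.
Proof.
move=> XY SX TY; apply: eq_bigl => al; apply/andP/forall_inP.
  move=> [/forall_inP h /eqP e] i; rewrite !finset.in_setU => /orP[iX|iY].
    rewrite (eqP (h _ iX)); case: (boolP (i \in T)) => [iT|_]; last by rewrite orbF.
    by have := fintype.subsetP TY _ iT; rewrite (disjointFr XY iX).
  have := congr1 (fun g : expo => val (g i)) e; rewrite /= ffunE iY indE => ->.
  case: (boolP (i \in S)) => // iS.
  by have := fintype.subsetP SX _ iS; rewrite (disjointFl XY iY).
move=> h; split.
  apply/forall_inP => i iX; rewrite (eqP (h i _)) ?finset.in_setU ?iX //.
  case: (boolP (i \in T)) => [iT|_]; last by rewrite orbF.
  by have := fintype.subsetP TY _ iT; rewrite (disjointFr XY iX).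
apply/eqP/ffunP => i; apply: val_inj; rewrite /= ffunE indE.
case: (boolP (i \in Y)) => iY.
  rewrite (eqP (h i _)) ?finset.in_setU ?iY ?orbT //.
  case: (boolP (i \in S)) => // iS.
  by have := fintype.subsetP SX _ iS; rewrite (disjointFl XY iY).
case: (boolP (i \in T)) => // iT.
by have := fintype.subsetP TY _ iT; rewrite (negbTE iY).
Qed.

(** At most one i contributes: agreement on X with the singleton of i means that al has total degree
    1 in X, placed at i. *)
Lemma sum_agree X al u :
  \sum_(i in X | agree X [set i] al) u i =
  if (\sum_(i in X) al i == 1)%N then \prod_(i in X) u i ^+ al i else 0.
Proof.
case: ifPn => [|h]; last first.
  rewrite big1 // => i /andP[iX /forall_inP ag]; case/negP: h.
  rewrite (bigD1 i) //= (eqP (ag _ iX)) set11 big1 // => j /andP[jX ji].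
  by rewrite (eqP (ag _ jX)) finset.in_set1 (negbTE ji).
move=> s1; have [i iX ai] : exists2 i, i \in X & (0 < al i)%N.
  apply/exists_inP; apply: contraLR s1; rewrite negb_exists_in => /forall_inP h.
  by rewrite big1 // => i /h; rewrite lt0n negbK => /eqP.
move: s1; rewrite (bigD1 i) //= => s1.
have ai1 : al i = 1%N :> nat.
  by apply/eqP; rewrite eqn_leq ai andbT -(eqP s1) leq_addr.
have r0 : (\sum_(j in X | j != i) al j)%N = 0%N.
  by move/eqP: s1; rewrite ai1 add1n => -[].
have aj j : j \in X -> j != i -> al j = 0%N :> nat.
  move=> jX ji; move/eqP: r0; rewrite sum_nat_eq0 => /forallP/(_ j).
  by rewrite jX ji => /eqP.
rewrite (bigD1 i) /=; last first.
  rewrite iX; apply/forall_inP => j jX; rewrite finset.in_set1.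
  by case: (eqVneq j i) => [->|/aj ->//]; rewrite ai1.
rewrite big1 ?addr0; last first.
  move=> j /andP[/andP[jX /forall_inP/(_ _ iX)]]; rewrite finset.in_set1 ai1.
  by move=> e ji; move: e; rewrite [i == j]eq_sym (negbTE ji).
rewrite (bigD1 i) //= ai1 expr1 big1 ?mulr1 // => j /andP[jX ji].
by rewrite aj // expr0.
Qed.

(* Rotating the variables in X by a common phase isolates the part of degree one in X. *)
Lemma sum_coef1 X z : torus z -> \sum_(i in X) normc (coef X [set i] z) <= 1.
Proof.
move=> hz; pose c i := coef X [set i] z.
(* Conjugate phases of the coefficients: at u the linear form takes the value of the sum to be
   bounded. *)
pose u i := if c i == 0 then 1 else (c i)^* / ((normc (c i))%:C)%C.
have hu i : normc (u i) = 1.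
  rewrite /u; case: eqVneq => [_|ci]; first exact: ComplexField.Normc.normc1.
  rewrite ComplexField.Normc.normcM ComplexField.Normc.normcV normc_conj normcC.
  by rewrite ger0_norm ?normc_ge0 // divff // normc_eq0.
have uc i : u i * c i = ((normc (c i))%:C)%C.
  rewrite /u; case: eqVneq => [->|ci].
    by rewrite mulr0 ComplexField.Normc.normc0.
  have nc : ((normc (c i))%:C)%C != 0 by rewrite -(rmorph0 (real_complex R)) (inj_eq (@complexI R)) normc_eq0.
  by apply: (mulIf nc); rewrite mulrAC mulfVK // mulrC -normc_sqr expr2 rmorphM.
pose L := avg (fun k : 'I_N.+1 => ((w ^+ 1) ^+ k)^* * ev (mix X (fun i => w ^+ k * u i) z)).
have LE : L = ((\sum_(i in X) normc (c i))%:C)%C.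
  rewrite rmorph_sum /= (eq_bigr (fun i => u i * c i)); last by move=> i _; rewrite uc.
  transitivity (\sum_al a al * (\prod_(i | i \notin X) z i ^+ al i) *
     \sum_(i in X | agree X [set i] al) u i); last first.
    rewrite (eq_bigr (fun al => \sum_(i in X | agree X [set i] al)
        a al * (\prod_(i | i \notin X) z i ^+ al i) * u i)); last first.
      by move=> al _; rewrite mulr_sumr.
    rewrite (exchange_big_dep (fun i => i \in X)) /=; last by move=> al i _ /andP[].
    apply: eq_bigr => i iX; rewrite /c /coef mulr_sumr.
    by apply: eq_big => [al|al _]; rewrite ?iX // mulrC.
  rewrite /L (eq_avg (F' := fun k : 'I_N.+1 => \sum_al
     (a al * ((\prod_(i | i \notin X) z i ^+ al i) * \prod_(i in X) u i ^+ al i)) *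
     ((w ^+ (\sum_(i in X) al i)) ^+ k * ((w ^+ 1) ^+ k)^*))); last first.
    move=> k; rewrite mulr_sumr; apply: eq_bigr => al _.
    have -> : mon al (mix X (fun i => w ^+ k * u i) z) =
       (\prod_(i | i \notin X) z i ^+ al i) * ((\prod_(i in X) u i ^+ al i) *
         (w ^+ (\sum_(i in X) al i)) ^+ k).
      rewrite -prodrXr -prodrXl -big_split /mon [LHS](bigID (fun i => i \in X)) /= mulrC.
      congr (_ * _); apply: eq_bigr => i; rewrite /mix.
        by move=> /negbTE ->.
      by move=> ->; rewrite exprMn mulrC -!exprM mulnC.
    by ring.
  rewrite avg_sum; apply: eq_bigr => al _; rewrite avgZ /avg card_ord sum_root //.
  rewrite sum_agree; have [->|/a_deg ad] := eqVneq (a al) 0; first by rewrite !mul0r.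
  have sd : (\sum_(i in X) al i <= d)%N.
    by apply: leq_trans ad; rewrite /deg [X in (_ <= X)%N](bigID (fun i => i \in X)) leq_addr.
  rewrite !modn_small ?ltnS //; last first.
    by rewrite (leq_trans sd) // (leq_trans _ dN) // -addnn leq_addr.
  case: eqP => _; rewrite ?mul0r ?mulr0 // divff ?mulr1 ?mulrA //.
have <- : normc L = \sum_(i in X) normc (c i).
  by rewrite LE normcC ger0_norm // sumr_ge0 // => i _; exact: normc_ge0.
apply: (le_trans (normc_avg _)); apply: (@le_trans _ _ (avg (fun _ : 'I_N.+1 => 1))); last first.
  by rewrite avg_const ?card_ord.
apply: ler_avg => k; rewrite ComplexField.Normc.normcM normc_conj !normcX (normc_root wP).
rewrite !expr1n mul1r; apply: ev_le1; apply: torus_mix => // i.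
by rewrite ComplexField.Normc.normcM normcX (normc_root wP) expr1n mul1r hu.
Qed.

End Coefficients.

(** Since p >= 1, enlarging the constant by lam divides each p-th power by at least lam. A sum
    exceeding 1 is thus absorbed into the constant, even if its terms have different exponents. *)
Lemma powR_rescale (R : realType) (x lam p : R) :
  0 <= x -> 1 <= lam -> 1 <= p -> (x / lam) `^ p <= x `^ p / lam.
Proof.
move=> x0 l1 p1; have l0 : 0 < lam by apply: lt_le_trans l1.
rewrite powRM ?invr_ge0 ?(ltW l0) // ler_wpM2l ?powR_ge0 //.
rewrite -[X in _ <= X]powRr1 ?invr_ge0 ?(ltW l0) // ger_powR //.
by rewrite invr_gt0 l0 invf_le1.
Qed.

Lemma sqrt_sum_div (R : realType) I r (P : pred I) (F : I -> R) (c : R) : 0 < c ->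
  Num.sqrt (\sum_(i <- r | P i) (F i / c) ^+ 2) =
  Num.sqrt (\sum_(i <- r | P i) F i ^+ 2) / c.
Proof.
move=> c0; rewrite (eq_bigr (fun i => F i ^+ 2 * c ^- 2)); last first.
  by move=> i _; rewrite expr_div_n.
rewrite -mulr_suml sqrtrM ?sumr_ge0 // => [|*]; last exact: sqr_ge0.
by rewrite -exprVn sqrtr_sqr gtr0_norm ?invr_gt0.
Qed.

(** * Splitting the variables into two halves *)

Section Step.
Variables (R : realType) (n N : nat) (w : R[i]).
Hypothesis wP : N.+1.-primitive_root w.
Local Notation expo := {ffun 'I_n -> 'I_N.+1}.
Implicit Types (al be x : expo) (X Y S T A : {set 'I_n}) (u z : 'I_n -> R[i]).
Local Notation trig := (@trig R n N w).
Local Notation pt := (@pt R n N w).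
Variable a : expo -> R[i].
Variable d : nat.
Hypothesis a_deg : forall al, a al != 0 -> (deg al <= d)%N.
Hypothesis d_gt0 : (0 < d)%N.
Hypothesis dN : (d.*2 <= N)%N.
Hypothesis ev_le1 : forall u, torus u -> normc (ev a u) <= 1.
Local Notation coef := (coef a).

(* Quantifying over X and z makes the bound on a random half of X an instance of the bound
   for smaller degrees. *)
Definition BH (V : pred nat) (D : R) := forall X z, torus z ->
  \sum_(T : {set 'I_n} | (T \subset X) && V #|T|)
     (normc (coef X T z) / D) `^ pexp R #|T| <= 1.

(** [gp] lists the pairs of sizes allowed for the two halves; it serves both the windows and the
    splitting into 1 and J used for small degrees. *)
Definition hyper (gp : rel nat) (j : nat) (H : R) := forall b : expo -> R[i],
  (forall be, b be != 0 -> (deg be <= d)%N) ->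
  Num.sqrt (\sum_(be | gp j (deg be)) normc (b be) ^+ 2) `^ pexp R j <=
  H `^ pexp R j * avg (fun x => normc (trig b x) `^ pexp R j).

(** For fixed S the coefficients indexed by T are Fourier coefficients of x -> coef X S (mix Y (pt
    x) z), so hypercontractivity trades their l^2 sum for an L^p mean. Once sum and mean are
    exchanged, [BH V D] applies at each frozen point. *)
Lemma mixed_norm (V : pred nat) (gp : rel nat) D H X Y z :
  0 < D -> 0 < H -> BH V D -> (forall j, V j -> hyper gp j H) ->
  [disjoint X & Y] -> torus z ->
  \sum_(S : {set 'I_n} | (S \subset X) && V #|S|)
    Num.sqrt (\sum_(T : {set 'I_n} | (T \subset Y) && gp #|S| #|T|)
      (normc (coef (X :|: Y) (S :|: T) z) / (H * D)) ^+ 2) `^ pexp R #|S| <= 1.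
Proof.
move=> D0 H0 BV hyp XY hz.
apply: (@le_trans _ _ (avg (fun x : expo =>
    \sum_(S : {set 'I_n} | (S \subset X) && V #|S|)
      (normc (coef X S (mix Y (pt x) z)) / D) `^ pexp R #|S|))); last first.
  apply: (@le_trans _ _ (avg (fun _ : expo => 1))); last first.
    by rewrite avg_const // card_ffun !card_ord expn_gt0.
  by apply: ler_avg => x; apply: BV; apply: torus_mix => //; exact: torus_pt.
rewrite avg_sum; apply: ler_sum => S /andP[SX VS].
set b := mixcoef a X S Y z; set p := pexp R #|S|.
have bd be : b be != 0 -> (deg be <= d)%N by apply: mixcoef_deg.
have HD0 : 0 < H * D by rewrite mulr_gt0.
have p0 : 0 <= p by rewrite divr_ge0 // mulr_ge0.
apply: (@le_trans _ _ ((Num.sqrt (\sum_(be | gp #|S| (deg be)) normc (b be) ^+ 2) /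
    (H * D)) `^ p)).
  rewrite ge0_ler_powR ?nnegrE ?sqrtr_ge0 ?divr_ge0 ?sqrtr_ge0 ?(ltW HD0) //.
  rewrite sqrt_sum_div // ler_wpM2r ?invr_ge0 ?(ltW HD0) // ler_wsqrtr //.
  rewrite (eq_bigr (fun T => normc (b (ind N T)) ^+ 2)); last first.
    by move=> T /andP[TY _]; rewrite /b (mixcoef_ind a d_gt0 dN).
  rewrite -(big_imset (fun be => normc (b be) ^+ 2) (h := @ind n N)) /=; last first.
    by move=> T T' _ _; apply: (ind_inj d_gt0 dN).
  (* The exponents of allowed degree that are not of the form [ind N T] only add nonnegative
     terms. *)
  rewrite [X in _ <= X](bigID (mem [set ind N T | T in (fun T : {set 'I_n} => (T \subset Y) && gp #|S| #|T|)])) /=.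
  apply: ler_wpDr; first by rewrite sumr_ge0 // => *; exact: sqr_ge0.
  rewrite le_eqVlt; apply/orP; left; apply/eqP; apply: eq_bigl => be.
  apply/idP/andP => [h|[]//]; split=> //.
  by case/imsetP: h => T; rewrite unfold_in => /andP[_ gT] ->; rewrite (deg_ind d_gt0 dN).
rewrite powRM ?sqrtr_ge0 ?invr_ge0 ?(ltW HD0) //.
apply: (le_trans (ler_wpM2r _ (hyp _ VS _ bd))); first exact: powR_ge0.
rewrite mulrAC -powRM ?invr_ge0 ?(ltW H0) ?(ltW HD0) //.
rewrite invfM [H * (_ * _)]mulrA divff ?gt_eqF // mul1r -avgZ.
rewrite le_eqVlt; apply/orP; left; apply/eqP; apply: eq_avg => x.
rewrite -powRM ?invr_ge0 ?normc_ge0 ?(ltW D0) // mulrC.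
by rewrite /b -coef_mix.
Qed.

(** T is the disjoint union of its traces on A and on the complement; [mixed_norm], used once from
    each side, gives both hypotheses of Blei's inequality. *)
Lemma hyper_split (V : pred nat) (gp : rel nat) D H k1 k0 X A z :
  0 < D -> 0 < H -> BH V D -> (forall j, V j -> hyper gp j H) ->
  symmetric gp -> (forall j l, gp j l -> V j /\ (0 < j)%N) ->
  (forall j l, gp j l -> j%:R / (j + l).+1%:R <= k1) ->
  (forall j l, gp j l -> ((j + l).+1%:R)^-1 <= k0) ->
  0 <= k1 -> 0 <= k0 -> torus z ->
  \sum_(T : {set 'I_n} | (T \subset X) && gp #|T :&: A| #|T :\: A|)
     (normc (coef X T z) / (H * D)) `^ pexp R #|T| <= k1 *+ 2 + k0.
Proof.
move=> D0 H0 BV hyp gpC gpV gp1 gp0 k10 k00 hz.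
set X1 := X :&: A; set X2 := X :\: A.
have XE : X1 :|: X2 = X by exact: finset.setID.
have dX : [disjoint X1 & X2].
  rewrite -finset.setI_eq0; apply/eqP/setP => i; rewrite !inE.
  by case: (i \in A); rewrite ?andbF.
pose f S T := normc (coef X (S :|: T) z) / (H * D).
pose P (S T : {set 'I_n}) := [&& S \subset X1, T \subset X2 & gp #|S| #|T|].
have f0 S T : 0 <= f S T by rewrite divr_ge0 ?normc_ge0 ?mulr_ge0 // ltW.
have := @blei R _ _ f (fun S => #|S|) (fun T => #|T|) P
  (fun S => (S \subset X1) && V #|S|) (fun T => (T \subset X2) && V #|T|) k1 k0 f0.
have -> : \sum_S \sum_(T | P S T) f S T `^ pexp R (#|S| + #|T|) =
  \sum_(T : {set 'I_n} | (T \subset X) && gp #|T :&: A| #|T :\: A|)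
     (normc (coef X T z) / (H * D)) `^ pexp R #|T|.
  rewrite pair_big_dep /=.
  rewrite (reindex_onto (fun U => (U :&: A, U :\: A)) (fun p => p.1 :|: p.2)) /=.
    apply: eq_big => [U|U _].
      rewrite finset.setID eqxx andbT /P /X1 /X2.
      case: (boolP (U \subset X)) => UX; first by rewrite finset.setSI ?finset.setSD.
      apply/negbTE; apply: contra UX => /and3P[UA UB _].
      by rewrite -(finset.setID U A) -XE finset.setUSS.
    by rewrite /f finset.setID cardsID.
  move=> [S T] /= /and3P[SX TX _].
  have hS i : i \in S -> i \in A.
    by move=> /(fintype.subsetP SX); rewrite !inE => /andP[].
  have hT i : i \in T -> i \notin A.
    by move=> /(fintype.subsetP TX); rewrite !inE => /andP[].
  congr pair; apply/setP => i; rewrite !inE; move: (hS i) (hT i);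
  by case: (i \in S); case: (i \in T); case: (i \in A) => //= h1 h2;
  solve [exact: h1 | exact: h2 | by have := h1 isT | by have := h2 isT].
apply => //.
- by move=> S T /and3P[-> _ g]; have [-> ?] := gpV _ _ g.
- by move=> S T /and3P[_ -> g]; rewrite gpC in g; have [-> ?] := gpV _ _ g.
- by move=> S T /and3P[_ _ g]; exact: gp1.
- by move=> S T /and3P[_ _ g]; rewrite addnC; apply: gp1; rewrite gpC.
- by move=> S T /and3P[_ _ g]; exact: gp0.
- apply: le_trans (mixed_norm D0 H0 BV hyp dX hz); rewrite XE.
  apply: ler_sum => S /andP[SX _]; rewrite le_eqVlt; apply/orP; left; apply/eqP.
  by congr (Num.sqrt _ `^ _); apply: eq_bigl => T; rewrite /P SX.
- rewrite disjoint_sym in dX.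
  apply: le_trans (mixed_norm D0 H0 BV hyp dX hz); rewrite finset.setUC XE.
  apply: ler_sum => T /andP[TX _]; rewrite le_eqVlt; apply/orP; left; apply/eqP.
  congr (Num.sqrt _ `^ _); apply: eq_big => [S|S _]; first by rewrite /P TX gpC.
  by rewrite /f finset.setUC.
Qed.

(** Averages [hyper_split] over all A: a T of size in W is split admissibly by a proportion at least
    q of the sets, which costs 1/q, and lam absorbs the total. *)
Lemma BH_split (W V : pred nat) (gp : rel nat) D H k1 k0 q lam :
  0 < D -> 0 < H -> BH V D -> (forall j, V j -> hyper gp j H) ->
  symmetric gp -> (forall j l, gp j l -> V j /\ (0 < j)%N) ->
  (forall j l, gp j l -> j%:R / (j + l).+1%:R <= k1) ->
  (forall j l, gp j l -> ((j + l).+1%:R)^-1 <= k0) ->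
  0 <= k1 -> 0 <= k0 -> 0 < q ->
  (forall j, W j -> (0 < j)%N) ->
  (forall T : {set 'I_n}, W #|T| ->
    q * 2 ^+ n <= #|[set A : {set 'I_n} | gp #|T :&: A| #|T :\: A|]|%:R) ->
  1 <= lam -> (k1 *+ 2 + k0) / q <= lam ->
  BH W (lam * (H * D)).
Proof.
move=> D0 H0 BV hyp gpC gpV gp1 gp0 k10 k00 q0 W0 cnt l1 lq X z hz.
have l0 : 0 < lam by apply: lt_le_trans l1.
have HD0 : 0 < H * D by rewrite mulr_gt0.
pose g (T : {set 'I_n}) := (normc (coef X T z) / (H * D)) `^ pexp R #|T|.
have g0 T : 0 <= g T by exact: powR_ge0.
apply: (@le_trans _ _ (\sum_(T : {set 'I_n} | (T \subset X) && W #|T|) g T / lam)).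
  apply: ler_sum => T /andP[_ /W0 T0]; rewrite [lam * _]mulrC invfM mulrA.
  by rewrite powR_rescale ?pexp_ge1 // divr_ge0 ?normc_ge0 // ltW.
rewrite -mulr_suml ler_pdivrMr // mul1r; apply: le_trans lq.
rewrite ler_pdivlMr // -(@ler_pM2r _ (2 ^+ n)) ?exprn_gt0 // -mulrA mulr_suml.
apply: (@le_trans _ _ (\sum_(A : {set 'I_n})
    \sum_(T : {set 'I_n} | (T \subset X) && gp #|T :&: A| #|T :\: A|) g T)); last first.
  rewrite (le_trans (ler_sum _ (fun A _ =>
     hyper_split X A D0 H0 BV hyp gpC gpV gp1 gp0 k10 k00 hz))) //.
  rewrite sumr_const -[_ *+ #|_|]mulr_natr -natrX ler_wpM2l ?addr_ge0 ?mulrn_wge0 //.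
  by rewrite ler_nat -cardsT -powersetT card_powerset cardsT card_ord.
rewrite (exchange_big_dep (fun T : {set 'I_n} => T \subset X)) /=; last first.
  by move=> A T _ /andP[].
rewrite [X in X <= _]big_mkcondr; apply: ler_sum => T TX.
rewrite TX; case: ifPn => [WT|_]; last by rewrite sumr_ge0.
rewrite sumr_const -[g T *+ _]mulr_natr ler_wpM2l //.
apply: (le_trans (cnt _ WT)); rewrite ler_nat.
by apply: subset_leq_card; apply/fintype.subsetP => A; rewrite !inE.
Qed.

End Step.

(** * Random subsets and their traces *)

Section Counting.
Variables (R : realType) (n : nat).
Implicit Types (A T : {set 'I_n}) (i j : 'I_n).

Lemma card_set_ord : #|{: {set 'I_n}}| = (2 ^ n)%N.
Proof. by rewrite -cardsT -powersetT card_powerset cardsT card_ord. Qed.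

(** For a fixed t in T, the sets t |: B with B disjoint from T already suffice. *)
Lemma card_trace_singleton T : (0 < #|T|)%N ->
  (2 ^ n <= 2 ^ #|T| * #|[set A : {set 'I_n} | #|T :&: A| == 1%N]|)%N.
Proof.
case/card_gt0P => t tT; have -> : (2 ^ n = 2 ^ #|T| * 2 ^ #|~: T|)%N.
  by rewrite -expnD cardsC card_ord.
rewrite leq_mul2l; apply/orP; right; rewrite -card_powerset.
rewrite -(card_in_imset (f := fun B => t |: B) (D := powerset (~: T))).
  apply: subset_leq_card; apply/fintype.subsetP => A /imsetP[B].
  rewrite !inE => BT ->; apply/cards1P; exists t.
  apply/setP => i; rewrite !inE; have [->|_] := eqVneq i t; first by rewrite tT.
  have := fintype.subsetP BT i; rewrite !inE.
  by case: (i \in T); case: (i \in B) => //= /(_ isT).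
move=> B B'; rewrite !inE => BT BT' /setP e; apply/setP => i.
have := e i; rewrite !inE; have [->|//] := eqVneq i t.
move=> _; have := fintype.subsetP BT t; have := fintype.subsetP BT' t.
rewrite !inE tT; case: (t \in B); case: (t \in B') => //=.
  by move=> _ /(_ isT).
by move=> /(_ isT).
Qed.

Definition sgnA A i : R := if i \in A then 1 else -1.

Definition flip i A : {set 'I_n} := [set k | (k \in A) (+) (k == i)].

Lemma flipK i : involutive (flip i).
Proof. by move=> A; apply/setP => k; rewrite !inE -addbA addbb addbF. Qed.

(** Flipping the membership of i is an involution that negates each term. *)
Lemma sum_sgnA i j : i != j -> \sum_A sgnA A i * sgnA A j = 0.
Proof.
move=> ij; set s := \sum_A _; suff : s = - s by move=> h; lra.
rewrite {1}/s (reindex_inj (can_inj (flipK i))) /s -sumrN.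
apply: eq_bigr => A _; rewrite /sgnA !inE eqxx (negbTE (_ : j != i)) 1?eq_sym //.
by rewrite addbF addbT; do 2 case: (_ \in A) => /=; ring.
Qed.

(** The difference of the traces is a sum of signs over T, and orthogonality of the signs leaves the
    diagonal. *)
Lemma sum_trace_sqr T :
  \sum_A (#|T :&: A|%:R - #|T :\: A|%:R) ^+ 2 = 2 ^+ n * #|T|%:R :> R.
Proof.
have e A : #|T :&: A|%:R - #|T :\: A|%:R = \sum_(i in T) sgnA A i.
  rewrite (bigID (fun i => i \in A)) /= (eq_bigr (fun=> 1)); last first.
    by move=> i /andP[_ iA]; rewrite /sgnA iA.
  rewrite [X in _ = _ + X](eq_bigr (fun=> -1)); last first.
    by move=> i /andP[_ iA]; rewrite /sgnA (negbTE iA).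
  rewrite !sumr_const mulNrn; congr (_%:R - _%:R).
    by apply: eq_card => i; rewrite !inE.
  by apply: eq_card => i; rewrite !inE andbC.
rewrite (eq_bigr (fun A => \sum_(i in T) \sum_(j in T) sgnA A i * sgnA A j)); last first.
  by move=> A _; rewrite e expr2 big_distrlr.
rewrite exchange_big /= (eq_bigr (fun=> 2 ^+ n)); last first.
  move=> i iT; rewrite exchange_big (bigD1 i) //= [X in _ + X]big1 => [|j /andP[_ ji]].
    rewrite addr0 (eq_bigr (fun=> 1)) ?sumr_const.
      by rewrite card_set_ord natrX.
    by move=> A _; rewrite /sgnA; case: ifP => _; ring.
  by rewrite sum_sgnA // eq_sym.
by rewrite sumr_const mulr_natr.
Qed.

Lemma chebyshev_trace T (t : R) : 0 < t ->
  2 ^+ n - 2 ^+ n * #|T|%:R / t <=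
  #|[set A : {set 'I_n} | (#|T :&: A|%:R - #|T :\: A|%:R) ^+ 2 <= t]|%:R.
Proof.
move=> t0; set S := [set A | _].
have h : 2 ^+ n = #|S|%:R + #|~: S|%:R :> R.
  by rewrite -natrD cardsC card_set_ord natrX.
rewrite lerBlDr {1}h lerD2l ler_pdivlMr // -sum_trace_sqr.
rewrite -sum1_card natr_sum mulr_suml [X in X <= _]big_mkcond.
apply: ler_sum => A _; rewrite !inE; case: ifPn => [|_]; last exact: sqr_ge0.
by rewrite mul1r -ltNge => /ltW.
Qed.

End Counting.

(** In passing to degree K >= 2, the factor 3 is 2 k1 + k0 with k1 = k0 = 1, and 4^K is the product
    of 2 (union with the smaller degrees), 2^K (inverse proportion of sets meeting T in one point)
    and 2^(K-1) (hypercontractivity). *)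
Fixpoint base_const (J : nat) : nat :=
  if J is J'.+1 then (3 * 4 ^ J'.+1 * base_const J')%N else 1%N.

(** * Operations on the bounds, and small degrees *)

Section Recursion.
Variables (R : realType) (n N : nat) (w : R[i]).
Hypothesis wP : N.+1.-primitive_root w.
Local Notation expo := {ffun 'I_n -> 'I_N.+1}.
Variable a : expo -> R[i].
Variable d : nat.
Hypothesis a_deg : forall al, a al != 0 -> (deg al <= d)%N.
Hypothesis d_gt0 : (0 < d)%N.
Hypothesis dN : (d.*2 <= N)%N.
Hypothesis ev_le1 : forall u, torus u -> normc (ev a u) <= 1.
Local Notation BH := (@BH R n N a).
Local Notation hyper := (@hyper R n N w d).

Lemma hyper_dual (gp : rel nat) (j : nat) (H : R) :
  (1 < j)%N -> 1 <= H -> (forall l, gp j l -> 2 `^ (l%:R / j%:R) <= H) ->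
  hyper gp j H.
Proof.
move=> j1 H1 gH b bd.
pose U (be : expo) := gp j (deg be).
(* The largest degree of b among those related to j; if there is none it is 0, a case covered by
   [1 <= H]. *)
pose l := \max_(be : expo | U be && (b be != 0)) deg be.
have lE : (l <= d)%N /\ 2 `^ (l%:R / j%:R) <= H.
  rewrite /l; elim/big_ind: _ => [|x y [xd xH] [yd yH]|be /andP[Ube /bd]].
  - by rewrite mul0r powRr0.
  - by rewrite /maxn; case: ifP.
  - by move=> bed; split=> //; exact: gH.
have lN : (l.*2 <= N)%N by apply: leq_trans dN; rewrite leq_double; case: lE.
have Ul be : U be -> b be != 0 -> (deg be <= l)%N.
  by move=> Ube bbe; rewrite (leq_bigmax_cond (F := @deg n N)) // Ube.
apply: (le_trans (hypercontractive_dual wP j1 lN Ul)).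
apply: ler_wpM2r; first by apply: avg_ge0 => x; exact: powR_ge0.
have p0 : 0 <= pexp R j by rewrite ltW // pexp_gt0 // ltnW.
have H0 : 0 <= H := le_trans ler01 H1.
by apply: ge0_ler_powR; rewrite ?nnegrE ?powR_ge0 //; case: lE.
Qed.

Lemma hyper_linear (gp : rel nat) (l : nat) (H : R) :
  (l <= d)%N -> 2 `^ l%:R <= H -> (forall k, gp 1%N k -> k = l) -> hyper gp 1%N H.
Proof.
move=> ld lH gl b bd; have lN : (l.*2 <= N)%N by apply: leq_trans dN; rewrite leq_double.
have bN be : b be != 0 -> (deg be <= N)%N.
  by move=> /bd bed; rewrite (leq_trans bed) // (leq_trans _ dN) // -addnn leq_addr.
have := hypercontractive_linear wP lN bN.
have -> : pexp R 1 = 1 by rewrite /pexp mulr1 divff.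
rewrite !powRr1 ?sqrtr_ge0 ?powR_ge0 // ?(le_trans (powR_ge0 _ _) lH) // divr1 => h.
apply: le_trans (le_trans h _); last first.
  by rewrite ler_wpM2r // avg_ge0 // => x; exact: powR_ge0.
rewrite ler_wsqrtr // big_mkcond [X in _ <= X]big_mkcond; apply: ler_sum => be _.
by case: ifP => [/gl ->|_]; [rewrite eqxx | case: ifP => // _; exact: sqr_ge0].
Qed.

Lemma BH_mono V D D' : 0 < D -> D <= D' -> BH V D -> BH V D'.
Proof.
move=> D0 DD' B X z hz; apply: le_trans (B X z hz); apply: ler_sum => T _.
have D'0 : 0 < D' by apply: lt_le_trans DD'.
rewrite ge0_ler_powR ?nnegrE ?divr_ge0 ?mulr_ge0 ?normc_ge0 ?(ltW D0) ?(ltW D'0) //.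
by rewrite ler_wpM2l ?normc_ge0 // lef_pV2.
Qed.

Lemma BH_sub (V V' : pred nat) D : (forall j, V' j -> V j) -> BH V D -> BH V' D.
Proof.
move=> VV' B X z hz; apply: le_trans (B X z hz).
rewrite big_mkcond [X in _ <= X]big_mkcond; apply: ler_sum => T _.
case: ifPn => [/andP[-> /VV' -> //]|_]; case: ifP => // _; exact: powR_ge0.
Qed.

(** Doubling the constant at least halves every term, because the exponents are at least 1. *)
Lemma BH_union (V V' : pred nat) D : 0 < D -> (forall j, V j || V' j -> (0 < j)%N) ->
  BH V D -> BH V' D -> BH (fun j => V j || V' j) (2 * D).
Proof.
move=> D0 V0 B B' X z hz.
apply: (@le_trans _ _ ((1 + 1) / 2)); last by lra.
apply: le_trans (ler_wpM2r _ (lerD (B X z hz) (B' X z hz))); last by rewrite invr_ge0.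
rewrite big_mkcond [X in _ <= (X + _) / _]big_mkcond [X in _ <= (_ + X) / _]big_mkcond.
rewrite -big_split mulr_suml; apply: ler_sum => T _ /=.
have h (b b' : bool) (x y : R) : 0 <= x -> 0 <= y -> ((b || b') -> y <= x / 2) ->
   (if b || b' then y else 0) <= ((if b then x else 0) + (if b' then x else 0)) / 2.
  by move=> x0 y0; case: b; case: b' => /= xy; try have := xy isT; lra.
rewrite andb_orr; apply: h; rewrite ?powR_ge0 // -andb_orr => /andP[_ /V0 T0].
rewrite [2 * D]mulrC invfM mulrA powR_rescale ?pexp_ge1 ?ler1n //.
by rewrite divr_ge0 ?normc_ge0 // ltW.
Qed.

Lemma BH_leaf : BH (fun j => (0 < j <= 1)%N) 1.
Proof.
move=> X z hz; apply: le_trans (sum_coef1 wP a_deg d_gt0 dN ev_le1 X hz).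
rewrite (eq_bigl (fun T : {set 'I_n} => T \in [set [set i] | i in X])); last first.
  move=> T; apply/andP/imsetP => [[TX]|[i iX ->]].
    rewrite -eqn_leq eq_sym => /cards1P[i Ti]; exists i => //.
    by move: TX; rewrite Ti finset.sub1set.
  by rewrite finset.sub1set cards1.
rewrite big_imset /=; last by move=> i j _ _; exact: finset.set1_inj.
apply: ler_sum => i _; rewrite cards1 /pexp mulr1 divff // divr1.
by rewrite powRr1 ?normc_ge0.
Qed.

Lemma base_const_ge1 J : (0 < base_const J)%N.
Proof. by elim: J => //= J IH; rewrite !muln_gt0 expn_gt0 IH. Qed.

(** Crude induction detaching one element at a time; the size of the constant does no harm because J
    will not depend on n. *)
Lemma BH_base J : (J <= d)%N -> BH (fun j => (0 < j <= J)%N) (base_const J)%:R.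
Proof.
elim: J => [|J IHJ] Jd.
  move=> X z hz; rewrite big_pred0 // => T.
  by case: #|T| => [|k]; rewrite ?andbF.
have {}IHJ := IHJ (ltnW Jd).
have Db0 : 0 < (base_const J)%:R :> R by rewrite ltr0n base_const_ge1.
case: J => [|J] in IHJ Jd Db0 *.
  by apply: BH_mono BH_leaf => //; rewrite ler1n base_const_ge1.
pose gp j l := (j == 1%N) && (l == J.+1) || (j == J.+1) && (l == 1%N).
pose H : R := 2 ^+ J.+1.
have H1 : 1 <= H by rewrite exprn_ege1 // ler1n.
have gpC : symmetric gp.
  by move=> j l; rewrite /gp orbC; congr (_ || _); rewrite andbC.
have gpV j l : gp j l -> (0 < j <= J.+1)%N /\ (0 < j)%N.
  by case/orP => /andP[/eqP -> _]; split; rewrite ?leqnn.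
(* The one-element half is paired with the single degree J + 1, as the linear case demands; the
   other half is paired with degree 1, where duality costs at most 2. *)
have hyp j : (0 < j <= J.+1)%N -> hyper gp j H.
  move=> /andP[j0 jJ]; have [j1|j1|->] := ltngtP j 1%N; first by rewrite ltnNge j0 in j1.
    apply: hyper_dual => // l /orP[/andP[/eqP j1' _]|/andP[_ /eqP ->]].
      by rewrite j1' in j1.
    apply: (@le_trans _ _ (2 `^ 1)); last first.
      by rewrite powRr1 // /H exprS ler_peMr // exprn_ege1 // ler1n.
    rewrite ler_powR // ?ler1n // ler_pdivrMr ?ltr0n 1?ltnW // mul1r.
    by rewrite ler1n ltnW.
  apply: (@hyper_linear _ J.+1) => //; first by rewrite ltnW.
    by rewrite powR_mulrn.
  move=> k /orP[/andP[_ /eqP -> //]|/andP[/eqP <- /eqP ->]] //.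
have cnt (T : {set 'I_n}) : #|T| == J.+2 -> (2 ^+ J.+2)^-1 * 2 ^+ n <=
    #|[set A : {set 'I_n} | gp #|T :&: A| #|T :\: A|]|%:R :> R.
  move=> /eqP TJ; rewrite mulrC ler_pdivrMr ?exprn_gt0 // mulrC -!natrX -natrM ler_nat.
  have T0 : (0 < #|T|)%N by rewrite TJ.
  have := card_trace_singleton T0; rewrite TJ => h; apply: (leq_trans h).
  rewrite leq_mul2l; apply/orP; right; apply: subset_leq_card.
  apply/fintype.subsetP => A; rewrite !inE /gp => /eqP TA; rewrite TA /=.
  by have := cardsID A T; rewrite TA TJ add1n => -[->]; rewrite eqxx.
have gp1 j l : gp j l -> j%:R / (j + l).+1%:R <= 1 :> R.
  by move=> _; rewrite ler_pdivrMr ?ltr0n // mul1r ler_nat -addnS leq_addr.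
have gp0 j l : gp j l -> ((j + l).+1%:R)^-1 <= 1 :> R.
  by move=> _; rewrite invf_le1 ?ltr0n // ler1n.
have Hp : 0 < H by rewrite exprn_gt0.
have q0 : 0 < (2 ^+ J.+2)^-1 :> R by rewrite invr_gt0 exprn_gt0.
have l1 : 1 <= 3 * 2 ^+ J.+2 :> R.
  by apply: mulr_ege1; rewrite ?exprn_ege1 ?ler1n.
have lq : (1 *+ 2 + 1) / (2 ^+ J.+2)^-1 <= 3 * 2 ^+ J.+2 :> R.
  by rewrite invrK -mulrSr.
have W0 j : j == J.+2 -> (0 < j)%N by move=> /eqP ->.
have BJ := BH_split wP a_deg d_gt0 dN Db0 Hp IHJ hyp gpC gpV gp1 gp0 ler01 ler01 q0
  W0 cnt l1 lq.
set D := 3 * 2 ^+ J.+2 * _ in BJ.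
have DJ : (base_const J.+1)%:R <= D.
  rewrite /D mulrA -[X in X <= _]mul1r ler_wpM2r ?(ltW Db0) //; exact: mulr_ege1.
have D0 : 0 < D by apply: lt_le_trans DJ.
have V0 j : (0 < j <= J.+1)%N || (j == J.+2) -> (0 < j)%N.
  by case/orP => [/andP[]//|/eqP ->].
have := BH_union D0 V0 (BH_mono Db0 DJ IHJ) BJ.
have -> : 2 * D = (base_const J.+2)%:R.
  have -> : base_const J.+2 = (3 * 4 ^ J.+2 * base_const J.+1)%N by [].
  rewrite /D /H 2!natrM natrX.
  have -> : 4 ^+ J.+2 = 2 * 2 ^+ J.+1 * 2 ^+ J.+2 :> R.
    by rewrite -exprS -exprMn -natrM.
  by ring.
apply: BH_sub => j /andP[j0]; rewrite leq_eqVlt => /orP[->|]; first by rewrite orbT.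
by rewrite ltnS j0 => ->.
Qed.

End Recursion.

(** * The Bohnenblust-Hille recursion *)

Section Windows.
Variable R : realType.

(* The width makes Chebyshev's inequality send both random halves of a set with size in the
   window of 2k into the window of k with probability at least 49/50; for large k the
   window is contained in [49/50 k, 51/50 k]. *)
Definition window (k j : nat) : bool := (j%:R - k%:R) ^+ 2 <= 1000 * k%:R :> R.
Definition large (k : nat) : bool := 1000 * 2500 <= k%:R :> R.

(** [large] is the threshold beyond which 1000 k <= (k / 50)^2. *)
Lemma window_bounds k j : large k -> window k j ->
  49 / 50 * k%:R <= j%:R :> R /\ j%:R <= 51 / 50 * k%:R :> R.
Proof.
rewrite /large /window => kL kj; have k0 : 0 <= k%:R :> R by [].
have : (j%:R - k%:R) ^+ 2 <= (k%:R / 50) ^+ 2 :> R by nra.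
rewrite -ler_sqrt ?sqr_ge0 // !sqrtr_sqr [X in _ <= X]ger0_norm ?divr_ge0 //.
by rewrite ler_norml => /andP[? ?]; split; lra.
Qed.

(** l / j <= 51/49 = 1 + 2/49, and 2^(2/49) <= 51/49 by the weighted mean inequality. *)
Lemma exp2_window k j l : large k -> window k j -> window k l ->
  2 `^ (l%:R / j%:R) <= 102 / 49 :> R.
Proof.
move=> kL kj kl; have [j1 j2] := window_bounds kL kj; have [l1 l2] := window_bounds kL kl.
have k0 : 0 < k%:R :> R by move: kL; rewrite /large; lra.
have j0 : 0 < j%:R :> R by lra.
have lj : l%:R / j%:R <= 1 + 2 / 49 :> R by rewrite ler_pdivrMr //; lra.
apply: (le_trans (ler_powR _ lj)); first by lra.
have -> : 2 `^ (1 + 2 / 49) = 2 * 2 `^ (2 / 49) :> R.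
  by rewrite powRD ?pnatr_eq0 ?implybT // powRr1.
have u0 : 0 <= 2 / 49 :> R by lra.
have v0 : 0 <= 47 / 49 :> R by lra.
have uv : 2 / 49 + 47 / 49 + 0 = 1 :> R by lra.
have two0 : 0 < 2 :> R by lra.
have := weighted_amgm u0 v0 (lexx 0) uv two0 ltr01 ltr01.
by rewrite ln1 !mulr0 !addr0 /powR pnatr_eq0 /= => h; lra.
Qed.

(** With D = j - K, e = j1 - j2 and o the parity of K, j1 - k = (D + o + e) / 2. Since D^2 / 4 <=
    500 k + 250, halving D uses about half of the allowance 1000 k; the rest accommodates e and
    o. *)
Lemma window_half k K j j1 j2 :
  large k -> K./2 = k -> window K j -> (j1 + j2 = j)%N ->
  (j1%:R - j2%:R) ^+ 2 <= 125 * k%:R :> R -> window k j1.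
Proof.
rewrite /large /window => kL Kk Kj jE jj.
have KE : K%:R = 2 * k%:R + (odd K)%:R :> R.
  by rewrite -{1}(odd_double_half K) Kk natrD -mul2n natrM addrC.
have oK : (0 <= ((odd K)%:R : R)) && (((odd K)%:R : R) <= 1) by rewrite ler0n lern1 leq_b1.
move: Kj jj kL oK; rewrite -jE natrD KE.
move: (j1%:R : R) (j2%:R : R) ((odd K)%:R : R) (k%:R : R) => x y o m h1 h2 mL /andP[q0 q1].
pose D := x + y - (2 * m + o); pose e := x - y.
have -> : x - m = (D + o + e) / 2 by rewrite /D /e; field.
have hD : D ^+ 2 <= 1000 * (2 * m + o) by [].
have he : e ^+ 2 <= 125 * m by [].
have q : (e + o) ^+ 2 <= 2 * e ^+ 2 + 2 * o ^+ 2.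
  by have := sqr_ge0 (e - o); nra.
have p : (D + (e + o)) ^+ 2 <= 3 / 2 * D ^+ 2 + 3 * (e + o) ^+ 2.
  have := sqr_ge0 (D - 2 * (e + o)); nra.
have o2 : o ^+ 2 <= 1 by nra.
have -> : ((D + o + e) / 2) ^+ 2 = (D + (e + o)) ^+ 2 / 4 by field.
lra.
Qed.

End Windows.

(** Hölder against the constant 1, through the weighted mean of x^p and 1/#|P|. *)
Lemma sum_le_card_powR (R : realType) (I : finType) (P : pred I) (x : I -> R) (p : R) :
  1 <= p -> (forall i, 0 <= x i) -> \sum_(i | P i) x i `^ p <= 1 ->
  \sum_(i | P i) x i <= #|P|%:R `^ (1 - p^-1).
Proof.
move=> p1 x0 sx; have p0 : 0 < p by apply: lt_le_trans p1.
have [P0|Pp] := posnP #|P|; first by rewrite big_pred0 ?powR_ge0 //; exact/card0_eq.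
have cP : 0 < #|P|%:R :> R by rewrite ltr0n.
set K := _ `^ _; have K0 : 0 < K by exact: powR_gt0.
apply: (@le_trans _ _ (\sum_(i | P i) K * (p^-1 * x i `^ p + (1 - p^-1) / #|P|%:R))).
  apply: ler_sum => i _; have := x0 i; rewrite le0r => /orP[/eqP ->|xi].
    rewrite mulr_ge0 ?(ltW K0) // addr_ge0 ?mulr_ge0 ?powR_ge0 ?invr_ge0 ?(ltW p0) //.
    by rewrite subr_ge0 invf_le1.
  have v0 : 0 <= 1 - p^-1 by rewrite subr_ge0 invf_le1.
  have u0 : 0 <= p^-1 by rewrite invr_ge0 ltW.
  have uv : p^-1 + (1 - p^-1) + 0 = 1 by rewrite addr0 subrKC.
  have xp : 0 < x i `^ p by exact: powR_gt0.
  have ci : 0 < #|P|%:R^-1 :> R by rewrite invr_gt0.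
  have := weighted_amgm u0 v0 (lexx 0) uv xp ci ltr01.
  rewrite !mul0r !addr0 ln_powR mulKf ?gt_eqF // lnV ?posrE // => h.
  rewrite mulrC -ler_pdivrMr //; apply: le_trans h.
  rewrite expRD lnK // ler_wpM2l ?(ltW xi) // /K /powR gt_eqF // -expRN ler_expR.
  by rewrite mulrN.
rewrite -mulr_sumr -[X in _ <= X]mulr1 ler_wpM2l ?(ltW K0) // big_split /=.
rewrite -mulr_sumr sumr_const -[(_ / _) *+ _]mulr_natr divfK ?gt_eqF //.
rewrite -[X in _ <= X](subrKC p^-1) lerD2r -[X in _ <= X]mulr1 ler_wpM2l //.
by rewrite invr_ge0 ltW.
Qed.

Section Squarefree.
Variables (R : realType) (n N : nat) (w : R[i]).
Hypothesis wP : N.+1.-primitive_root w.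
Local Notation expo := {ffun 'I_n -> 'I_N.+1}.
Variable a : expo -> R[i].
Variable d : nat.
Hypothesis a_deg : forall al, a al != 0 -> (deg al <= d)%N.
Hypothesis d_gt0 : (0 < d)%N.
Hypothesis dN : (d.*2 <= N)%N.
Hypothesis ev_le1 : forall u, torus u -> normc (ev a u) <= 1.
Local Notation BH := (@BH R n N a).
Local Notation window := (window R).
Local Notation large := (large R).

(** The loss is 102/49 from hypercontractivity times 106/100, which covers Blei's 51/50 + 1/100
    divided by the proportion 49/50 of good sets; the product is below 2.21. *)
Lemma BH_double k K D : large k -> K./2 = k -> 0 < D ->
  BH (window k) D -> BH (window K) (9 / 4 * D).
Proof.
move=> kL Kk D0 B.
have kR : 1000 * 2500 <= k%:R :> R by exact: kL.
have kK : k%:R <= K%:R :> R by rewrite ler_nat -Kk; lia.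
have KL : large K by apply: le_trans kK.
have KE : K%:R <= 2 * k%:R + 1 :> R.
  rewrite -{1}(odd_double_half K) Kk natrD -mul2n natrM addrC lerD2l.
  by rewrite lern1 leq_b1.
pose gp j l := window k j && window k l.
have gpC : symmetric gp by move=> j l; rewrite /gp andbC.
have pos j : window k j -> 0 < j%:R :> R by move/(window_bounds kL) => [? _]; lra.
have gpV j l : gp j l -> window k j /\ (0 < j)%N.
  by move=> /andP[kj _]; rewrite -(ltr0n R); split=> //; exact: pos.
have hyp j : window k j -> @hyper R n N w d gp j (102 / 49).
  move=> kj; apply: hyper_dual => //.
  - by rewrite -(ltr_nat R); have [? _] := window_bounds kL kj; lra.
  - by lra.
  - by move=> l /andP[_ kl]; exact: (exp2_window kL).
have gp1 j l : gp j l -> j%:R / (j + l).+1%:R <= 51 / 100 :> R.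
  move=> /andP[kj kl]; rewrite ler_pdivrMr ?ltr0n // -[(j + l).+1%:R]natr1 natrD.
  have [? ?] := window_bounds kL kj; have [? ?] := window_bounds kL kl; lra.
have gp0 j l : gp j l -> ((j + l).+1%:R)^-1 <= 1 / 100 :> R.
  move=> /andP[kj kl]; rewrite div1r lef_pV2 ?posrE ?ltr0n // -[(j + l).+1%:R]natr1 natrD.
  have [? ?] := window_bounds kL kj; have [? ?] := window_bounds kL kl; lra.
have cnt (T : {set 'I_n}) : window K #|T| -> 49 / 50 * 2 ^+ n <=
    #|[set A : {set 'I_n} | gp #|T :&: A| #|T :\: A|]|%:R :> R.
  (* At level 125 k the failure rate |T| / (125 k) is at most 1/50, as |T| is about 2k, and
     [window_half] tolerates this deviation. *)
  move=> KT; have t0 : 0 < 125 * k%:R :> R by lra.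
  apply: (@le_trans _ _ (2 ^+ n - 2 ^+ n * #|T|%:R / (125 * k%:R))).
    have -> : 2 ^+ n - 2 ^+ n * #|T|%:R / (125 * k%:R) =
      (1 - #|T|%:R / (125 * k%:R)) * 2 ^+ n :> R by ring.
    rewrite ler_wpM2r ?exprn_ge0 //.
    have [_ h] := window_bounds KL KT.
    suff : #|T|%:R / (125 * k%:R) <= 1 / 50 :> R by lra.
    by rewrite ler_pdivrMr //; lra.
  apply: (le_trans (chebyshev_trace T t0)); rewrite ler_nat.
  apply: subset_leq_card; apply/fintype.subsetP => A; rewrite !inE => TA.
  apply/andP; split.
    by apply: (window_half kL Kk KT (j2 := #|T :\: A|)) => //; rewrite cardsID.
  apply: (window_half kL Kk KT (j2 := #|T :&: A|)).
    by rewrite addnC cardsID.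
  by rewrite -sqrrN opprB.
have W0 j : window K j -> (0 < j)%N.
  by move=> /(window_bounds KL) [? _]; rewrite -(ltr0n R); lra.
have H0 : 0 < 102 / 49 :> R by lra.
have q0 : 0 < 49 / 50 :> R by lra.
have k10 : 0 <= 51 / 100 :> R by lra.
have k00 : 0 <= 1 / 100 :> R by lra.
have l1 : 1 <= 106 / 100 :> R by lra.
have lq : (51 / 100 *+ 2 + 1 / 100) / (49 / 50) <= 106 / 100 :> R.
  by rewrite -mulr_natr; lra.
have := BH_split wP a_deg d_gt0 dN D0 H0 B hyp gpC gpV gp1 gp0 k10 k00 q0 W0 cnt l1 lq.
apply: BH_mono; first by rewrite mulr_gt0 // mulr_gt0.
by rewrite mulrA ler_wpM2r ?(ltW D0) //; lra.
Qed.

End Squarefree.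

(** (9/4)^5 < 58 < 64 = 2^6. *)
Lemma two_powR_6_5 (R : realType) : 9 / 4 <= 2 `^ (6 / 5) :> R.
Proof.
have -> : 9 / 4 = ((9 / 4) ^+ 5) `^ (5^-1) :> R.
  by rewrite -powR_mulrn -?powRrM ?mulfV ?powRr1 //; lra.
have -> : 2 `^ (6 / 5) = (2 ^+ 6) `^ (5^-1) :> R.
  by rewrite -powR_mulrn // -powRrM.
by apply: ge0_ler_powR; rewrite ?nnegrE ?exprn_ge0 //; lra.
Qed.

Section Squarefree.
Variables (R : realType) (n N : nat) (w : R[i]).
Hypothesis wP : N.+1.-primitive_root w.
Local Notation expo := {ffun 'I_n -> 'I_N.+1}.
Variable a : expo -> R[i].
Variable d : nat.
Hypothesis a_deg : forall al, a al != 0 -> (deg al <= d)%N.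
Hypothesis d_gt0 : (0 < d)%N.
Hypothesis dN : (d.*2 <= N)%N.
Hypothesis ev_le1 : forall u, torus u -> normc (ev a u) <= 1.
Local Notation BH := (@BH R n N a).
Local Notation window := (window R).
Local Notation large := (large R).
Variable J : nat.
Hypothesis J_large : forall k, ~~ large k./2 -> 51 / 50 * k%:R <= J%:R :> R.
Hypothesis Jd : (J <= d)%N.

Let M : R := (base_const J)%:R.
Let M_gt0 : 0 < M.
Proof. by rewrite ltr0n base_const_ge1. Qed.

Lemma base_le_powR m : (0 < m)%N -> M <= M * m%:R `^ (6 / 5).
Proof.
move=> m0; rewrite ler_peMr ?(ltW M_gt0) //.
have p0 : 0 <= 6 / 5 :> R by lra.
have m1 : 1 <= m%:R :> R by rewrite ler1n.
by have := ler_powR m1 p0; rewrite powRr0.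
Qed.

(** Doubling K multiplies K^(6/5) by 2^(6/5), which pays for the factor 9/4; once [K./2] is not
    large, J covers the whole window. *)
Lemma BH_window K : large K -> BH (window K) (M * K%:R `^ (6 / 5)).
Proof.
elim/ltn_ind: K => K IH KL.
have K0 : (0 < K)%N by rewrite -(ltr0n R); move: KL; rewrite /large; lra.
have [kL|kL] := boolP (large K./2).
  have k0 : (0 < K./2)%N by rewrite -(ltr0n R); move: kL; rewrite /large; lra.
  have kK : (K./2 < K)%N by lia.
  have D0 : 0 < M * (K./2)%:R `^ (6 / 5) by apply: mulr_gt0 => //; apply: powR_gt0; rewrite ltr0n.
  have := BH_double wP a_deg d_gt0 dN kL erefl D0 (IH _ kK kL).
  apply: BH_mono; first by rewrite mulr_gt0.
  rewrite mulrCA ler_wpM2l ?(ltW M_gt0) //.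
  apply: (@le_trans _ _ (2 `^ (6 / 5) * (K./2)%:R `^ (6 / 5))).
    by rewrite ler_wpM2r ?powR_ge0 ?two_powR_6_5.
  rewrite -powRM //; apply: ge0_ler_powR; rewrite ?nnegrE ?mulr_ge0 ?invr_ge0 //.
  by rewrite -natrM ler_nat mul2n -{2}(odd_double_half K) leq_addl.
apply: BH_mono (base_le_powR K0) _ => //.
apply: BH_sub (BH_base wP a_deg d_gt0 dN ev_le1 Jd) => j Kj.
have [j1 j2] := window_bounds KL Kj.
rewrite -(ltr0n R) -(ler_nat R) (le_trans j2) ?J_large // andbT.
by move: KL; rewrite /large => ?; lra.
Qed.

Lemma coef_setT T z : coef a [set: 'I_n] T z = a (ind N T).
Proof.
have N0 : (0 < N)%N by apply: leq_trans dN; rewrite double_gt0.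
rewrite /coef (big_pred1 (ind N T)) => [|al].
  by rewrite big_pred0 ?mulr1 // => i; rewrite inE.
apply/forall_inP/eqP => [h|-> i _]; last by rewrite (indE d_gt0 dN).
by apply/ffunP => i; apply: val_inj; rewrite /= (indE d_gt0 dN) (eqP (h i _)) ?inE.
Qed.

(** Hölder over the C(n, m) sets converts the l^p bound, with 1 - 1/p = 1/2 - 1/(2m). *)
Lemma squarefree_coef_sum m : (0 < m)%N ->
  \sum_(T : {set 'I_n} | #|T| == m) normc (a (ind N T)) <=
  M * m%:R `^ (6 / 5) * 'C(n, m)%:R `^ (2^-1 - (2 * m%:R)^-1).
Proof.
move=> m0; set D := M * _.
have D0 : 0 < D by apply: mulr_gt0 => //; apply: powR_gt0; rewrite ltr0n.
have B : BH (fun j => j == m) D.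
  have [mL|mL] := boolP (large m).
    apply: BH_sub (BH_window mL) => j /eqP ->.
    by rewrite /window subrr expr0n; apply: mulr_ge0; apply: ler0n.
  apply: BH_mono (base_le_powR m0) _ => //.
  apply: BH_sub (BH_base wP a_deg d_gt0 dN ev_le1 Jd) => j /eqP ->.
  rewrite m0 /= -(ler_nat R); have : 51 / 50 * m%:R <= J%:R :> R.
    apply: J_large; apply: contra mL => /le_trans; apply.
    by rewrite ler_nat; lia.
  by apply: le_trans; rewrite ler_peMl //; lra.
have t1 : @torus R n (fun=> 1).
  by move=> i; rewrite ComplexField.Normc.normc1.
have p1 := pexp_ge1 R m0.
have := sum_le_card_powR (P := fun T : {set 'I_n} => #|T| == m)
   (x := fun T => normc (a (ind N T)) / D) p1.
move=> /(_ (fun T => divr_ge0 (normc_ge0 _) (ltW D0))).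
have -> : \sum_(T : {set 'I_n} | #|T| == m) (normc (a (ind N T)) / D) `^ pexp R m =
   \sum_(T : {set 'I_n} | (T \subset [set: 'I_n]) && (#|T| == m))
      (normc (coef a [set: 'I_n] T (fun=> 1)) / D) `^ pexp R #|T|.
  apply: eq_big => [T|T /eqP <-]; first by rewrite finset.subsetT.
  by rewrite coef_setT.
move=> /(_ (B _ _ t1)); rewrite -mulr_suml ler_pdivrMr // mulrC.
have -> : #|(fun T : {set 'I_n} => #|T| == m)| = 'C(n, m).
  by rewrite -[in RHS](card_ord n) -card_draws cardsE.
suff -> : 1 - (pexp R m)^-1 = 2^-1 - (2 * m%:R)^-1 by [].
rewrite /pexp -natr1; field; rewrite nat1r !pnatr_eq0 andbT -lt0n.
by rewrite m0.
Qed.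

End Squarefree.

Lemma large_half_bound (R : realType) : exists J : nat,
  forall k, ~~ large R k./2 -> 51 / 50 * k%:R <= J%:R :> R.
Proof.
(* If [k./2] is not large then k < 5000001, and 51/50 of this is below 6000000. *)
exists (Num.truncn (6 * (1000 * 1000) : R)).+1 => k; rewrite /large -ltNge => kL.
apply: (@le_trans _ _ (6 * (1000 * 1000))); last by rewrite ltW // truncnS_gt.
have : k%:R <= 2 * (k./2)%:R + 1 :> R; last by lra.
rewrite -{1}(odd_double_half k) natrD -mul2n natrM addrC lerD2l.
by rewrite lern1 leq_b1.
Qed.

(** * Homogeneous parts *)

Section Homogeneous.
Variables (R : realType) (n N : nat) (w : R[i]).
Hypothesis wP : N.+1.-primitive_root w.
Local Notation expo := {ffun 'I_n -> 'I_N.+1}.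
Implicit Types (a b : expo -> R[i]) (al : expo) (u : 'I_n -> R[i]).
Variable d : nat.
Hypothesis d_gt0 : (0 < d)%N.
Hypothesis dN : (d.*2 <= N)%N.

Definition zero_expo : expo := [ffun=> ord0].

Lemma deg_eq0 al : (deg al == 0%N) = (al == zero_expo).
Proof.
apply/eqP/eqP => [h|->]; last by rewrite /deg big1 // => i _; rewrite ffunE.
apply/ffunP => i; apply: val_inj; rewrite /= ffunE /=.
by apply/eqP; rewrite -leqn0 -h deg_ge.
Qed.

Lemma mon_rot al u (k : nat) :
  mon al (fun i => w ^+ k * u i) = (w ^+ deg al) ^+ k * mon al u.
Proof.
rewrite /mon /deg -prodrXr -prodrXl -big_split; apply: eq_bigr => i _ /=.
by rewrite exprMn -!exprM mulnC.
Qed.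

Lemma ev_part a l u : (l <= N)%N -> (forall al, a al != 0 -> (deg al <= N)%N) ->
  avg (fun k : 'I_N.+1 => ((w ^+ l) ^+ k)^* * ev a (fun i => w ^+ k * u i)) =
  ev (part (fun al => deg al == l) a) u.
Proof.
move=> lN aN; rewrite /ev (eq_avg (F' := fun k : 'I_N.+1 => \sum_al
    a al * mon al u * ((w ^+ deg al) ^+ k * ((w ^+ l) ^+ k)^*))); last first.
  move=> k; rewrite mulr_sumr; apply: eq_bigr => al _; rewrite mon_rot; by ring.
rewrite avg_sum; apply: eq_bigr => al _; rewrite avgZ /avg card_ord sum_root //.
rewrite /part; have [->|/aN dal] := eqVneq (a al) 0; first by rewrite if_same !mul0r.
rewrite !modn_small ?ltnS //; case: eqP => _; rewrite ?mul0r ?mulr0 //.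
by rewrite divff ?mulr1 // pnatr_eq0.
Qed.

(** The conjugate has only frequencies at most 0, so none equal to m > 0; modulo N + 1 this uses m +
    deg al <= 2d <= N. *)
Lemma ev_conj_avg a m u : (0 < m)%N -> (m <= d)%N ->
  (forall al, a al != 0 -> (deg al <= d)%N) ->
  avg (fun k : 'I_N.+1 => ((w ^+ m) ^+ k)^* * (ev a (fun i => w ^+ k * u i))^*) = 0.
Proof.
move=> m0 md ad; rewrite /ev (eq_avg (F' := fun k : 'I_N.+1 => \sum_al
    (a al * mon al u)^* * ((w ^+ 0) ^+ k * ((w ^+ (m + deg al)) ^+ k)^*))); last first.
  move=> k; rewrite rmorph_sum mulr_sumr; apply: eq_bigr => al _ /=.
  rewrite mon_rot expr0 expr1n mul1r exprD exprMn !rmorphM; by ring.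
rewrite avg_sum big1 // => al _; rewrite avgZ /avg card_ord sum_root //.
have [->|/ad dal] := eqVneq (a al) 0; first by rewrite mul0r rmorph0 mul0r.
rewrite mod0n modn_small; last first.
  by rewrite ltnS (leq_trans _ dN) // -addnn leq_add.
by rewrite eq_sym addn_eq0 (gtn_eqF m0) mul0r mulr0.
Qed.

Lemma ev_zero_part a u : ev (part (fun al => deg al == 0%N) a) u = a zero_expo.
Proof.
rewrite /ev (bigD1 zero_expo) //= /part deg_eq0 eqxx big1 ?addr0.
  rewrite [mon _ _]big1 ?mulr1 // => i _; rewrite ffunE; exact: expr0.
by move=> al ne; rewrite deg_eq0 (negbTE ne) mul0r.
Qed.

Lemma phase (c : R[i]) : exists2 k : R[i], normc k = 1 & k * c = ((normc c)%:C)%C.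
Proof.
have [->|c0] := eqVneq c 0.
  exists 1; first exact: ComplexField.Normc.normc1.
  by rewrite mulr0 ComplexField.Normc.normc0.
have nc : ((normc c)%:C)%C != 0.
  by rewrite -(rmorph0 (real_complex R)) (inj_eq (@complexI R)) normc_eq0.
exists (c^* / ((normc c)%:C)%C).
  rewrite ComplexField.Normc.normcM ComplexField.Normc.normcV normc_conj normcC.
  by rewrite ger0_norm ?normc_ge0 // divff // normc_eq0.
by apply: (mulIf nc); rewrite mulrAC mulfVK // mulrC -normc_sqr expr2 rmorphM.
Qed.

Lemma addcJ_Re (z : R[i]) : z + z^* = ((2 * complex.Re z)%:C)%C.
Proof. by case: z => x y; apply/eqP; rewrite eq_complex /= mulr2n mulrDl mul1r !eqxx /= subrr. Qed.

Lemma Re_le_normc (z : R[i]) : complex.Re z <= normc z.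
Proof.
by case: z => x y /=; rewrite (le_trans (ler_norm _)) // -sqrtr_sqr ler_wsqrtr // lerDl sqr_ge0.
Qed.

(* 1 - Re f is nonnegative of mean 1 - |a_0| once a_0 is rotated to the positive axis, and
   its Fourier coefficients are those of f up to a factor -1/2. *)
Lemma homogeneous_part_le a m u :
  (forall al, a al != 0 -> (deg al <= d)%N) ->
  (forall u, torus u -> normc (ev a u) <= 1) -> (0 < m)%N -> (m <= d)%N -> torus u ->
  normc (ev (part (fun al => deg al == m) a) u) <= 2 * (1 - normc (a zero_expo)).
Proof.
move=> ad a1 m0 md tu.
have dN' : (d <= N)%N by rewrite (leq_trans _ dN) // -addnn leq_addr.
have aN al : a al != 0 -> (deg al <= N)%N by move=> /ad /leq_trans; apply.
have mN : (m <= N)%N := leq_trans md dN'.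
have [kp kp1 kpc] := phase (a zero_expo).
pose h (k : 'I_N.+1) := kp * ev a (fun i => w ^+ k * u i).
pose t k : R := 2 - 2 * complex.Re (h k).
have h1 k : normc (h k) <= 1.
  rewrite ComplexField.Normc.normcM kp1 mul1r; apply: a1 => i.
  by rewrite ComplexField.Normc.normcM normcX (normc_root wP) expr1n mul1r.
have t0 k : 0 <= t k.
  by rewrite /t subr_ge0 -[X in _ <= X]mulr1 ler_wpM2l // (le_trans (Re_le_normc _)).
have tE k : ((t k)%:C)%C = 2 - (h k + (h k)^*).
  by rewrite /t rmorphB /= addcJ_Re rmorph_nat.
have cN : (0 < #|'I_N.+1|)%N by rewrite card_ord.
have wk0 : avg (fun k : 'I_N.+1 => ((w ^+ m) ^+ k)^*) = 0.
  rewrite (eq_avg (F' := fun k : 'I_N.+1 => (w ^+ 0) ^+ k * ((w ^+ m) ^+ k)^*)).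
    by rewrite /avg sum_root // mod0n modn_small // eq_sym (gtn_eqF m0) mul0r.
  by move=> k; rewrite expr0 expr1n mul1r.
have mE : kp * ev (part (fun al => deg al == m) a) u =
    - avg (fun k : 'I_N.+1 => ((w ^+ m) ^+ k)^* * ((t k)%:C)%C).
  rewrite -ev_part //.
  rewrite [avg (fun k => _ * (t k)%:C%C)](eq_avg (F' := fun k : 'I_N.+1 =>
    2 * ((w ^+ m) ^+ k)^* +
     ((- kp) * (((w ^+ m) ^+ k)^* * ev a (fun i => w ^+ k * u i)) +
     (- kp^*) * (((w ^+ m) ^+ k)^* * (ev a (fun i => w ^+ k * u i))^*)))); last first.
    by move=> k; rewrite (tE k) /h rmorphM; ring.
  by rewrite !avgD !avgZ wk0 ev_conj_avg //; ring.
have mt : avg t = 2 * (1 - normc (a zero_expo)).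
  apply: (@complexI R); rewrite -avg_complex.
  rewrite (eq_avg (F' := fun k : 'I_N.+1 => 2 +
     ((- kp) * (((w ^+ 0) ^+ k)^* * ev a (fun i => w ^+ k * u i)) +
     (- kp^*) * (((w ^+ 0) ^+ k)^* * ev a (fun i => w ^+ k * u i))^* ))); last first.
    by move=> k; rewrite tE /h rmorphM expr0 expr1n rmorph1 !mul1r; ring.
  rewrite !avgD !avgZ avg_const // ev_part //.
  have -> : avg (fun k : 'I_N.+1 => (((w ^+ 0) ^+ k)^* * ev a (fun i => w ^+ k * u i))^*) =
     (ev (part (fun al => deg al == 0%N) a) u)^*.
    by rewrite -ev_part // /avg -rmorph_sum rmorphM fmorphV rmorph_nat.
  rewrite ev_zero_part !mulNr kpc -rmorphM kpc.
  rewrite [X in _ - X](_ : _ = ((normc (a zero_expo))%:C)%C); last first.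
    by apply/eqP; rewrite eq_complex /= oppr0 !eqxx.
  by rewrite !rmorphM rmorphB rmorph1 rmorph_nat; ring.
have -> : normc (ev (part (fun al => deg al == m) a) u) =
    normc (kp * ev (part (fun al => deg al == m) a) u).
  by rewrite ComplexField.Normc.normcM kp1 mul1r.
rewrite mE normcN -mt; apply: (le_trans (normc_avg _)); apply: ler_avg => k.
rewrite ComplexField.Normc.normcM normc_conj !normcX (normc_root wP) !expr1n mul1r.
by rewrite normcC ger0_norm.
Qed.

Lemma parseval_le1 a : (forall u, torus u -> normc (ev a u) <= 1) ->
  \sum_al normc (a al) ^+ 2 <= 1.
Proof.
move=> a1; rewrite -(parseval wP).
apply: (@le_trans _ _ (avg (fun _ : expo => 1))); last first.
  by rewrite avg_const // card_ffun !card_ord expn_gt0.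
apply: ler_avg => x; rewrite exprn_ile1 ?normc_ge0 //.
by apply: (a1 (pt w x)); exact: torus_pt.
Qed.

End Homogeneous.

Lemma sum_sqrt_le (R : rcfType) (I : Type) (r : seq I) (P : pred I) (x : I -> R) :
  (forall i, 0 <= x i) ->
  \sum_(i <- r | P i) Num.sqrt (x i) <=
  Num.sqrt (\sum_(i <- r | P i) 1) * Num.sqrt (\sum_(i <- r | P i) x i).
Proof.
move=> x0; have s0 : 0 <= \sum_(i <- r | P i) Num.sqrt (x i).
  by rewrite sumr_ge0 // => i _; exact: sqrtr_ge0.
rewrite -sqrtrM ?sumr_ge0 // -[X in X <= _]ger0_norm // -sqrtr_sqr ler_wsqrtr //.
have := cauchy_schwarz_sum r P (fun=> 1) (fun i => Num.sqrt (x i)).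
under eq_bigr do rewrite mul1r.
under [X in _ <= X * _]eq_bigr do rewrite expr1n.
by under [X in _ <= _ * X]eq_bigr do rewrite sqr_sqrtr //.
Qed.

Lemma sum_geometric_half (R : realType) (k l : nat) :
  \sum_(k <= m < l) (2 ^+ m)^-1 <= 2 * (2 ^+ k)^-1 :> R.
Proof.
have [lk|kl] := leqP l k.
  by rewrite big_geq // mulr_ge0 // invr_ge0 exprn_ge0.
suff : \sum_(k <= m < l) (2 ^+ m)^-1 <= 2 * (2 ^+ k)^-1 - 2 * (2 ^+ l)^-1 :> R.
  move/le_trans; apply; rewrite gerBl mulr_ge0 // invr_ge0 exprn_ge0 //.
elim: l kl => // l IH; rewrite ltnS leq_eqVlt => /orP[/eqP <-|kl].
  rewrite big_nat1 exprS invfM mulVKf ?pnatr_eq0 //.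
  by rewrite mulr2n mulrDl mul1r addrK.
rewrite big_nat_recr ?(ltnW kl) //= (le_trans (lerD (IH kl) (lexx _))) //.
by rewrite exprS invfM mulVKf ?pnatr_eq0 // mulr2n; lra.
Qed.

(** C(n+1, m+1) = (n+1)/(m+1) C(n, m), and lowering both terms of n/m >= 1 by 1 does not decrease
    it. *)
Lemma bin_ge_pow (R : realType) (n m : nat) : (0 < m)%N -> (m <= n)%N ->
  (n%:R / m%:R) ^+ m <= 'C(n, m)%:R :> R.
Proof.
case: m => // m _; elim: m n => [|m IH] [|n] // mn.
  by rewrite bin1 divr1 expr1.
rewrite ltnS in mn.
have e : 'C(n.+1, m.+2)%:R = n.+1%:R / m.+2%:R * 'C(n, m.+1)%:R :> R.
  rewrite mulrAC; apply: (mulIf (x := m.+2%:R)); first by rewrite pnatr_eq0.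
  by rewrite divfK ?pnatr_eq0 // -!natrM mulnC -mul_bin_diag.
rewrite e exprS ler_wpM2l ?divr_ge0 //; apply: le_trans (IH n mn).
rewrite lerXn2r ?nnegrE ?divr_ge0 //.
rewrite ler_pdivrMr ?ltr0n // mulrAC ler_pdivlMr ?ltr0n // -!natrM ler_nat.
by nia.
Qed.

(** * Sums over exponents *)

Section Sums.
Variables (R : realType) (n N : nat).
Local Notation expo := {ffun 'I_n -> 'I_N.+1}.
Implicit Types (b : expo -> R[i]) (al : expo) (P : pred expo) (rho : R).

Definition squarefree al := [forall i, al i <= 1]%N.

Lemma sum_by_degree (V : nmodType) (F : expo -> V) P (k l : nat) :
  \sum_(k <= m < l) \sum_(al | P al && (deg al == m)) F al =
  \sum_(al | P al && (k <= deg al < l)%N) F al.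
Proof.
rewrite (exchange_big_dep P) /=; last by move=> m al _ /andP[].
rewrite [RHS]big_mkcondr; apply: eq_bigr => al Pal; rewrite Pal /=.
rewrite (eq_bigl (pred1 (deg al))); last by move=> m; rewrite /= eq_sym.
rewrite big_const_seq iter_addr_0 count_uniq_mem ?iota_uniq // mem_index_iota.
by case: (_ && _).
Qed.

Lemma sum_squarefree (N0 : (0 < N)%N) b m :
  \sum_(al | squarefree al && (deg al == m)) normc (b al) =
  \sum_(T : {set 'I_n} | #|T| == m) normc (b (ind N T)).
Proof.
have N2 : (1.*2 <= N.*2)%N by rewrite leq_double.
rewrite (eq_bigl (fun al => al \in [set ind N T | T : {set 'I_n} & #|T| == m])).
  rewrite big_imset /=; first by apply: eq_bigl => T; rewrite inE.
  move=> S T _ _ /ffunP e; apply/setP => i; have := congr1 val (e i).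
  rewrite /= !ffunE !inordK ?ltnS //; by case: (i \in S); case: (i \in T).
have indN T i : ind N T i = (i \in T) :> nat.
  by rewrite ffunE inordK //; case: (i \in T).
have dT T : deg (ind N T) = #|T|.
  rewrite /deg (eq_bigr (fun i => (i \in T) : nat)); last by move=> i _; rewrite indN.
  by rewrite -sum1_card [RHS]big_mkcond; apply: eq_bigr => i _; case: (i \in T).
move=> al; apply/andP/imsetP => [[/forallP sq /eqP da]|[T]].
  have e : al = ind N [set i | al i == 1%N :> nat].
    apply/ffunP => i; apply: val_inj; rewrite /= indN inE.
    by have := sq i; case: (val (al i)) => [|[|k]].
  by exists [set i | al i == 1%N :> nat] => //; rewrite inE -dT -e da.
rewrite inE => /eqP Tm ->; split; last by rewrite dT Tm.
by apply/forallP => i; rewrite indN; case: (i \in T).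
Qed.

Lemma sum_pow_deg rho : 0 <= rho < 1 ->
  \sum_(al : expo) rho ^+ deg al <= ((1 - rho)^-1) ^+ n.
Proof.
move=> /andP[r0 r1].
rewrite (eq_bigr (fun al : expo => \prod_i rho ^+ al i)); last by move=> al _; rewrite /deg prodrXr.
rewrite -(bigA_distr_bigA (fun i (k : 'I_N.+1) => rho ^+ k)) /= prodr_const card_ord.
have g0 : 0 <= \sum_(k < N.+1) rho ^+ k by rewrite sumr_ge0 // => k _; rewrite exprn_ge0.
have gl : \sum_(k < N.+1) rho ^+ k <= (1 - rho)^-1.
  rewrite -[X in _ <= X]mul1r ler_pdivlMr ?subr_gt0 // mulrC -opprB mulNr -subrX1 opprB.
  by rewrite gerBl exprn_ge0.
by rewrite lerXn2r ?nnegrE // (le_trans g0).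
Qed.

(** Union bound over a variable of exponent at least 2, whose geometric sum starts at rho^2. *)
Lemma sum_pow_deg_nonsquarefree rho : 0 <= rho < 1 ->
  \sum_(al : expo | ~~ squarefree al) rho ^+ deg al <=
  n%:R * rho ^+ 2 * ((1 - rho)^-1) ^+ n.
Proof.
move=> /andP[r0 r1]; have i0 : 0 < 1 - rho by rewrite subr_gt0.
have geo k : \sum_(j < k) rho ^+ j <= (1 - rho)^-1.
  rewrite -[X in _ <= X]mul1r ler_pdivlMr // mulrC -opprB mulNr -subrX1 opprB.
  by rewrite gerBl exprn_ge0.
apply: (@le_trans _ _ (\sum_(i < n) \sum_(al : expo | (1 < al i)%N) rho ^+ deg al)).
  rewrite (exchange_big_dep xpredT) //= big_mkcond; apply: ler_sum => al _.
  case: ifPn => [|_]; last by rewrite sumr_ge0 // => *; rewrite exprn_ge0.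
  rewrite negb_forall => /existsP[i ai]; rewrite -ltnNge in ai.
  by rewrite (bigD1 i) //= lerDl sumr_ge0 // => *; rewrite exprn_ge0.
rewrite -mulrA mulr_natl -[X in _ *+ X](card_ord n) -sumr_const; apply: ler_sum => i _.
(* Deleting the first two terms of the i-th geometric sum encodes the condition on al i and keeps
   the product form. *)
pose F (j : 'I_n) (k : 'I_N.+1) := if (j == i) && (k <= 1)%N then 0 else rho ^+ k.
apply: (@le_trans _ _ (\sum_(al : expo) \prod_j F j (al j))).
  rewrite big_mkcond; apply: ler_sum => al _; case: ifPn => [ai|_].
    rewrite le_eqVlt; apply/orP; left; apply/eqP; rewrite /deg -prodrXr.
    apply: eq_bigr => j _; rewrite /F; case: eqVneq => //= ->.
    by rewrite leqNgt ai.
  by rewrite prodr_ge0 // => j _; rewrite /F; case: ifP => // _; rewrite exprn_ge0.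
rewrite -(bigA_distr_bigA F) (bigD1 i) //=.
have n1 : (n = n.-1.+1)%N by rewrite prednK // (leq_ltn_trans _ (ltn_ord i)).
have -> : (1 - rho)^-1 ^+ n = (1 - rho)^-1 * (1 - rho)^-1 ^+ n.-1.
  by rewrite -exprS -n1.
rewrite mulrA; apply: ler_pM.
- by rewrite sumr_ge0 // => k _; rewrite /F; case: ifP => // _; rewrite exprn_ge0.
- by rewrite prodr_ge0 // => j _; rewrite sumr_ge0 // => k _; rewrite /F; case: ifP => // _; rewrite exprn_ge0.
- rewrite /F eqxx /=; case: N => [|[|N']].
  + by rewrite big_ord_recl big_ord0 /= addr0 mulr_ge0 ?sqr_ge0 // invr_ge0 ltW.
  + by rewrite !big_ord_recl big_ord0 /= !addr0 mulr_ge0 ?sqr_ge0 // invr_ge0 ltW.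
  rewrite 2!big_ord_recl /= !add0r; apply: le_trans (ler_wpM2l (sqr_ge0 rho) (geo N'.+1)).
  by rewrite mulr_sumr; apply: ler_sum => k _; rewrite -exprD.
- rewrite (eq_bigr (fun=> \sum_(k < N.+1) rho ^+ k)); last first.
    by move=> j /negbTE ji; apply: eq_bigr => k _; rewrite /F ji.
  rewrite prodr_const cardC1 card_ord lerXn2r ?nnegrE ?invr_ge0 ?(ltW i0) //.
  by rewrite sumr_ge0 // => k _; rewrite exprn_ge0.
Qed.

Lemma sum_coef_cs b P m (r : R) : 0 <= r -> \sum_al normc (b al) ^+ 2 <= 1 ->
  \sum_(al | P al && (deg al == m)) normc (b al) * r ^+ m <=
  Num.sqrt (\sum_(al | P al && (deg al == m)) (r ^+ 2) ^+ deg al).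
Proof.
move=> r0 b1; set s := \sum_(al | _) _.
have s0 : 0 <= s by rewrite sumr_ge0 // => al _; rewrite mulr_ge0 ?normc_ge0 ?exprn_ge0.
rewrite -[s]ger0_norm // -sqrtr_sqr ler_wsqrtr //.
apply: (le_trans (cauchy_schwarz_sum _ _ _ _)).
rewrite -[X in _ <= X]mul1r; apply: ler_pM.
- by rewrite sumr_ge0 // => al _; exact: sqr_ge0.
- by rewrite sumr_ge0 // => al _; exact: sqr_ge0.
- apply: le_trans b1; rewrite big_mkcond; apply: ler_sum => al _.
  by case: ifP => // _; exact: sqr_ge0.
- apply: ler_sum => al /andP[_ /eqP ->].
  by rewrite -!exprM mulnC.
Qed.

End Sums.

(** * Bohr's inequality for polynomials bounded on the torus *)

Section Core.
Variables (R : realType) (n N : nat) (w : R[i]).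
Hypothesis wP : N.+1.-primitive_root w.
Local Notation expo := {ffun 'I_n -> 'I_N.+1}.
Implicit Types (al : expo).
Variable d : nat.
Hypothesis d_gt0 : (0 < d)%N.
Hypothesis dN : (d.*2 <= N)%N.
Variable J : nat.
Hypothesis J_large : forall k, ~~ large R k./2 -> 51 / 50 * k%:R <= J%:R :> R.
Hypothesis Jd : (J <= d)%N.
Variables (r : R) (M : nat).
Hypothesis r0 : 0 < r.
Hypotheses (M0 : (0 < M)%N) (Mn : (M <= n)%N) (Md : (M <= d)%N).
Let rho := r ^+ 2.
Hypothesis rho4 : rho < 4^-1.
Let c : R := (base_const J)%:R.
Let N0 : (0 < N)%N.
Proof. by apply: leq_trans dN; rewrite double_gt0. Qed.
Let rho0 : 0 <= rho. Proof. exact: sqr_ge0. Qed.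

(** Compared with the Cauchy-Schwarz bound sqrt(C(n, m) rho^m), [bsqf] has the extra constant and
    the gain sqrt(M / n). *)
Let bsqf (m : nat) : R :=
  c * M%:R `^ (6 / 5) * Num.sqrt (M%:R / n%:R) * Num.sqrt ('C(n, m)%:R * rho ^+ m).
Let bnon (m : nat) : R :=
  Num.sqrt (\sum_(al : expo | ~~ squarefree al && (deg al == m)) rho ^+ deg al).
Let ball (m : nat) : R :=
  Num.sqrt (\sum_(al : expo | true && (deg al == m)) rho ^+ deg al).
Let B (m : nat) : R := if (m <= M)%N then bsqf m + bnon m else ball m.

Lemma c_gt0 : 0 < c.
Proof. by rewrite ltr0n base_const_ge1. Qed.

Lemma degree_sum_le (b : expo -> R[i]) m :
  (forall al, b al != 0 -> (deg al <= d)%N) ->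
  (forall u, torus u -> normc (ev b u) <= 1) -> (0 < m)%N ->
  \sum_(al | deg al == m) normc (b al) * r ^+ m <= B m.
Proof.
move=> bd b1 m0; have P1 := parseval_le1 wP b1; have r0' := ltW r0.
rewrite /B; case: ifPn => [mM|_]; last first.
  exact: (sum_coef_cs xpredT m r0' P1).
rewrite (bigID (@squarefree n N)) /=.
rewrite (eq_bigl (fun al => squarefree al && (deg al == m))); last first.
  by move=> al; rewrite andbC.
rewrite [X in _ + X](eq_bigl (fun al => ~~ squarefree al && (deg al == m))); last first.
  by move=> al; rewrite andbC.
apply: lerD; last by have := sum_coef_cs (fun al => ~~ squarefree al) m r0' P1.
rewrite -mulr_suml sum_squarefree //.
have := squarefree_coef_sum wP bd d_gt0 dN b1 J_large Jd m0.
set C := 'C(n, m)%:R => h.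
apply: (le_trans (ler_wpM2r (exprn_ge0 m r0') h)).
have mn : (m <= n)%N := leq_trans mM Mn.
have n0 : (0 < n)%N := leq_trans M0 Mn.
have C0 : 0 < C :> R by rewrite ltr0n bin_gt0.
have [mR nR MR] : [/\ 0 < m%:R :> R, 0 < n%:R :> R & 0 < M%:R :> R] by rewrite !ltr0n.
(* The gain: C(n, m) >= (n / m)^m. *)
have Cm : C `^ (- (2 * m%:R)^-1) <= Num.sqrt (M%:R / n%:R).
  rewrite powRN -[X in _ <= X]invrK lef_pV2 ?posrE ?invr_gt0 ?sqrtr_gt0 ?divr_gt0 ?powR_gt0 //.
  rewrite -sqrtrV ?divr_ge0 // invf_div.
  apply: (@le_trans _ _ (((n%:R / m%:R) ^+ m) `^ (2 * m%:R)^-1)); last first.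
    apply: ge0_ler_powR; rewrite ?nnegrE ?invr_ge0 ?mulr_ge0 ?exprn_ge0 ?divr_ge0 ?(ltW C0) //.
    exact: bin_ge_pow.
  rewrite -powR_mulrn ?divr_ge0 // -powRrM.
  have -> : m%:R / (2 * m%:R) = 2^-1 :> R by field; rewrite gt_eqF.
  rewrite powR12_sqrt ?divr_ge0 // ler_wsqrtr // ler_wpM2l // lef_pV2 ?posrE //.
  by rewrite ler_nat.
have -> : c * m%:R `^ (6 / 5) * C `^ (2^-1 - (2 * m%:R)^-1) * r ^+ m =
   c * m%:R `^ (6 / 5) * C `^ (- (2 * m%:R)^-1) * Num.sqrt (C * rho ^+ m).
  rewrite powRD ?(gt_eqF C0) ?implybT // powR12_sqrt ?(ltW C0) // [in RHS]sqrtrM ?(ltW C0) //.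
  have -> : Num.sqrt (rho ^+ m) = r ^+ m.
    by rewrite /rho -exprM mulnC exprM sqrtr_sqr ger0_norm ?exprn_ge0.
  by ring.
rewrite /bsqf ler_wpM2r ?sqrtr_ge0 //; apply: ler_pM => //.
- by rewrite mulr_ge0 ?powR_ge0 // ltW // c_gt0.
- exact: powR_ge0.
rewrite ler_wpM2l ?(ltW c_gt0) //; apply: ge0_ler_powR; rewrite ?nnegrE ?ler_nat //.
Qed.

(** Rankin's trick: rho^m = 4^(-m) (4 rho)^m, the first factor giving decay in m, the second a full
    sum over exponents. *)
Lemma tail_sum_le : \sum_(M.+1 <= m < d.+1) ball m <=
  (2 ^+ M)^-1 * Num.sqrt (((1 - 4 * rho)^-1) ^+ n).
Proof.
have r4 : 0 <= 4 * rho < 1 by apply/andP; split; [rewrite mulr_ge0|rewrite mulrC -ltr_pdivlMr // div1r].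
set Z := Num.sqrt _.
have hm m : ball m <= (2 ^+ m)^-1 * Z.
  have -> : (2 ^+ m)^-1 = Num.sqrt ((4 ^+ m)^-1) :> R.
    have -> : 4 = 2 ^+ 2 :> R by ring.
    by rewrite -exprM mulnC exprM sqrtrV ?exprn_ge0 // sqrtr_sqr ger0_norm ?exprn_ge0.
  rewrite -sqrtrM ?invr_ge0 ?exprn_ge0 // ler_wsqrtr //.
  rewrite mulrC ler_pdivlMr ?exprn_gt0 // mulr_suml.
  apply: le_trans (sum_pow_deg n N r4); rewrite big_mkcond; apply: ler_sum => al _ /=.
  case: eqP => [->|_]; last by rewrite exprn_ge0 // mulr_ge0.
  by rewrite [X in _ <= X]exprMn mulrC.
apply: (le_trans (ler_sum _ (fun m _ => hm m))).
rewrite -mulr_suml ler_wpM2r ?sqrtr_ge0 // (le_trans (sum_geometric_half _ _ _)) //.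
by rewrite exprS invfM mulVKf ?pnatr_eq0.
Qed.

Lemma sum_iota1 : \sum_(1 <= m < M.+1) 1 = M%:R :> R.
Proof. by rewrite sumr_const_nat subn1. Qed.

Lemma nonsquarefree_sum_le : \sum_(1 <= m < M.+1) bnon m <=
  Num.sqrt (M%:R * (n%:R * rho ^+ 2 * ((1 - rho)^-1) ^+ n)).
Proof.
have r1 : 0 <= rho < 1.
  by rewrite rho0 (lt_trans rho4) // invf_lt1 // (_ : 1 = 1%:R) // ltr_nat.
have q0 m : 0 <= \sum_(al : expo | ~~ squarefree al && (deg al == m)) rho ^+ deg al.
  by rewrite sumr_ge0 // => al _; rewrite exprn_ge0.
apply: (le_trans (sum_sqrt_le _ _ q0)); rewrite sum_iota1 -sqrtrM // ler_wsqrtr //.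
rewrite ler_wpM2l // (sum_by_degree (fun al : expo => rho ^+ deg al) (fun al => ~~ squarefree al)).
apply: le_trans (sum_pow_deg_nonsquarefree n N r1).
rewrite big_mkcond [X in _ <= X]big_mkcond; apply: ler_sum => al _.
case: (squarefree al) => //=; case: ifP => // _; by rewrite exprn_ge0.
Qed.

(** The C(n, m) rho^m add up to at most (1 + rho)^n; Cauchy-Schwarz over M degrees costs sqrt(M) and
    completes sqrt(M / n) to M / sqrt(n). *)
Lemma squarefree_sum_le : \sum_(1 <= m < M.+1) bsqf m <=
  c * M%:R `^ (6 / 5) * M%:R * Num.sqrt (expR (n%:R * rho) / n%:R).
Proof.
have x0 m : 0 <= 'C(n, m)%:R * rho ^+ m by rewrite mulr_ge0 // exprn_ge0.
rewrite /bsqf -mulr_sumr.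
have h : \sum_(1 <= m < M.+1) 'C(n, m)%:R * rho ^+ m <= expR (n%:R * rho).
  apply: (@le_trans _ _ ((1 + rho) ^+ n)); last first.
    rewrite mulrC expRM_natr lerXn2r ?nnegrE ?expR_ge0 ?addr_ge0 //.
    exact: expR_ge1Dx.
  have E : (1 + rho) ^+ n = \sum_(0 <= i < n.+1) 'C(n, i)%:R * rho ^+ i.
    rewrite exprDn big_mkord; apply: eq_bigr => i _.
    by rewrite expr1n mul1r mulr_natl.
  rewrite E [X in _ <= X](@big_cat_nat _ _ _ 1%N) //= [X in _ <= _ + X](@big_cat_nat _ _ _ M.+1) //= addrCA.
  by rewrite lerDl addr_ge0 // sumr_ge0.
have k0 : 0 <= c * M%:R `^ (6 / 5) * Num.sqrt (M%:R / n%:R).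
  by rewrite !mulr_ge0 ?powR_ge0 ?sqrtr_ge0 // ltW // c_gt0.
apply: (le_trans (ler_wpM2l k0 (sum_sqrt_le _ _ x0))); rewrite sum_iota1.
apply: (le_trans (ler_wpM2l k0 (ler_wpM2l (sqrtr_ge0 _) (ler_wsqrtr h)))).
rewrite (sqrtrM _ (ler0n _ M)) (sqrtrM _ (expR_ge0 _)).
have sM : Num.sqrt M%:R ^+ 2 = M%:R :> R by rewrite sqr_sqrtr.
rewrite le_eqVlt; apply/orP; left; apply/eqP.
transitivity (c * M%:R `^ (6 / 5) * Num.sqrt M%:R ^+ 2 *
  (Num.sqrt (expR (n%:R * rho)) * Num.sqrt n%:R^-1)); first by ring.
by rewrite sM.
Qed.

(** Wiener's argument: divided by dl = 2 (1 - |a_0|), each homogeneous part is bounded by 1, so the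
    positive degrees contribute at most dl / 2 = 1 - |a_0|. *)
Theorem bohr_inequality (a : expo -> R[i]) :
  (forall al, a al != 0 -> (deg al <= d)%N) ->
  (forall u, torus u -> normc (ev a u) <= 1) ->
  c * M%:R `^ (6 / 5) * M%:R * Num.sqrt (expR (n%:R * rho) / n%:R) +
  Num.sqrt (M%:R * (n%:R * rho ^+ 2 * ((1 - rho)^-1) ^+ n)) +
  (2 ^+ M)^-1 * Num.sqrt (((1 - 4 * rho)^-1) ^+ n) <= 1 / 2 ->
  \sum_al normc (a al) * r ^+ deg al <= 1.
Proof.
move=> ad a1 small; set a0 := normc (a (zero_expo n N)).
have P1 := parseval_le1 wP a1.
have B12 : \sum_(1 <= m < d.+1) B m <= 1 / 2.
  rewrite (@big_cat_nat _ _ _ M.+1) ?ltnS //=; apply: le_trans small; apply: lerD.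
    rewrite (eq_big_nat _ _ (F2 := fun m => bsqf m + bnon m)) => [|m /andP[_ mM]].
      by rewrite big_split lerD ?squarefree_sum_le ?nonsquarefree_sum_le.
    by rewrite /B -ltnS mM.
  rewrite (eq_big_nat _ _ (F2 := ball)) => [|m /andP[mM _]]; first exact: tail_sum_le.
  by rewrite /B leqNgt mM.
have split_deg (b : expo -> R[i]) : (forall al, b al != 0 -> (deg al <= d)%N) ->
    \sum_al normc (b al) * r ^+ deg al = normc (b (zero_expo n N)) +
    \sum_(1 <= m < d.+1) \sum_(al | deg al == m) normc (b al) * r ^+ m.
  move=> bd; transitivity (\sum_(0 <= m < d.+1)
      \sum_(al | deg al == m) normc (b al) * r ^+ deg al).
    have := sum_by_degree (fun al : expo => normc (b al) * r ^+ deg al) xpredT 0 d.+1.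
    rewrite /= => ->; rewrite [RHS]big_mkcond; apply: eq_bigr => al _ /=; rewrite ltnS.
    case: ifPn => // h; have [->|/bd] := eqVneq (b al) 0.
      by rewrite ComplexField.Normc.normc0 mul0r.
    by rewrite (negbTE h).
  rewrite (@big_cat_nat _ _ _ 1%N) //= big_nat1; congr (_ + _).
    by rewrite (big_pred1 (zero_expo n N)) => [|al]; rewrite /= ?deg_eq0 // (eqP (etrans (deg_eq0 _) (eqxx _))) expr0 mulr1.
  by apply: eq_bigr => m _; apply: eq_bigr => al /eqP ->.
have a01 : a0 <= 1.
  rewrite -(@expr_le1 _ 2) ?normc_ge0 //; apply: le_trans P1.
  by rewrite (bigD1 (zero_expo n N)) //= lerDl sumr_ge0 // => *; exact: sqr_ge0.
rewrite split_deg // -/a0.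
(* If |a_0| = 1 the division is impossible, but Parseval makes every other coefficient vanish. *)
have [a0e|a0l] : a0 = 1 \/ a0 < 1.
- by move: a01; rewrite le_eqVlt => /orP[/eqP|]; [left|right].
- rewrite [X in _ + X]big1_seq ?addr0 // => m; rewrite mem_index_iota => /andP[_ /andP[m0 _]].
  apply: big1 => al /eqP dal; suff -> : a al = 0.
    by rewrite ComplexField.Normc.normc0 mul0r.
  have ne : al != zero_expo n N by rewrite -deg_eq0 dal -lt0n.
  apply/eqP; rewrite -normc_eq0 -(sqrf_eq0) eq_le sqr_ge0 andbT.
  move: P1; rewrite (bigD1 (zero_expo n N)) //= -/a0 a0e expr1n (bigD1 al) //= gerDl.
  by apply: le_trans; rewrite lerDl sumr_ge0 // => *; exact: sqr_ge0.
set dl := 2 * (1 - a0); have dl0 : 0 < dl by rewrite mulr_gt0 // subr_gt0.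
suff : \sum_(1 <= m < d.+1) \sum_(al | deg al == m) normc (a al) * r ^+ m <= dl * (1 / 2).
  by rewrite /dl => h; lra.
apply: le_trans (ler_wpM2l (ltW dl0) B12); rewrite mulr_sumr.
apply: ler_sum_nat => m /andP[m0 md].
pose b al := part (fun al => deg al == m) a al / (dl%:C)%C.
have nb al : normc (b al) = normc (part (fun al => deg al == m) a al) / dl.
  by rewrite ComplexField.Normc.normcM ComplexField.Normc.normcV normcC gtr0_norm.
have bd al : b al != 0 -> (deg al <= d)%N.
  by rewrite /b /part; case: (deg al =P m) => [->|_]; rewrite ?mul0r ?eqxx.
have b1 u : torus u -> normc (ev b u) <= 1.
  move=> tu; have -> : ev b u = ev (part (fun al => deg al == m) a) u / (dl%:C)%C.
    by rewrite /ev mulr_suml; apply: eq_bigr => al _; rewrite /b mulrAC.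
  rewrite ComplexField.Normc.normcM ComplexField.Normc.normcV normcC gtr0_norm //.
  rewrite ler_pdivrMr // mul1r; exact: (homogeneous_part_le wP dN ad a1 m0 md tu).
apply: le_trans (ler_wpM2l (ltW dl0) (degree_sum_le bd b1 m0)); rewrite mulr_sumr.
apply: ler_sum => al /eqP dal; rewrite nb /part dal eqxx.
by rewrite mulrA [dl * _]mulrC divfK ?gt_eqF.
Qed.

End Core.

(** * Polynomials in the polydisc *)

Section PolydiscPolynomials.
Import -(notations) mpoly.

Section Bridge.
Variables (R : realType) (n N : nat).
Local Notation expo := {ffun 'I_n -> 'I_N.+1}.
Implicit Types (al : expo) (f : mpoly.mpoly n R[i]).

Definition mnm al : mpoly.multinom n := mpoly.Multinom [tuple (al i : nat) | i < n].

Lemma mnmE al i : mpoly.fun_of_multinom (mnm al) i = al i.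
Proof. by rewrite mpoly.mnmE. Qed.

Lemma mnm_inj : injective mnm.
Proof.
by move=> al be e; apply/ffunP => i; apply: val_inj; rewrite /= -!mnmE e.
Qed.

Lemma mdeg_mnm al : mpoly.mdeg (mnm al) = deg al.
Proof. by rewrite mpoly.mdegE; apply: eq_bigr => i _; rewrite mnmE. Qed.

Lemma sum_msupp (V : nmodType) f (F : mpoly.multinom n -> V) :
  (forall (m : mpoly.multinom n) i, m \in mpoly.msupp f ->
     (mpoly.fun_of_multinom m i <= N)%N) ->
  (forall m : mpoly.multinom n, m \notin mpoly.msupp f -> F m = 0) ->
  \sum_(m <- mpoly.msupp f) F m = \sum_al F (mnm al).
Proof.
move=> fN F0; pose s := [seq mnm al | al <- enum (fun al => mnm al \in mpoly.msupp f)].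
rewrite (perm_big s) /=.
  rewrite /s big_map big_enum /= big_mkcond /=; apply: eq_bigr => al _.
  by rewrite unfold_in; case: ifPn => // /F0.
apply: uniq_perm; first exact: mpoly.msupp_uniq.
  by rewrite (map_inj_uniq mnm_inj) enum_uniq.
move=> m; apply/idP/mapP => [mf|[al]]; last by rewrite mem_enum unfold_in => ? ->.
pose al : expo := [ffun i => inord (mpoly.fun_of_multinom m i)].
have e : m = mnm al.
  by apply/mpoly.mnmP => i; rewrite mnmE ffunE inordK // ltnS fN.
by exists al => //; rewrite mem_enum unfold_in -e.
Qed.

Definition mpoly_of (a : expo -> R[i]) : mpoly.mpoly n R[i] :=
  \sum_al a al *: mpoly.mpolyX _ (mnm al).

Lemma mcoeff_mpoly_of a al : mpoly.mcoeff (mnm al) (mpoly_of a) = a al.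
Proof.
rewrite /mpoly_of raddf_sum /= (bigD1 al) //= big1 => [|be ne].
  by rewrite mpoly.mcoeffZ mpoly.mcoeffX eqxx mulr1 addr0.
by rewrite mpoly.mcoeffZ mpoly.mcoeffX (inj_eq mnm_inj) (negbTE ne) mulr0.
Qed.

Lemma meval_mpoly_of a z : mpoly.meval z (mpoly_of a) = ev a z.
Proof.
rewrite /mpoly_of raddf_sum /=; apply: eq_bigr => al _.
by rewrite mpoly.mevalZ mpoly.mevalX; congr (_ * _); apply: eq_bigr => i _; rewrite mnmE.
Qed.

Lemma msupp_mpoly_of a m : m \in mpoly.msupp (mpoly_of a) -> exists al, m = mnm al.
Proof.
rewrite mpoly.mcoeff_msupp /mpoly_of raddf_sum /= => h.
have [//|ne] := pselect (exists al, m = mnm al); case/eqP: h.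
apply: big1 => al _; rewrite mpoly.mcoeffZ mpoly.mcoeffX.
by case: eqP => [e|_]; rewrite ?mulr0 //; case: ne; exists al.
Qed.

End Bridge.

Lemma bohr_set_coef_le (R : realType) (n N : nat) (a : {ffun 'I_n -> 'I_N.+1} -> R[i])
    (r B : R) :
  @bohr_set R n r -> (forall z, @polydisc R n z -> normc (ev a z) <= B) ->
  \sum_al normc (a al) * r ^+ deg al <= B.
Proof.
move=> [/andP[r0 _] h] aB; have := h (mpoly_of a) => {}h.
have : (polydisc_norm (mpoly_of a) <= B%:E)%E.
  apply: ub_ereal_sup => _ [z hz <-]; rewrite lee_fin meval_mpoly_of; exact: aB.
move/(le_trans h); rewrite lee_fin; apply: le_trans.
rewrite /majorant_sum (@sum_msupp R n N).
- by apply: ler_sum => al _; rewrite mcoeff_mpoly_of mdeg_mnm.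
- by move=> m i /msupp_mpoly_of[al ->]; rewrite mnmE -ltnS.
- move=> m; rewrite mpoly.mcoeff_msupp negbK => /eqP ->.
  by rewrite ComplexField.Normc.normc0 mul0r.
Qed.

(** Membership will be shown strictly below r only: the norm is taken over the open polydisc, while
    the argument runs on the torus. *)
Lemma bohr_radius_ge (R : realType) (n : nat) (r : R) : 0 < r ->
  (forall s, 0 < s < 1 -> @bohr_set R n (r * s)) -> r <= bohr_radius R n.
Proof.
move=> r0 h; have ub : has_ubound (@bohr_set R n) by exists 1 => x [/andP[_ /ltW]].
have le s : 0 < s < 1 -> r * s <= bohr_radius R n.
  by move=> hs; apply: ub_le_sup => //; exact: h.
rewrite leNgt; apply/negP => br; set b := bohr_radius R n in br le.
have b0 : 0 < b.
  have h2 : 0 < (2^-1 : R) < 1 by apply/andP; split; lra.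
  by apply: lt_le_trans (le _ h2); rewrite mulr_gt0 // invr_gt0.
(* The scale that puts r s midway between b and r. *)
have q1 : 0 < (1 + b / r) / 2 < 1.
  have [p0 p1] : 0 < b / r /\ b / r < 1 by rewrite divr_gt0 // ltr_pdivrMr // mul1r.
  by apply/andP; split; lra.
have := le _ q1.
have -> : r * ((1 + b / r) / 2) = (r + b) / 2 by field; rewrite gt_eqF.
by move=> ?; lra.
Qed.

(** [0 <= B] covers an empty [bohr_set], whose [sup] is 0 by convention. *)
Lemma bohr_radius_le (R : realType) (n : nat) (B : R) : 0 <= B ->
  (forall r, @bohr_set R n r -> r <= B) -> bohr_radius R n <= B.
Proof.
move=> B0 h; rewrite /bohr_radius.
have [->|/set0P ne] := eqVneq (@bohr_set R n) classical_sets.set0; first by rewrite sup0.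
by apply: ge_sup.
Qed.

Lemma bohr_set_of_inequality (R : realType) (n J M : nat) (r s : R) :
  (forall k, ~~ large R k./2 -> 51 / 50 * k%:R <= J%:R :> R) ->
  0 < r < 1 -> 0 < s < 1 -> (0 < M)%N -> (M <= n)%N -> r ^+ 2 < 4^-1 ->
  (base_const J)%:R * M%:R `^ (6 / 5) * M%:R * Num.sqrt (expR (n%:R * r ^+ 2) / n%:R) +
  Num.sqrt (M%:R * (n%:R * (r ^+ 2) ^+ 2 * ((1 - r ^+ 2)^-1) ^+ n)) +
  (2 ^+ M)^-1 * Num.sqrt (((1 - 4 * r ^+ 2)^-1) ^+ n) <= 1 / 2 ->
  @bohr_set R n (r * s).
Proof.
move=> J_large /andP[r0 r1] /andP[s0 s1] M0 Mn r4 small; split.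
  by rewrite mulr_gt0 //= mulr_ilt1 // ltW.
move=> f; have : (0%:E <= polydisc_norm f)%E.
  apply: le_trans (ereal_sup_ubound _); last first.
    exists (fun=> 0) => //; move=> i; rewrite ComplexField.Normc.normc0; exact: ltr01.
  by rewrite lee_fin normc_ge0.
(* An infinite norm makes the claim trivial; a finite one is enlarged by e > 0 so that it can be
   divided by even when it is 0. *)
case E : (polydisc_norm f) => [x| |] //= x0; last by rewrite leey.
rewrite lee_fin; rewrite lee_fin in x0; apply/ler_addgt0Pr => e e0.
have xe : 0 < x + e by rewrite ltr_wpDl.
pose D := \max_(m <- mpoly.msupp f) mpoly.mdeg m.
pose d := maxn (maxn J M) (maxn D 1); pose N := d.*2.
have [w wP] := @primitive_root_exists R N.+1 isT.
have Jd : (J <= d)%N by rewrite /d !leq_max leqnn.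
have Md : (M <= d)%N by rewrite /d !leq_max leqnn orbT.
have Dd : (D <= d)%N by rewrite /d !leq_max leqnn !orbT.
have d0 : (0 < d)%N by rewrite /d !leq_max ltnSn !orbT.
have degD m : m \in mpoly.msupp f -> (mpoly.mdeg m <= d)%N.
  by move=> mf; apply: leq_trans Dd; rewrite /D (big_rem m) //= leq_maxl.
(* Coefficients of f(s z) / (x + e): the dilation by s < 1 brings the torus inside the open
   polydisc. *)
pose a (al : {ffun 'I_n -> 'I_N.+1}) : R[i] :=
  mpoly.mcoeff (mnm al) f * ((s ^+ deg al / (x + e))%:C)%C.
have ad al : a al != 0 -> (deg al <= d)%N.
  rewrite /a mulf_eq0 negb_or => /andP[h _]; rewrite -mdeg_mnm; apply: degD.
  by rewrite mpoly.mcoeff_msupp.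
have fN (m : mpoly.multinom n) i : m \in mpoly.msupp f ->
    (mpoly.fun_of_multinom m i <= N)%N.
  move=> /degD md; apply: (@leq_trans d); last by rewrite /N -addnn leq_addr.
  by apply: leq_trans md; rewrite mpoly.mdegE (bigD1 i) //= leq_addr.
have a1 u : torus u -> normc (ev a u) <= 1.
  move=> tu; have -> : ev a u = mpoly.meval (fun i => (s%:C)%C * u i) f * (((x + e)^-1)%:C)%C.
    rewrite mpoly.mevalE (sum_msupp fN); last first.
      by move=> m; rewrite mpoly.mcoeff_msupp negbK => /eqP ->; rewrite mul0r.
    rewrite mulr_suml; apply: eq_bigr => al _; rewrite /a rmorphM rmorphXn /=.
    rewrite (eq_bigr (fun i => (s%:C)%C ^+ al i * u i ^+ al i)); last first.
      by move=> i _; rewrite mnmE exprMn.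
    by rewrite big_split /= prodrXr -/(deg al) -/(mon al u) -!mulrA [mon al u * _]mulrC.
  rewrite ComplexField.Normc.normcM normcC ger0_norm ?invr_ge0 ?(ltW xe) //.
  rewrite ler_pdivrMr // mul1r -lee_fin; apply: (@le_trans _ _ x%:E); last first.
    by rewrite lee_fin lerDl ltW.
  rewrite -E; apply: ereal_sup_ubound; exists (fun i => (s%:C)%C * u i) => // i.
  by rewrite /= ComplexField.Normc.normcM normcC tu mulr1 gtr0_norm.
have := bohr_inequality wP d0 (leqnn _) J_large Jd r0 M0 Mn Md r4 ad a1 small.
have -> : \sum_al normc (a al) * r ^+ deg al = majorant_sum f (r * s) / (x + e).
  rewrite /majorant_sum (sum_msupp fN); last first.
    move=> m; rewrite mpoly.mcoeff_msupp negbK => /eqP ->.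
    by rewrite ComplexField.Normc.normc0 mul0r.
  rewrite mulr_suml; apply: eq_bigr => al _; rewrite /a mdeg_mnm.
  rewrite ComplexField.Normc.normcM normcC ger0_norm; last first.
    by rewrite divr_ge0 ?exprn_ge0 // ltW.
  by rewrite exprMn -!mulrA; congr (_ * _); rewrite mulrA mulrC.
by rewrite ler_pdivrMr // mul1r.
Qed.

End PolydiscPolynomials.

(** * Random signs *)

(** For |x| >= 1 both exponentials are at most exp(x^2); below 1, exp(y) <= (1 - y/2)^(-2) leaves a
    rational inequality in s = x^2 / 4. *)
Lemma cosh_le (R : realType) (x : R) : (expR x + expR (- x)) / 2 <= expR (x ^+ 2).
Proof.
wlog x0 : x / 0 <= x.
  move=> h; have [/h//|/ltW x0] := leP 0 x; have := h (- x); rewrite oppr_ge0 => /(_ x0).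
  by rewrite opprK sqrrN addrC.
have [x1|x1] := leP 1 x.
  have e1 : expR (- x) <= expR x by rewrite ler_expR; lra.
  have : expR x <= expR (x ^+ 2) by rewrite ler_expR expr2 ler_peMr.
  lra.
pose s := x ^+ 2 / 4.
have s0 : 0 <= s by rewrite divr_ge0 ?sqr_ge0.
have s4 : s <= 1 / 4.
  by have x2 : x ^+ 2 <= 1; [rewrite exprn_ile1 // ltW|rewrite /s; lra].
have half (y : R) : y < 2 -> expR y <= (1 - y / 2) ^- 2.
  move=> y2; have y0 : 0 < 1 - y / 2 by lra.
  have -> : expR y = (expR (- (y / 2))) ^- 2.
    by rewrite -expRM_natr -expRN; congr expR; field.
  rewrite lef_pV2 ?posrE ?exprn_gt0 ?expR_gt0 // lerXn2r ?nnegrE ?expR_ge0 ?(ltW y0) //.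
  exact: expR_ge1Dx.
have h1 : expR x <= (1 - x / 2) ^- 2 by apply: half; lra.
have h2 : expR (- x) <= (1 + x / 2) ^- 2.
  by have := half (- x); rewrite mulNr opprK; apply; lra.
have h3 : (1 + 2 * s) ^+ 2 <= expR (x ^+ 2).
  have -> : expR (x ^+ 2) = expR (2 * s) ^+ 2.
    by rewrite -expRM_natr; congr expR; rewrite /s; field.
  by rewrite lerXn2r ?nnegrE ?expR_ge0 ?expR_ge1Dx // addr_ge0 // mulr_ge0.
have [p q] : 0 < 1 - x / 2 /\ 0 < 1 + x / 2 by split; lra.
have h4 : ((1 - x / 2) ^- 2 + (1 + x / 2) ^- 2) / 2 = (1 + s) / (1 - s) ^+ 2.
  by rewrite /s; field; apply/and3P; split; rewrite gt_eqF //; rewrite /s in s4; lra.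
have h5 : (1 + s) / (1 - s) ^+ 2 <= (1 + 2 * s) ^+ 2.
  rewrite ler_pdivrMr ?exprn_gt0 ?subr_gt0 //; last by lra.
  have -> : (1 + 2 * s) ^+ 2 * (1 - s) ^+ 2 =
    1 + s + s * (1 - 3 * s - 4 * s ^+ 2 + 4 * s ^+ 3) by ring.
  rewrite lerDl mulr_ge0 //.
  have s2 : s ^+ 2 <= s / 4 by rewrite expr2 ler_wpM2l //; lra.
  have s3 : 0 <= s ^+ 3 by rewrite exprn_ge0.
  lra.
lra.
Qed.

(** Exponential moments with t^2 V = l = ln |Q|: if every choice of signs failed at some q, each E e
    would exceed exp(2 l), whereas the mean of E is at most |Q| exp(t^2 V) = exp(2 l). *)
Lemma exists_signs (R : realType) (S Q : finType) (c : Q -> S -> R) (V : R) :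
  0 < V -> (forall q, \sum_s c q s ^+ 2 <= V) -> (1 < #|Q|)%N ->
  exists e : {ffun S -> bool},
    forall q, \sum_s (-1) ^+ e s * c q s <= 2 * Num.sqrt (V * ln #|Q|%:R).
Proof.
move=> V0 cV Q1; set l := ln #|Q|%:R.
have Q0 : 0 < #|Q|%:R :> R by rewrite ltr0n ltnW.
have l0 : 0 < l by rewrite ln_gt0 // ltr1n.
have [//|none] := pselect (exists e : {ffun S -> bool},
  forall q, \sum_s (-1) ^+ e s * c q s <= 2 * Num.sqrt (V * l)).
exfalso; pose t := Num.sqrt (l / V); have t0 : 0 < t by rewrite sqrtr_gt0 divr_gt0.
have t2V : t ^+ 2 * V = l by rewrite sqr_sqrtr ?divfK ?gt_eqF // divr_ge0 // ltW.
have tb : t * (2 * Num.sqrt (V * l)) = 2 * l.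
  rewrite mulrCA -sqrtrM ?divr_ge0 ?(ltW l0) ?(ltW V0) //.
  have -> : l / V * (V * l) = l ^+ 2 by field; rewrite gt_eqF.
  by rewrite sqrtr_sqr gtr0_norm.
pose E (e : {ffun S -> bool}) := \sum_q expR (t * \sum_s (-1) ^+ e s * c q s).
have big e : expR (2 * l) < E e.
  have [q hq] : exists q, 2 * Num.sqrt (V * l) < \sum_s (-1) ^+ e s * c q s.
    apply: contrapT => h; apply: none; exists e => q; rewrite leNgt; apply/negP => hq.
    by apply: h; exists q.
  apply: (@lt_le_trans _ _ (expR (t * \sum_s (-1) ^+ e s * c q s))).
    by rewrite ltr_expR -tb ltr_pM2l.
  by rewrite /E (bigD1 q) //= lerDl sumr_ge0 // => *; exact: expR_ge0.
have total : \sum_e E e <= 2 ^+ #|S| * expR (2 * l).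
  rewrite /E exchange_big /=.
  apply: (@le_trans _ _ (\sum_(q : Q) 2 ^+ #|S| * expR l)); last first.
    rewrite sumr_const -[_ *+ #|_|]mulr_natl mulrCA ler_wpM2l ?exprn_ge0 //.
    by rewrite mulr2n mulrDl mul1r expRD ler_wpM2r ?expR_ge0 // /l lnK.
  apply: ler_sum => q _.
  rewrite (eq_bigr (fun e : {ffun S -> bool} =>
     \prod_s expR (t * ((-1) ^+ e s * c q s)))); last first.
    by move=> e _; rewrite mulr_sumr expR_sum.
  rewrite -(bigA_distr_bigA (fun s (b : bool) => expR (t * ((-1) ^+ b * c q s)))) /=.
  apply: (@le_trans _ _ (\prod_(s : S) (2 * expR ((t * c q s) ^+ 2)))).
    apply: ler_prod => s _; rewrite big_bool /= expr1 expr0 mul1r mulN1r mulrN.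
    rewrite addr_ge0 ?expR_ge0 //= [2 * _]mulrC -ler_pdivrMr // addrC; exact: cosh_le.
  rewrite big_split prodr_const /= ler_wpM2l ?exprn_ge0 // -expR_sum ler_expR.
  rewrite (eq_bigr (fun s => t ^+ 2 * c q s ^+ 2)); last by move=> s _; rewrite exprMn.
  by rewrite -mulr_sumr -t2V ler_wpM2l ?sqr_ge0.
have : \sum_(e : {ffun S -> bool}) expR (2 * l) < \sum_e E e.
  by apply: ltr_sum => //; apply/hasP; exists [ffun=> true]; rewrite ?mem_index_enum.
rewrite ltNge => /negP; apply; apply: (le_trans total).
by rewrite sumr_const card_ffun card_bool -[expR _ *+ _]mulr_natl natrX.
Qed.

(** * Regular polygons containing the unit disc *)

Section Polygon.
Variables (R : realType) (m : nat) (w : R[i]).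
Hypothesis m0 : (0 < m)%N.
Hypothesis wP : m.+2.-primitive_root w.
Implicit Types (u z : R[i]).

Lemma unit_conj u : normc u = 1 -> u^* * u = 1.
Proof. by move=> u1; rewrite mulrC -normc_sqr u1 expr1n. Qed.

(** s = 0 gives the mass and s = 1 the first moment of the kernel; all exponents stay below m + 2,
    so there is no aliasing. *)
Lemma fejer_sum u s : (s <= 1)%N ->
  \sum_(k < m.+2) ((normc (\sum_(j < m.+1) (u^* * w ^+ k) ^+ j) ^+ 2)%:C)%C * (w ^+ s) ^+ k =
  m.+2%:R * \sum_(j < m.+1) \sum_(l < m.+1) (if (j + s == l)%N then u^* ^+ j * u ^+ l else 0).
Proof.
move=> s1; rewrite (eq_bigr (fun k : 'I_m.+2 => \sum_(j < m.+1) \sum_(l < m.+1)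
    u^* ^+ j * u ^+ l * ((w ^+ (j + s)) ^+ k * ((w ^+ l) ^+ k)^*))); last first.
  move=> k _; rewrite normc_sqr rmorph_sum big_distrlr mulr_suml; apply: eq_bigr => j _ /=.
  rewrite mulr_suml; apply: eq_bigr => l _.
  rewrite rmorphXn rmorphM /= conjCK !exprMn rmorphXn /= exprD exprMn.
  rewrite -!exprM [(k * j)%N]mulnC [(l * k)%N]mulnC !exprM rmorphXn /=.
  by rewrite rmorphXn; ring.
rewrite exchange_big mulr_sumr; apply: eq_bigr => j _.
rewrite exchange_big mulr_sumr; apply: eq_bigr => l _ /=.
rewrite -mulr_sumr (sum_root wP) !modn_small ?(ltn_trans (ltn_ord l)) //; last first.
  by have := ltn_ord j; lia.
by case: ifP => _; rewrite ?mulr0 // mulrC.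
Qed.

(* The weights are a discrete Fejer kernel centred at u. *)
Lemma polygon_unit u : normc u = 1 -> exists c : 'I_m.+2 -> R,
  [/\ forall k, 0 <= c k, \sum_k c k = 1 &
      \sum_k ((c k)%:C)%C * w ^+ k = ((m%:R / m.+1%:R)%:C)%C * u].
Proof.
move=> u1; pose D (k : 'I_m.+2) := \sum_(j < m.+1) (u^* * w ^+ k) ^+ j.
pose M : R := m.+1%:R * m.+2%:R.
have M0 : 0 < M by rewrite mulr_gt0 ?ltr0n.
have uu := unit_conj u1.
have sum0 : \sum_(k < m.+2) normc (D k) ^+ 2 = M.
  apply: (@complexI R); rewrite rmorph_sum /=.
  rewrite (eq_bigr (fun k : 'I_m.+2 => ((normc (D k) ^+ 2)%:C)%C * (w ^+ 0) ^+ k)); last first.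
    by move=> k _; rewrite expr0 expr1n mulr1.
  rewrite fejer_sum // /M rmorphM !rmorph_nat mulrC; congr (_ * _).
  rewrite (eq_bigr (fun=> 1)) ?sumr_const ?card_ord // => j _.
  rewrite (bigD1 j) //= addn0 eqxx -exprMn uu expr1n big1 ?addr0 // => l lj.
  by rewrite ?addn0 eq_sym val_eqE (negbTE lj).
(* Of the m + 1 indices j, m have a successor, whence the ratio m / (m + 1). *)
have sum1 : \sum_(k < m.+2) ((normc (D k) ^+ 2)%:C)%C * w ^+ k = m.+2%:R * (m%:R * u).
  rewrite (eq_bigr (fun k : 'I_m.+2 => ((normc (D k) ^+ 2)%:C)%C * (w ^+ 1) ^+ k)); last first.
    by move=> k _; rewrite expr1.
  rewrite fejer_sum //; congr (_ * _); rewrite exchange_big big_ord_recl /= big1 ?add0r.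
    rewrite (eq_bigr (fun=> u)); first by rewrite sumr_const card_ord mulr_natl.
    move=> l _.
    rewrite (bigD1 (widen_ord (leqnSn m) l)) //= big1 ?addr0.
      by rewrite addn1 eqxx /= exprS mulrCA -exprMn uu expr1n mulr1.
    by move=> j jl; rewrite addn1 /= /bump leq0n add1n eqSS -[X in _ == X]/(val (widen_ord (leqnSn m) l)) val_eqE (negbTE jl).
  by move=> j _; rewrite addn1.
exists (fun k => normc (D k) ^+ 2 / M); split.
- by move=> k; rewrite divr_ge0 ?sqr_ge0 // ltW.
- by rewrite -mulr_suml sum0 divff // gt_eqF.
rewrite (eq_bigr (fun k => ((normc (D k) ^+ 2)%:C)%C * w ^+ k * ((M^-1)%:C)%C)); last first.
  by move=> k _; rewrite rmorphM mulrAC.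
rewrite -mulr_suml sum1.
have -> : m%:R / m.+1%:R = m.+2%:R * m%:R * M^-1 :> R.
  by rewrite /M; field; rewrite !gt_eqF ?ltr_pwDl ?ler0n ?ltr01 ?ltr0n.
by rewrite !rmorphM !rmorph_nat /= -!mulrA; congr (_ * (_ * _)); rewrite mulrC.
Qed.

(** The radius (m+1)/m undoes the shrinking by m/(m+1) in [polygon_unit]. *)
Definition vertex k : R[i] := ((m.+1%:R / m%:R)%:C)%C * w ^+ k.

Lemma normc_vertex k : normc (vertex k) = m.+1%:R / m%:R.
Proof.
rewrite ComplexField.Normc.normcM normcX (normc_root wP) expr1n mulr1 normcC.
by rewrite ger0_norm // divr_ge0.
Qed.

Lemma polygon_disc z : normc z <= 1 -> exists c : 'I_m.+2 -> R,
  [/\ forall k, 0 <= c k, \sum_k c k = 1 & \sum_k ((c k)%:C)%C * vertex k = z].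
Proof.
move=> z1; have [kp kp1 kpz] := phase z; pose u := kp^*.
have u1 : normc u = 1 by rewrite normc_conj.
have zE : z = ((normc z)%:C)%C * u.
  by rewrite -kpz /u mulrC mulrA unit_conj ?mul1r.
have [c [c0 c1 cu]] := polygon_unit u1.
have [c' [c'0 c'1 c'u]] : exists c : 'I_m.+2 -> R, [/\ forall k, 0 <= c k, \sum_k c k = 1 &
      \sum_k ((c k)%:C)%C * w ^+ k = ((m%:R / m.+1%:R)%:C)%C * - u].
  by apply: polygon_unit; rewrite normcN.
(* z lies on the segment from -u to u, with weight p at u and q at -u. *)
pose p := (1 + normc z) / 2; pose q := (1 - normc z) / 2.
have p0 : 0 <= p by rewrite divr_ge0 // addr_ge0 // normc_ge0.
have q0 : 0 <= q by rewrite divr_ge0 // subr_ge0.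
exists (fun k => p * c k + q * c' k); split.
- by move=> k; rewrite addr_ge0 // mulr_ge0.
- by rewrite big_split /= -!mulr_sumr c1 c'1 /p /q; field.
rewrite (eq_bigr (fun k : 'I_m.+2 => ((m.+1%:R / m%:R)%:C)%C * (
   (p%:C)%C * (((c k)%:C)%C * w ^+ k) + (q%:C)%C * (((c' k)%:C)%C * w ^+ k)))); last first.
  by move=> k _; rewrite /vertex rmorphD !rmorphM /= mulrDl mulrDr; congr (_ + _);
     rewrite mulrCA; congr (_ * _); rewrite !mulrA.
rewrite -mulr_sumr big_split /= -!mulr_sumr cu c'u [RHS]zE.
have -> : normc z = p - q by rewrite /p /q; field.
rewrite !mulrN -mulrBl rmorphB /= mulrCA; congr (_ * _).
have e : m.+1%:R / m%:R * (m%:R / m.+1%:R) = 1 :> R.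
  by rewrite mulrA divfK ?divff ?pnatr_eq0 -?lt0n.
by rewrite mulrA -rmorphM /= e mul1r.
Qed.

End Polygon.

Lemma normc_le_ReIm (R : realType) (z : R[i]) (b : R) :
  complex.Re z <= b -> - complex.Re z <= b -> complex.Im z <= b -> - complex.Im z <= b ->
  normc z <= 2 * b.
Proof.
case: z => x y /= xb xb' yb yb'; have b0 : 0 <= b by lra.
rewrite -[2 * b]ger0_norm ?mulr_ge0 // -sqrtr_sqr ler_wsqrtr // exprMn.
have x2 : x ^+ 2 <= b ^+ 2 by rewrite -[x ^+ 2]real_normK ?num_real // lerXn2r ?nnegrE // ler_norml; lra.
have y2 : y ^+ 2 <= b ^+ 2 by rewrite -[y ^+ 2]real_normK ?num_real // lerXn2r ?nnegrE // ler_norml; lra.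
by have := sqr_ge0 b; lra.
Qed.

Lemma sqr_Re_le (R : realType) (z : R[i]) : complex.Re z ^+ 2 <= normc z ^+ 2.
Proof. by case: z => x y /=; rewrite sqr_sqrtr ?lerDl ?sqr_ge0 // addr_ge0 ?sqr_ge0. Qed.

Lemma sqr_Im_le (R : realType) (z : R[i]) : complex.Im z ^+ 2 <= normc z ^+ 2.
Proof. by case: z => x y /=; rewrite sqr_sqrtr ?lerDr ?sqr_ge0 // addr_ge0 ?sqr_ge0. Qed.

Lemma ReD (R : realType) (y z : R[i]) : complex.Re (y + z) = complex.Re y + complex.Re z.
Proof. by case: y; case: z. Qed.

Lemma ImD (R : realType) (y z : R[i]) : complex.Im (y + z) = complex.Im y + complex.Im z.
Proof. by case: y; case: z. Qed.

Lemma ReZ (R : realType) (x : R) (z : R[i]) : complex.Re ((x%:C)%C * z) = x * complex.Re z.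
Proof. by case: z => ? ?; rewrite /= mul0r subr0. Qed.

Lemma ImZ (R : realType) (x : R) (z : R[i]) : complex.Im ((x%:C)%C * z) = x * complex.Im z.
Proof. by case: z => ? ?; rewrite /= mul0r addr0. Qed.

Section RandomPolynomial.
Variables (R : realType) (n m : nat).
Hypothesis m0 : (0 < m)%N.
Hypothesis mn : (m <= n)%N.
Variable w : R[i].
Hypothesis wP : m.+2.-primitive_root w.
Local Notation expo := {ffun 'I_n -> 'I_2}.
Local Notation vertices := {ffun 'I_n -> 'I_m.+2}.
Implicit Types (al : expo) (ka : vertices).

Definition corner ka : 'I_n -> R[i] := fun i => vertex m w (ka i).

(* A polynomial of degree at most one in each variable is dominated on the polydisc by its
   values at the vertices of a product of polygons containing the unit disc. *)
Lemma ev_corner (a : expo -> R[i]) (B : R) :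
  (forall ka, normc (ev a (corner ka)) <= B) ->
  forall z, (forall i, normc (z i) <= 1) -> normc (ev a z) <= B.
Proof.
move=> aB z z1; pose C i := cid (polygon_disc m0 wP (z1 i)).
pose c i := sval (C i).
have c0 i k : 0 <= c i k by have [h _ _] := svalP (C i); exact: h.
have c1 i : \sum_k c i k = 1 by have [_ h _] := svalP (C i).
have cz i : \sum_k ((c i k)%:C)%C * vertex m w k = z i by have [_ _ h] := svalP (C i).
(* Product weights: with exponents 0 or 1, each monomial at z is the weighted mean of its values at
   the vertices. *)
pose W ka := \prod_i c i (ka i).
have W0 ka : 0 <= W ka by rewrite prodr_ge0.
have monE al : mon al z = \sum_ka ((W ka)%:C)%C * mon al (corner ka).
  rewrite /mon (eq_bigr (fun i => \sum_k ((c i k)%:C)%C * vertex m w k ^+ al i)); last first.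
    move=> i _; have : (al i <= 1)%N by rewrite -ltnS.
    case: (al i : nat) => [|[|//]] _; last by rewrite expr1 -cz; apply: eq_bigr.
    rewrite expr0 -(rmorph1 (real_complex R)) -(c1 i) rmorph_sum /=.
    by apply: eq_bigr => k _; rewrite expr0 mulr1.
  rewrite (bigA_distr_bigA (fun i k => ((c i k)%:C)%C * vertex m w k ^+ al i)) /=.
  by apply: eq_bigr => ka _; rewrite big_split /= /W rmorph_prod.
have -> : ev a z = \sum_ka ((W ka)%:C)%C * ev a (corner ka).
  rewrite /ev (eq_bigr (fun al => \sum_ka ((W ka)%:C)%C * (a al * mon al (corner ka)))).
    by rewrite exchange_big; apply: eq_bigr => ka _; rewrite mulr_sumr.
  by move=> al _; rewrite monE mulr_sumr; apply: eq_bigr => ka _; rewrite mulrCA.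
apply: (le_trans (le_normc_sum _ _ _)).
apply: (@le_trans _ _ (\sum_ka W ka * B)).
  apply: ler_sum => ka _; rewrite ComplexField.Normc.normcM normcC ger0_norm //.
  by rewrite ler_wpM2l.
rewrite -mulr_suml /W -(bigA_distr_bigA (fun i k => c i k)) /=.
by rewrite big1 ?mul1r.
Qed.

(** (1 + 1/m)^m <= e <= 4: with m + 2 vertices the enlargement is harmless in degree m. *)
Lemma normc_mon_corner al ka : deg al = m -> normc (mon al (corner ka)) <= 4.
Proof.
move=> dal; rewrite /mon normc_prod.
rewrite (eq_bigr (fun i => (m.+1%:R / m%:R) ^+ al i)); last first.
  by move=> i _; rewrite normcX (normc_vertex wP).
rewrite prodrXr -/(deg al) dal.
have mR : 0 < m%:R :> R by rewrite ltr0n.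
have -> : m.+1%:R / m%:R = 1 + m%:R^-1 :> R.
  by rewrite -natr1 mulrDl divff ?gt_eqF // mul1r.
apply: (@le_trans _ _ (expR (m%:R^-1) ^+ m)).
  by rewrite lerXn2r ?nnegrE ?expR_ge0 ?expR_ge1Dx // addr_ge0 // invr_ge0 ltW.
rewrite -expRM_natr mulVf ?gt_eqF //.
have -> : expR 1 = expR (- 2^-1) ^- 2 :> R.
  by rewrite -expRM_natr -expRN; congr expR; field.
have h : 2^-1 <= expR (- 2^-1) :> R by apply: le_trans (expR_ge1Dx _); lra.
have -> : 4 = (2^-1) ^- 2 :> R by field.
by rewrite lef_pV2 ?posrE ?exprn_gt0 ?expR_gt0 ?invr_gt0 // lerXn2r ?nnegrE ?expR_ge0 ?invr_ge0.
Qed.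

Lemma card_degree : \sum_(al : expo | deg al == m) 1 = 'C(n, m)%:R :> R.
Proof.
have := @sum_squarefree R n 1 isT (fun=> 1) m.
rewrite (eq_bigl (fun al : expo => deg al == m)) => [|al]; last first.
  by rewrite (_ : squarefree al) //; apply/forallP => i; rewrite -ltnS.
under eq_bigr do rewrite ComplexField.Normc.normc1.
under [X in _ = X]eq_bigr do rewrite ComplexField.Normc.normc1.
move=> ->; rewrite sumr_const; congr _%:R.
by rewrite -[in RHS](card_ord n) -card_draws cardsE.
Qed.

Theorem bohr_set_upper (r : R) : @bohr_set R n r ->
  'C(n, m)%:R * r ^+ m <= 16 * Num.sqrt ('C(n, m)%:R * ln (4 * m.+2%:R ^+ n)).
Proof.
move=> br; set C : R := 'C(n, m)%:R.
have C0 : 0 < C by rewrite ltr0n bin_gt0.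
(* Besides a vertex, q carries a sign and the choice of real or imaginary part: four real forms
   control the modulus. *)
pose v (q : vertices * (bool * bool)) (s : expo) : R :=
  if deg s == m then
    (-1) ^+ q.2.1 * (if q.2.2 then complex.Re (mon s (corner q.1)) else complex.Im (mon s (corner q.1)))
  else 0.
have V0 : 0 < 16 * C by rewrite mulr_gt0.
have vV q : \sum_s v q s ^+ 2 <= 16 * C.
  rewrite /C -card_degree mulr_sumr [X in _ <= X]big_mkcond; apply: ler_sum => s _.
  rewrite /v; case: eqP => [ds|_]; last by rewrite expr0n.
  rewrite mulr1 exprMn -exprM mulnC exprM sqrrN !expr1n mul1r.
  apply: (@le_trans _ _ (normc (mon s (corner q.1)) ^+ 2)).
    by case: q.2.2; [exact: sqr_Re_le|exact: sqr_Im_le].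
  have -> : 16 = 4 ^+ 2 :> R by ring.
  by rewrite lerXn2r ?nnegrE ?normc_ge0 // normc_mon_corner.
have cQ : #|{: vertices * (bool * bool)}| = (m.+2 ^ n * 4)%N.
  by rewrite !card_prod card_bool card_ffun !card_ord.
have Q1 : (1 < #|{: vertices * (bool * bool)}|)%N.
  have q0 : (0 < m.+2 ^ n)%N by rewrite expn_gt0.
  by rewrite cQ; move: (m.+2 ^ n)%N q0 => k k0; lia.
have [e he] := exists_signs V0 vV Q1.
set b := 2 * Num.sqrt _ in he.
pose a (al : expo) : R[i] := if deg al == m then (((-1) ^+ e al)%:C)%C else 0.
have bE : 2 * b = 16 * Num.sqrt (C * ln (4 * m.+2%:R ^+ n)).
  rewrite /b cQ natrM natrX [m.+2%:R ^+ n * 4]mulrC -mulrA sqrtrM //.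
  have -> : Num.sqrt 16 = 4 :> R.
    by have -> : 16 = 4 ^+ 2 :> R; [ring|rewrite sqrtr_sqr ger0_norm].
  by ring.
have partE (f : R[i] -> R) (fD : forall x y, f (x + y) = f x + f y) (f0 : f 0 = 0)
    (fZ : forall (x : R) z, f ((x%:C)%C * z) = x * f z) ka :
    f (ev a (corner ka)) =
    \sum_s (-1) ^+ e s * (if deg s == m then f (mon s (corner ka)) else 0).
  rewrite /ev (big_morph f fD f0); apply: eq_bigr => s _; rewrite /a.
  case: ifP => _; first by rewrite fZ.
  by rewrite mul0r mulr0.
have ReE := partE (@complex.Re R) (@ReD R) erefl (@ReZ R).
have ImE := partE (@complex.Im R) (@ImD R) erefl (@ImZ R).
have sgn (s1 s2 : bool) ka : (-1) ^+ s1 * (if s2 then complex.Re (ev a (corner ka))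
    else complex.Im (ev a (corner ka))) <= b.
  apply: le_trans (he (ka, (s1, s2))); rewrite le_eqVlt; apply/orP; left; apply/eqP.
  rewrite ReE ImE /v /=; case: s2; rewrite mulr_sumr; apply: eq_bigr => s _;
  by case: ifP => _; rewrite ?mulr0 // mulrCA.
have aB z : @polydisc R n z -> normc (ev a z) <= 2 * b.
  move=> hz; apply: ev_corner => [ka|i]; last by rewrite ltW // hz.
  apply: normc_le_ReIm.
  - by have := sgn false true ka; rewrite expr0 mul1r.
  - by have := sgn true true ka; rewrite expr1 mulN1r.
  - by have := sgn false false ka; rewrite expr0 mul1r.
  - by have := sgn true false ka; rewrite expr1 mulN1r.
rewrite -bE; apply: le_trans (bohr_set_coef_le br aB).
rewrite le_eqVlt; apply/orP; left; apply/eqP; rewrite /C -card_degree mulr_suml.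
rewrite big_mkcond; apply: eq_bigr => al _; rewrite /a; case: eqP => [->|_].
  by rewrite normcC normrX normrN1 expr1n.
by rewrite ComplexField.Normc.normc0 mul0r.
Qed.

End RandomPolynomial.

(** * Asymptotics *)

Lemma expR_ge_quartic (R : realType) (y : R) : 0 <= y -> (1 + y / 4) ^+ 4 <= expR y.
Proof.
move=> y0; have -> : expR y = expR (y / 4) ^+ 4.
  by rewrite -expRM_natl; congr expR; rewrite mulrC divfK // pnatr_eq0.
by rewrite lerXn2r ?nnegrE ?expR_ge0 ?expR_ge1Dx // addr_ge0 // divr_ge0.
Qed.

Lemma inv_le_expR (R : realType) (x y : R) : 0 < x -> 1 <= x * (1 + y) -> x^-1 <= expR y.
Proof.
move=> x0 h; rewrite -[x^-1]mul1r ler_pdivrMr //; apply: le_trans h _.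
by rewrite [expR y * x]mulrC ler_pM2l // expR_ge1Dx.
Qed.

(* [ln 2 >= 5/8] *)
Lemma expR_le_pow2 (R : realType) (m : nat) : expR (5 / 8 * m%:R) <= 2 ^+ m :> R.
Proof.
rewrite mulrC expRM_natl lerXn2r ?nnegrE ?expR_ge0 //.
have h : 2^-1 <= expR (- (5 / 8)) :> R.
  have -> : - (5 / 8) = 4%:R * (- (5 / 32)) :> R by lra.
  rewrite expRM_natl; apply: (@le_trans _ _ ((1 + - (5 / 32)) ^+ 4)).
    by rewrite !exprS expr0; lra.
  by rewrite lerXn2r ?nnegrE ?expR_ge0 ?expR_ge1Dx //; lra.
by rewrite expRN lef_pV2 ?posrE ?expR_gt0 in h.
Qed.

(** The assumption [40 <= l] also excludes the small n at which [ln] takes default values. *)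
Lemma lnln_scale (R : realType) (n : nat) (l : R) : l = ln (ln n%:R) -> 40 <= l ->
  [/\ ln n%:R = expR l, n%:R = expR (ln n%:R) :> R, 100 <= expR l,
      2 * ln n%:R ^+ 2 <= n%:R :> R & 10 * l <= ln n%:R].
Proof.
move=> el l40.
have L1 : (1 : R) < ln n%:R.
  by rewrite ltNge; apply/negP => /ln_le0 h; move: l40; rewrite el; lra.
have n0 : (0 : R) < n%:R.
  by rewrite lt0r ler0n andbT; apply/eqP => h; move: L1; rewrite h ln0 //; lra.
have eL : ln n%:R = expR l :> R by rewrite el lnK // posrE; lra.
have en : n%:R = expR (ln n%:R) :> R by rewrite lnK.
set L := ln n%:R in L1 eL en el *.
have q : (1 + l / 4) ^+ 4 <= L by rewrite eL expR_ge_quartic //; lra.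
have qq : ((1 + l / 4) ^+ 2) ^+ 2 = (1 + l / 4) ^+ 4 by rewrite -exprM.
have s : 11 * (1 + l / 4) <= (1 + l / 4) ^+ 2 by rewrite expr2 ler_wpM2r //; lra.
have s2 : 121 <= (1 + l / 4) ^+ 2 by lra.
have s4 : 121 * (1 + l / 4) ^+ 2 <= (1 + l / 4) ^+ 4.
  by rewrite -qq [leRHS]expr2 ler_wpM2r //; lra.
have L4 : 100 <= L by lra.
split=> //; first by rewrite -eL.
  apply: (@le_trans _ _ ((1 + L / 4) ^+ 4)); last by rewrite [leRHS]en expR_ge_quartic //; lra.
  have t : 10 * (L / 4) <= (1 + L / 4) ^+ 2.
    by rewrite expr2 ler_pM //; lra.
  have -> : (1 + L / 4) ^+ 4 = ((1 + L / 4) ^+ 2) ^+ 2 by rewrite -exprM.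
  have : (10 * (L / 4)) ^+ 2 <= ((1 + L / 4) ^+ 2) ^+ 2.
    by rewrite lerXn2r ?nnegrE ?sqr_ge0 //; lra.
  by apply: le_trans; have := sqr_ge0 L; rewrite !expr2; lra.
by lra.
Qed.

Lemma powR_expR (R : realType) (x y : R) : (expR x) `^ y = expR (y * x).
Proof. by rewrite /powR gt_eqF ?expR_gt0 // expRK. Qed.

Lemma sqrt_expR (R : realType) (x : R) : Num.sqrt (expR x) = expR (x / 2).
Proof.
have -> : expR x = expR (x / 2) ^+ 2 by rewrite -expRM_natl; congr expR; lra.
by rewrite sqrtr_sqr gtr0_norm ?expR_gt0.
Qed.

Lemma bohr_radius_lower (R : realType) : exists T : R, forall n : nat,
  T <= ln (ln n%:R) ->
  Num.sqrt ((ln n%:R - 89 / 20 * ln (ln n%:R)) / n%:R) <= bohr_radius R n.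
Proof.
have [J J_large] := large_half_bound R; move Ec : ((base_const J)%:R : R) => c.
have c0 : 0 <= c by rewrite -Ec ler0n.
(* Chosen for [t1]: l / 40 >= K gives 512 c exp(-l/40) <= 1/6. *)
move EK : (6 * c * (64 * 8)) => K; have K0 : 0 <= K by rewrite -EK !mulr_ge0.
exists (40 + 40 * K) => n; have := @lnln_scale R n (ln (ln n%:R)) erefl.
move: (ln n%:R) => L; move: (ln L) => l scale lT.
have [|eL en] := scale; first by lra.
move=> L4 Ln lL {scale}; rewrite -eL in L4.
have n0 : (0 : R) < n%:R by rewrite en expR_gt0.
have L2n : 200 * L <= n%:R by move: Ln; rewrite expr2; nra.
move Er : ((L - 89 / 20 * l) / n%:R) => rho.
have nrho : n%:R * rho = L - 89 / 20 * l by rewrite -Er mulrC divfK // gt_eqF.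
have rho0 : 0 < rho by rewrite -Er divr_gt0 //; lra.
have rho8 : rho <= 1 / 8 by rewrite -Er ler_pdivrMr //; lra.
have r2 : Num.sqrt rho ^+ 2 = rho by rewrite sqr_sqrtr // ltW.
have r0 : 0 < Num.sqrt rho by rewrite sqrtr_gt0.
apply: bohr_radius_ge => // s s01.
have /andP[M1 M2] : ((Num.truncn (8 * L))%:R <= 8 * L < (Num.truncn (8 * L)).+1%:R).
  by apply: trunc_itv; lra.
move: (Num.truncn (8 * L)) M1 M2 => M M1 M2; rewrite -natr1 in M2.
apply: (@bohr_set_of_inequality R n J M) => //.
- by rewrite r0 /= -[X in _ < X]sqrtr1 ltr_sqrt; lra.
- by rewrite -(ltr_nat R); lra.
- by rewrite -(ler_nat R); lra.
- by rewrite r2; lra.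
rewrite r2 nrho Ec {Ec}.
(* Exponents of L: 6/5 + 1 from M and -89/40 from the root, in all -1/40. *)
have t1 : c * M%:R `^ (6 / 5) * M%:R * Num.sqrt (expR (L - 89 / 20 * l) / n%:R) <= 1 / 6.
  rewrite [n%:R in X in _ * X]en -expRN -expRD sqrt_expR.
  have eM : M%:R `^ (6 / 5) <= 64 * expR (6 / 5 * l) :> R.
    rewrite -powR_expR -eL; apply: (@le_trans _ _ ((8 * L) `^ (6 / 5))).
      by rewrite ge0_ler_powR ?nnegrE //; lra.
    rewrite powRM; [|lra|lra]; rewrite ler_wpM2r ?powR_ge0 //.
    apply: (@le_trans _ _ (8 `^ 2%:R)); first by rewrite ler_powR //; lra.
    by rewrite powR_mulrn // expr2; lra.
  have eM2 : M%:R `^ (6 / 5) * M%:R <= 64 * expR (6 / 5 * l) * (8 * expR l) :> R.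
    by rewrite ler_pM ?powR_ge0 // -eL.
  apply: (@le_trans _ _ (c * (64 * expR (6 / 5 * l) * (8 * expR l)) *
      expR ((L - 89 / 20 * l - L) / 2))).
    by rewrite ler_wpM2r ?expR_ge0 // -mulrA ler_wpM2l.
  have -> : c * (64 * expR (6 / 5 * l) * (8 * expR l)) * expR ((L - 89 / 20 * l - L) / 2) =
      c * (64 * 8) * (expR (- (l / 40))).
    have -> : expR (- (l / 40)) = expR (6 / 5 * l) * expR l * expR ((L - 89 / 20 * l - L) / 2).
      by rewrite -!expRD; congr expR; lra.
    by ring.
  have h : 1 + l / 40 <= expR (l / 40) by apply: expR_ge1Dx.
  rewrite expRN ler_pdivrMr ?expR_gt0 //; lra.
(* Under the root, at most of order L * (L^2 / n) * n L^(-89/20) = L^(-29/20). *)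
have t2 : Num.sqrt (M%:R * (n%:R * rho ^+ 2 * ((1 - rho)^-1) ^+ n)) <= 1 / 6.
  have -> : 1 / 6 = Num.sqrt ((1 / 6) ^+ 2) :> R by rewrite sqrtr_sqr gtr0_norm //; lra.
  rewrite ler_wsqrtr //.
  have nr2 : n%:R * rho ^+ 2 <= L ^+ 2 * expR (- L).
    rewrite expRN -en ler_pdivlMr // [leLHS](_ : _ = (n%:R * rho) ^+ 2); last first.
      by rewrite !expr2; ring.
    rewrite nrho lerXn2r ?nnegrE //; lra.
  have nr1 : n%:R * rho ^+ 2 <= 1 / 2.
    apply: le_trans nr2 _; rewrite expRN -en ler_pdivrMr //; lra.
  have e1 : (1 - rho)^-1 ^+ n <= 4 * expR (L - 89 / 20 * l).
    apply: (@le_trans _ _ (expR (rho + 2 * rho ^+ 2) ^+ n)).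
      rewrite lerXn2r ?nnegrE ?expR_ge0 ?invr_ge0 //; first lra.
      apply: inv_le_expR; first lra.
      have : 0 <= rho * rho * (1 - 2 * rho) by rewrite !mulr_ge0 //; lra.
      rewrite expr2; nra.
    rewrite -expRM_natl mulrDr nrho [expR (_ + n%:R * _)]expRD [expR _ * expR _]mulrC ler_wpM2r ?expR_ge0 //.
    have h := expR_le_pow2 R 2; rewrite expr2 in h.
    apply: (@le_trans _ _ (expR (5 / 8 * 2))); last by apply: le_trans h _; lra.
    rewrite ler_expR; lra.
  apply: (@le_trans _ _ (8 * L * (L ^+ 2 * expR (- L) * (4 * expR (L - 89 / 20 * l))))).
    apply: ler_pM => //; first by rewrite !mulr_ge0 ?sqr_ge0 ?exprn_ge0 ?invr_ge0 //; lra.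
    apply: ler_pM => //; first by rewrite mulr_ge0 ?sqr_ge0.
    by rewrite exprn_ge0 ?invr_ge0 //; lra.
  have -> : 8 * L * (L ^+ 2 * expR (- L) * (4 * expR (L - 89 / 20 * l))) =
      32 * expR (- (29 / 20 * l)).
    have -> : expR (- (29 / 20 * l)) = L * L ^+ 2 * (expR (- L) * expR (L - 89 / 20 * l)).
      rewrite -exprS {1}eL -expRM_natl -!expRD; congr expR; lra.
    by ring.
  have h : (1 + 29 / 20 * l / 4) ^+ 4 <= expR (29 / 20 * l) by apply: expR_ge_quartic; lra.
  have h1 : 15 <= 1 + 29 / 20 * l / 4 by lra.
  have h2 : 15 ^+ 4 <= (1 + 29 / 20 * l / 4) ^+ 4 by rewrite lerXn2r ?nnegrE //; lra.
  rewrite expRN ler_pdivrMr ?expR_gt0 //; move: h2; rewrite [15 ^+ 4]exprS !exprS expr0; lra.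
(* 2^(-M) <= exp(-5M/8) with M > 8L - 1 beats exp(4L). *)
have t3 : (2 ^+ M)^-1 * Num.sqrt ((1 - 4 * rho)^-1 ^+ n) <= 1 / 6.
  have s1 : Num.sqrt ((1 - 4 * rho)^-1 ^+ n) <= expR (4 * L).
    have -> : expR (4 * L) = Num.sqrt (expR (8 * L)) by rewrite sqrt_expR; congr expR; lra.
    rewrite ler_wsqrtr //; apply: (@le_trans _ _ (expR (8 * rho) ^+ n)).
      rewrite lerXn2r ?nnegrE ?expR_ge0 ?invr_ge0 //; first lra.
      apply: inv_le_expR; first lra.
      by have : 0 <= rho * (1 / 8 - rho) by [rewrite mulr_ge0 //; lra]; nra.
    rewrite -expRM_natl ler_expR mulrCA nrho; lra.
  have s2 : (2 ^+ M)^-1 <= expR (- (5 / 8 * M%:R)) :> R.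
    by rewrite expRN lef_pV2 ?posrE ?expR_gt0 ?exprn_gt0 // expR_le_pow2.
  apply: (@le_trans _ _ (expR (- (5 / 8 * M%:R)) * expR (4 * L))).
    by rewrite ler_pM ?sqrtr_ge0 // invr_ge0 exprn_ge0.
  rewrite -expRD; apply: (@le_trans _ _ (expR (- 50))); first by rewrite ler_expR; lra.
  have h : 1 + 50 <= expR 50 :> R by apply: expR_ge1Dx.
  rewrite expRN div1r lef_pV2 ?posrE ?expR_gt0 //; lra.
by lra.
Qed.

(** Stirling in the form m! <= e m (m/e)^m; the induction step is ln(1 + 1/m) >= 1/(m+1). *)
Lemma ln_fact_le (R : realType) (m : nat) : (0 < m)%N ->
  ln (m`!%:R) <= 1 + ln m%:R + m%:R * ln m%:R - m%:R :> R.
Proof.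
case: m => // m _; elim: m => [|m IH]; first by rewrite factS fact0 muln1 ln1; lra.
rewrite factS natrM lnM ?posrE ?ltr0n ?fact_gt0 //.
set x : R := m.+1%:R in IH *; have x1 : 1 <= x by rewrite ler1n.
have -> : m.+2%:R = x + 1 :> R by rewrite natr1.
have h : (x + 1) * ln x + 1 <= (x + 1) * ln (x + 1).
  have -> : ln (x + 1) = ln x - ln (1 - (x + 1)^-1).
    rewrite -ln_div ?posrE; [|lra|]; last by rewrite subr_gt0 invf_lt1; lra.
    by congr ln; field; lra.
  have : ln (1 - (x + 1)^-1) <= - (x + 1)^-1.
    rewrite -[X in _ <= X]expRK ler_ln ?posrE ?expR_gt0 ?expR_ge1Dx //.
    by rewrite subr_gt0 invf_lt1; lra.
  rewrite -(ler_pM2l (_ : 0 < x + 1)); last lra.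
  by rewrite mulrN divff; [lra|lra].
lra.
Qed.

Lemma ln_bin_ge (R : realType) (n m : nat) : (0 < m)%N -> (m < n)%N ->
  m%:R * ln (n%:R - m%:R) - (1 + ln m%:R + m%:R * ln m%:R - m%:R)
    <= ln 'C(n, m)%:R :> R.
Proof.
move=> m0 mn; rewrite lerBlDr; apply: le_trans (lerD (lexx _) (ln_fact_le R m0)).
rewrite -lnM ?posrE ?ltr0n ?bin_gt0 ?fact_gt0 ?(ltnW mn) // -natrM bin_ffact.
rewrite -natrB ?(ltnW mn) // mulrC mulr_natr -lnXn ?ltr0n ?subn_gt0 // -natrX.
rewrite ler_ln ?posrE ?ltr0n ?ffact_gt0 ?(ltnW mn) ?expn_gt0 ?subn_gt0 ?mn // ler_nat.
rewrite ffact_prod -[m in (_ ^ m)%N]card_ord -prod_nat_const leq_prod // => i _.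
by rewrite leq_sub2l // ltnW.
Qed.

(** The gap between 13/20 and 3/4 pays for the convexity of exp on [0, 1/10]. *)
Lemma expR_le_line (R : realType) (x : R) : 0 <= x -> x <= 1 / 10 ->
  expR (13 / 20 * x) <= 1 + 3 / 4 * x.
Proof.
move=> x0 x1; have h := expR_ge1Dx (- (13 / 20 * x)).
have {}h : expR (13 / 20 * x) <= (1 - 13 / 20 * x)^-1.
  by rewrite -[leLHS]invrK -expRN lef_pV2 ?posrE ?expR_gt0 //; lra.
apply: le_trans h _; rewrite -div1r ler_pdivrMr; last lra.
by have := mulr_ge0 x0 (_ : 0 <= 1 / 10 - x); rewrite subr_ge0 => /(_ x1); lra.
Qed.

Lemma bohr_radius_upper (R : realType) : exists T : R, forall n : nat,
  T <= ln (ln n%:R) ->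
  bohr_radius R n <=
    Num.sqrt (ln n%:R / n%:R) * (1 + 3 / 4 * (ln (ln n%:R) / ln n%:R)).
Proof.
exists 100 => n; have := @lnln_scale R n (ln (ln n%:R)) erefl; move EL : (ln n%:R) => L.
move El : (ln L) => l scale l100.
have [|eL] := scale; first by lra.
move=> en L4 Ln lL; rewrite -eL in L4.
have n0 : (0 : R) < n%:R by rewrite en expR_gt0.
have L2n : 200 * L <= n%:R by move: Ln; rewrite expr2; nra.
have x0 : 0 <= l / L by rewrite divr_ge0 //; lra.
have x5 : l / L <= 1 / 10 by rewrite ler_pdivrMr; lra.
apply: bohr_radius_le => [|r rS].
  by rewrite mulr_ge0 ?sqrtr_ge0 //; lra.
have r0 : 0 < r by case: rS => /andP[].
have /andP[M1 M2] : ((Num.truncn L)%:R <= L < (Num.truncn L).+1%:R).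
  by apply: trunc_itv; lra.
move: (Num.truncn L) M1 M2 => m M1 M2; rewrite -natr1 in M2.
have m0 : (0 < m)%N by rewrite -(ltr_nat R); lra.
have mn : (m < n)%N by rewrite -(ltr_nat R); lra.
have [w wP] := @primitive_root_exists R m.+2 isT.
have := @bohr_set_upper R n m m0 (ltnW mn) w wP r rS.
have C0 : (0 : R) < 'C(n, m)%:R by rewrite ltr0n bin_gt0 ltnW.
have := ln_bin_ge R m0 mn; move: ('C(n, m)%:R) C0 => C C0 lnC.
set arg := 4 * _; move ELam : (ln arg) => Lam up.
have lnm : ln m%:R <= l by rewrite -El ler_ln ?posrE ?ltr0n //; lra.
have lnnm : L - 2 * m%:R / n%:R <= ln (n%:R - m%:R).
  have nm : 0 < n%:R - m%:R :> R by lra.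
  have mn0 : 0 < m%:R / n%:R :> R by rewrite divr_gt0 // ltr0n.
  have mn1 : m%:R / n%:R <= 1 / 2 :> R by rewrite ler_pdivrMr //; lra.
  rewrite lerBlDr -lerBlDl -EL -ln_div ?posrE // -[leRHS]expRK ler_ln ?posrE ?expR_gt0 ?divr_gt0 //.
  have -> : n%:R / (n%:R - m%:R) = (1 - m%:R / n%:R)^-1 :> R by field; rewrite !gt_eqF.
  rewrite -mulrA; apply: inv_le_expR; first lra.
  by have : 0 <= m%:R / n%:R * (1 / 2 - m%:R / n%:R) :> R by [rewrite mulr_ge0 //; lra]; nra.
have mmn : m%:R * (2 * m%:R / n%:R) <= 1 :> R.
  rewrite mulrA ler_pdivrMr // mul1r; apply: le_trans Ln.
  by rewrite mulrCA ler_pM2l // expr2 ler_pM.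
have m2 : 1 <= m.+2%:R ^+ n :> R by rewrite exprn_ege1 // ler1n.
have Lam0 : 0 < Lam.
  by rewrite -ELam ln_gt0 /arg; move: m2; move: (m.+2%:R ^+ n) => y y1; lra.
have ln_lin (y : R) : 0 < y -> ln y <= y - 1 :> R.
  by move=> y0; rewrite -[leRHS]expRK ler_ln ?posrE ?expR_gt0 //; have := expR_ge1Dx (y - 1); lra.
have m2E : m.+2%:R = m%:R + 2 :> R by rewrite -addn2 natrD.
have LamE : Lam <= n%:R * (4 + l).
  rewrite -ELam lnM ?posrE ?(lt_le_trans ltr01 m2) //.
  rewrite lnXn ?ltr0n // -[ln m.+2%:R *+ n]mulr_natl.
  have : ln m.+2%:R <= ln (2 * L) by rewrite ler_ln ?posrE ?m2E; lra.
  rewrite lnM ?posrE //; [rewrite El => h|lra].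
  have h2 := ln_lin 2 (ltr0n R 2); have h4 := ln_lin 4 (ltr0n R 4).
  have : n%:R * ln m.+2%:R <= n%:R * (1 + l) by rewrite ler_pM2l //; lra.
  lra.
have lnLam : ln Lam <= L + 29 / 4 + l / 16.
  apply: (@le_trans _ _ (ln (n%:R * (4 + l)))).
    by rewrite ler_ln ?posrE // mulr_gt0 //; lra.
  rewrite lnM ?posrE //; last lra.
  rewrite EL -[L + _ + _]addrA lerD2l -[leRHS]expRK ler_ln ?posrE ?expR_gt0 //; last lra.
  have h : 0 <= 29 / 4 + l / 16 by lra.
  apply: le_trans (expR_ge_quartic h).
  have -> : (1 + (29 / 4 + l / 16) / 4) ^+ 4 = ((11 / 4 + (4 + l) / 64) ^+ 2) ^+ 2.
    by rewrite -exprM; congr (_ ^+ _); lra.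
  have -> : 4 + l = 64 * ((4 + l) / 64) by lra.
  have : 0 <= (4 + l) / 64 by lra.
  move: ((4 + l) / 64) => b b0; rewrite [64 * b / 64]mulrAC divff ?pnatr_eq0 // mul1r.
  have bb := mulr_ge0 b0 b0.
  apply: (@le_trans _ _ ((121 / 16 + 11 / 2 * b) ^+ 2)); first by rewrite expr2; lra.
  by rewrite lerXn2r ?nnegrE ?sqr_ge0 //; [lra|rewrite expr2; lra].
have ln16 : ln 16 <= 4 :> R.
  have h := @expR_ge_quartic R 4 (ler0n _ _).
  rewrite -[leRHS]expRK ler_ln ?posrE ?expR_gt0 //; apply: le_trans h.
  by rewrite !exprS expr0; lra.
have {}up : ln C + m%:R * ln r <= ln 16 + (ln C + ln Lam) / 2.
  have rm : 0 < r ^+ m by rewrite exprn_gt0.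
  have CL : 0 < C * Lam by rewrite mulr_gt0.
  have : ln (C * r ^+ m) <= ln (16 * Num.sqrt (C * Lam)).
    by rewrite ler_ln ?posrE ?mulr_gt0 ?sqrtr_gt0.
  rewrite [ln (C * _)]lnM ?posrE // lnXn // [m%:R * ln r]mulr_natl.
  by rewrite [ln (16 * _)]lnM ?posrE ?sqrtr_gt0 // ln_sqrt // [ln (C * _)]lnM ?posrE.
have h1 : m%:R * (L - 2 * m%:R / n%:R) <= m%:R * ln (n%:R - m%:R) by rewrite ler_wpM2l.
have h2 : m%:R * ln m%:R <= m%:R * l by rewrite ler_wpM2l.
move Ex : (l / L) => x in x0 x5 *; have xL : L * x = l by rewrite -Ex mulrC divfK; lra.
have h3 : (L - 1) * x <= m%:R * x by rewrite ler_wpM2r //; lra.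
(* Before division by m, the terms in l beyond m (l - L) / 2 are 1/2 from ln m and 1/32 from ln Lam;
   the distance from 17/32 to 13/20 absorbs the constants, as l >= 100. *)
have lnr : ln r <= (l - L) / 2 + 13 / 20 * x.
  rewrite -(ler_pM2l (_ : 0 < m%:R :> R)) ?ltr0n //.
  rewrite mulrBr in h1; rewrite mulrBl mul1r xL in h3; lra.
have -> : Num.sqrt (L / n%:R) = expR ((l - L) / 2).
  by rewrite eL en -expRN -expRD sqrt_expR -eL.
apply: (@le_trans _ _ (expR ((l - L) / 2 + 13 / 20 * x))); first by rewrite -[leLHS]lnK ?ler_expR.
by rewrite expRD ler_wpM2l ?expR_ge0 // expR_le_line.
Qed.

(** sqrt(1 - 89/20 x) >= 1 - 9/4 x for 0 <= x <= 1/400: the gap between 89/40 and 9/4 pays for the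
    quadratic term. And 9/4 = 3/2 + 3/4 is at most [beta_star] + 3/4. *)
Lemma bohr_radius_asymptotic (R : realType) : exists T : R, forall n : nat,
  T <= ln (ln n%:R) ->
  [/\ 0 < ln n%:R / n%:R :> R, 0 < ln (ln n%:R) / ln n%:R :> R &
    1 - 9 / 4 * (ln (ln n%:R) / ln n%:R)
      <= bohr_radius R n * Num.sqrt (n%:R / ln n%:R)
      <= 1 + 3 / 4 * (ln (ln n%:R) / ln n%:R)].
Proof.
have [T1 lower] := bohr_radius_lower R; have [T2 upper] := bohr_radius_upper R.
exists (Num.max (Num.max T1 T2) 100) => n; rewrite !ge_max -andbA => /and3P[l1 l2 l100].
move: (lower n l1) (upper n l2).
have := @lnln_scale R n (ln (ln n%:R)) erefl; move: (bohr_radius R n) => b.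
move: (ln n%:R) l100 => L; move: (ln L) => l l100 scale.
have [|eL en L4 _ _] := scale; first by lra.
have n0 : 0 < n%:R :> R by rewrite en expR_gt0.
have L0 : 0 < L by rewrite eL expR_gt0.
have lL : 400 * l <= L.
  have q : (1 + l / 4) ^+ 4 <= L by rewrite eL expR_ge_quartic //; lra.
  apply: le_trans q; have -> : (1 + l / 4) ^+ 4 = ((1 + l / 4) ^+ 2) ^+ 2 by rewrite -exprM.
  have s : 26 * (1 + l / 4) <= (1 + l / 4) ^+ 2 by rewrite expr2 ler_wpM2r //; lra.
  have : 676 * (1 + l / 4) ^+ 2 <= ((1 + l / 4) ^+ 2) ^+ 2.
    by rewrite [leRHS]expr2 ler_wpM2r ?sqr_ge0 //; lra.
  by lra.
have Ln0 : 0 < L / n%:R by rewrite divr_gt0.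
have s0 : 0 < Num.sqrt (L / n%:R) by rewrite sqrtr_gt0.
have -> : Num.sqrt (n%:R / L) = (Num.sqrt (L / n%:R))^-1 by rewrite -sqrtrV ?(ltW Ln0) // invf_div.
have x0 : 0 < l / L by rewrite divr_gt0 //; lra.
have x1 : 400 * (l / L) <= 1 by rewrite mulrA ler_pdivrMr //; lra.
have -> : (L - 89 / 20 * l) / n%:R = L / n%:R * (1 - 89 / 20 * (l / L)) by field; rewrite !gt_eqF.
rewrite [Num.sqrt (_ * (1 - _))]sqrtrM ?(ltW Ln0) // => lo up.
split=> //; rewrite ler_pdivlMr // ler_pdivrMr // mulrC [X in _ && (_ <= X)]mulrC up andbT.
apply: le_trans lo; rewrite ler_pM2l //; move: (l / L) x0 x1 => x x0 x1.
have h : 0 <= 1 - 9 / 4 * x by lra.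
by rewrite -[leLHS](ger0_norm h) -sqrtr_sqr ler_wsqrtr // expr2; nra.
Qed.

(** [B_cap] alone is at least 3/2, because mu <= 1. *)
Lemma beta_star_ge (R : realType) : 3 / 2 <= beta_star R.
Proof.
apply: lb_le_inf.
  (* An admissible a must be exhibited, as [inf] of the empty set is a default value. *)
  exists (Num.max (B_diff (a_max R / 2)) (B_cap (a_max R / 2))); exists (a_max R / 2) => //=.
  have : 0 < a_max R.
    rewrite /a_max mulr_gt0 ?invr_gt0 // subr_gt0 invf_lt1 ?sqrtr_gt0 //.
    by rewrite -[X in X < _]sqrtr1 ltr_sqrt // ltr1n.
  lra.
move=> _ [a /= /andP[a0 a1] <-]; rewrite le_max; apply/orP; right.
have a2 : a <= 1 / 2.
  have : 0 < (Num.sqrt 2 : R)^-1 by rewrite invr_gt0 sqrtr_gt0.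
  by move: a1; rewrite /a_max; lra.
have mu1 : 1 <= 2 * mu a <= 2.
  rewrite /mu mulrCA divff ?pnatr_eq0 // mulr1 lerDl sqrtr_ge0 /=.
  suff : Num.sqrt (2 * (1 - 2 * a) ^+ 2 - 1) <= 1 by lra.
  by rewrite -[leRHS]sqrtr1 ler_wsqrtr // expr2; nra.
by rewrite /B_cap ler_pM2l // lef_pV2 ?posrE; lra.
Qed.

Local Open Scope classical_set_scope.
Local Open Scope ring_scope.

Lemma near_lnln (R : realType) (T : R) : \forall n \near \oo, T <= ln (ln n%:R).
Proof.
near=> n; have h : expR (expR T) <= n%:R by near: n; exact: nbhs_infty_ger.
have n0 : 0 < n%:R :> R by apply: lt_le_trans h; exact: expR_gt0.
have h1 : expR T <= ln n%:R by rewrite -ler_expR lnK.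
by rewrite -ler_expR lnK // posrE; apply: lt_le_trans h1; exact: expR_gt0.
Unshelve. all: by end_near. Qed.

(** [limn_esup] is an infimum, over neighbourhoods of infinity, of suprema; the set where the bound
    holds is one of them. *)
Lemma limn_esup_le_near (R : realType) (u : nat -> \bar R) (B : \bar R) :
  (\forall n \near \oo, (u n <= B)%E) -> (limn_esup u <= B)%E.
Proof.
move=> uB; apply: (@le_trans _ _ (ereal_sup (u @` [set n | (u n <= B)%E]))).
  by apply: ereal_inf_lbound; exists [set n | (u n <= B)%E].
by apply: ge_ereal_sup => _ [n /= h <-].
Qed.

Theorem theorem10p5 (R : realType) :
  [/\ exists2 e : nat -> R, e n @[n --> \oo] --> (0 : R) &
        forall A : R, 2 * beta_star R + 3 / 2 < A ->
        \forall n \near \oo,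
          Num.sqrt ((ln n%:R - A * ln (ln n%:R)) / n%:R) <= bohr_radius R n
            <= Num.sqrt (ln n%:R / n%:R)
               * expR ((3 / 4 + e n) * (ln (ln n%:R) / ln n%:R)),
      exists2 g : nat -> R,
        g =O_\oo (fun n => ln (ln n%:R) / ln n%:R) &
        \forall n \near \oo,
          bohr_radius R n = Num.sqrt (ln n%:R / n%:R) * (1 + g n),
      (limn_esup (fun n => (ln n%:R / ln (ln n%:R) *
          (1 - bohr_radius R n * Num.sqrt (n%:R / ln n%:R)))%:E)
        <= (beta_star R + 3 / 4)%:E)%E &
      (limn_esup (fun n => (ln n%:R / ln (ln n%:R) *
          (bohr_radius R n * Num.sqrt (n%:R / ln n%:R) - 1))%:E)
        <= (3 / 4 : R)%:E)%E ].
Proof.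
have b32 := beta_star_ge R.
have [T asym] := bohr_radius_asymptotic R.
have sqrtV (n : nat) : 0 < ln n%:R / n%:R :> R ->
    Num.sqrt (ln n%:R / n%:R) * Num.sqrt (n%:R / ln n%:R) = 1 :> R.
  move=> h; rewrite -sqrtrM ?(ltW h) // -[n%:R / ln n%:R]invf_div divff ?sqrtr1 //.
  by rewrite gt_eqF.
split.
- exists (fun=> 0) => [|A hA]; first exact: cvg_cst.
  have [T1 lower] := bohr_radius_lower R; have [T2 upper] := bohr_radius_upper R.
  near=> n.
  have h1 : T1 <= ln (ln n%:R) by near: n; exact: near_lnln.
  have h2 : T2 <= ln (ln n%:R) by near: n; exact: near_lnln.
  have h3 : 0 <= ln (ln n%:R) :> R by near: n; exact: near_lnln.
  apply/andP; split.
    apply: le_trans (lower n h1); rewrite ler_wsqrtr // ler_wpM2r ?invr_ge0 ?ler0n //.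
    (* 89/20 < 9/2 < A, and ln ln n >= 0. *)
    by rewrite lerD2l lerN2 ler_wpM2r //; lra.
  apply: le_trans (upper n h2) _; rewrite ler_wpM2l ?sqrtr_ge0 //.
  by rewrite addr0 expR_ge1Dx.
- exists (fun n => bohr_radius R n * Num.sqrt (n%:R / ln n%:R) - 1).
    apply/eqOP; near=> k; near=> n.
    have [|_ x0] := asym n; first by near: n; exact: near_lnln.
    move=> /andP[lo up]; rewrite /= [X in _ <= _ * X]gtr0_norm //.
    apply: (@le_trans _ _ (9 / 4 * (ln (ln n%:R) / ln n%:R))).
      by rewrite ler_norml; lra.
    by rewrite ler_wpM2r ?(ltW x0) //; near: k; exact: nbhs_pinfty_ge.
  near=> n; have [|y0 _ _] := asym n; first by near: n; exact: near_lnln.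
  by rewrite addrC subrK mulrCA sqrtV ?mulr1.
- apply: limn_esup_le_near; near=> n.
  have [|_ x0 /andP[lo up]] := asym n; first by near: n; exact: near_lnln.
  rewrite lee_fin -invf_div mulrC ler_pdivrMr //.
  apply: (@le_trans _ _ (9 / 4 * (ln (ln n%:R) / ln n%:R))); first lra.
  by rewrite ler_wpM2r ?(ltW x0) //; lra.
- apply: limn_esup_le_near; near=> n.
  have [|_ x0 /andP[lo up]] := asym n; first by near: n; exact: near_lnln.
  by rewrite lee_fin -invf_div mulrC ler_pdivrMr //; lra.
Unshelve. all: by end_near. Qed.
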